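(* Let $n\ge 5$, let $m$ be odd, and let $C_{2m}\subset\mathfrak{S}_n$ be a cyclic subgroup of order $2m$. (a) (Galois case) For every field $F$ with absolute Galois group $\Gamma$ and every continuous homomorphism $\rho:\Gamma\to C_{2m}\subset\mathfrak{S}_n$, the twist ${}^{\rho}\overline{\mathcal M}_{0,n}$ is rational over $F$. (b) (Equivariant case) The action of $C_{2m}$ on $\overline{\mathcal M}_{0,n}$ is stably linearizable.
   Context: $\overline{\mathcal M}_{0,n}$ is the moduli space of stable $n$-pointed curves of genus zero; $\mathfrak{S}_n$ acts on it by permuting the marked points. For a homomorphism $\rho$ from the absolute Galois group of $F$ to $\mathfrak{S}_n$, the twist ${}^{\rho}\overline{\mathcal M}_{0,n}$ is the $F$-variety obtained by Galois descent, twisting the standard Galois action on $\overline{\mathcal M}_{0,n}$ by $\rho$. A generically free regular action of a finite group $G$ on a projective variety $X$ is linearizable if $X$ is $G$-equivariantly birational to $\mathbb{P}(V)$ for a linear representation $V$ of $G$; it is stably linearizable if $X\times\mathbb{P}^r$, with trivial action on the second factor, is linearizable for some $r$. *)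

(* Defs.v *)
From HB Require Import structures.
From mathcomp Require Import all_boot all_order all_algebra all_fingroup.
From mathcomp Require Import separable mxrepresentation.
From mathcomp Require Import mpoly.

Set Implicit Arguments.
Unset Strict Implicit.
Unset Printing Implicit Defensive.

Import GRing.Theory.
Local Open Scope ring_scope.

(** * Separable closures and absolute Galois groups *)

Definition separable_closure (F L : fieldType) (iota : {rmorphism F -> L}) :=
  (forall x : L, exists2 p : {poly F},
     separable_poly p & root (map_poly iota p) x) /\
  (forall p : {poly L}, separable_poly p -> (1 < size p)%N ->
     exists x, root p x).

(* When L is algebraic over F, every F-endomorphism of L is bijective, so for
   a separable closure L this is the whole group Gal(L / F). *)
Record absGal (F L : fieldType) (iota : {rmorphism F -> L}) := AbsGal {
  absGal_mor :> {rmorphism L -> L};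
  absGal_fix : forall a, absGal_mor (iota a) = iota a
}.

Lemma absGal_comp_fix (F L : fieldType) (iota : {rmorphism F -> L})
  (s t : absGal iota) (a : F) : (s \o t) (iota a) = iota a.
Proof. by rewrite /= !absGal_fix. Qed.

Definition absGal_comp (F L : fieldType) (iota : {rmorphism F -> L})
    (s t : absGal iota) : absGal iota :=
  @AbsGal F L iota (absGal_mor s \o absGal_mor t) (absGal_comp_fix s t).

(* The product of permutations is composition in the opposite order; this is
   immaterial below, where the image of rho is contained in a cyclic group. *)
Definition galois_hom (F L : fieldType) (iota : {rmorphism F -> L})
    (gT : finGroupType) (rho : absGal iota -> gT) :=
  forall s t, rho (absGal_comp s t) = (rho s * rho t)%g.

(* Krull topology on the source: the automorphisms agreeing with s on a finite
   subset of L form a basic neighbourhood of s. The target is discrete. *)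
Definition galois_continuous (F L : fieldType) (iota : {rmorphism F -> L})
    (gT : finGroupType) (rho : absGal iota -> gT) :=
  forall s : absGal iota, exists e : seq L, forall t : absGal iota,
    {in e, forall x, t x = s x} -> rho t = rho s.

(** * Varieties in products of projective spaces *)

(* A product of projective spaces, one factor for each element of [blocks];
   the homogeneous coordinates of the factor i are the j with block j = i. *)
Record multiproj := Multiproj {
  blocks : finType;
  coords : finType;
  block : coords -> blocks
}.

(* Points are represented by their homogeneous coordinates, and sets of points
   by predicates on these. *)
Definition hcoord (A : multiproj) (L : fieldType) := coords A -> L.

Definition is_point (A : multiproj) (L : fieldType) (x : hcoord A L) :=
  forall i : blocks A, exists2 j, block j = i & x j != 0.

Definition same_point (A : multiproj) (L : fieldType) (x y : hcoord A L) :=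
  exists c : blocks A -> L,
    (forall i, c i != 0) /\ (forall j, y j = c (block j) * x j).

Notation coord_ring A K := {mpoly K[#|coords A|]}.

(* D i is the degree in the coordinates of the factor i. *)
Definition multihomogeneous (A : multiproj) (K : fieldType)
    (D : blocks A -> nat) (p : coord_ring A K) :=
  forall m, m \in msupp p -> forall i,
    (\sum_(k < #|coords A| | block (enum_val k) == i) m k)%N = D i.

Definition mh_eval (A : multiproj) (K L : fieldType)
    (iota : {rmorphism K -> L}) (p : coord_ring A K) (x : hcoord A L) : L :=
  mmap iota (fun k => x (enum_val k)) p.

(* X is the set of L-points of a closed subvariety defined over K. The field L
   will be separably closed: K-varieties that are geometrically reduced are
   then determined by their L-points. *)
Definition closed_over (A : multiproj) (K L : fieldType)
    (iota : {rmorphism K -> L}) (X : hcoord A L -> Prop) :=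
  exists e : seq (coord_ring A K),
    {in e, forall p, exists D, multihomogeneous D p} /\
    (forall x, X x <->
       is_point x /\ {in e, forall p, mh_eval iota p x = 0}).

Definition open_over (A : multiproj) (K L : fieldType)
    (iota : {rmorphism K -> L}) (X U : hcoord A L -> Prop) :=
  exists e : seq (coord_ring A K),
    {in e, forall p, exists D, multihomogeneous D p} /\
    (forall x, U x <-> X x /\ exists2 p, p \in e & mh_eval iota p x != 0).

Definition dense_in (A : multiproj) (L : fieldType)
    (X U : hcoord A L -> Prop) :=
  forall (D : blocks A -> nat) (h : coord_ring A L), multihomogeneous D h ->
    (forall x, U x -> mh_eval idfun h x = 0) ->
    forall x, X x -> mh_eval idfun h x = 0.

(* A rational map to B, given by homogeneous coordinates. *)
Definition ratmap (A B : multiproj) (K : fieldType) :=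
  coords B -> coord_ring A K.

Definition ratmap_wf (A B : multiproj) (K : fieldType) (f : ratmap A B K) :=
  forall i : blocks B, exists D : blocks A -> nat,
    forall j, block j = i -> multihomogeneous D (f j).

Definition ratmap_eval (A B : multiproj) (K L : fieldType)
    (iota : {rmorphism K -> L}) (f : ratmap A B K) (x : hcoord A L) :
    hcoord B L :=
  fun j => mh_eval iota (f j) x.

Definition is_morphism (A B : multiproj) (L : fieldType)
    (X : hcoord A L -> Prop) (Y : hcoord B L -> Prop)
    (phi : hcoord A L -> hcoord B L) :=
  (forall x, X x -> Y (phi x)) /\
  (forall x, X x -> exists f : ratmap A B L,
    [/\ ratmap_wf f, is_point (ratmap_eval idfun f x)
      & forall y, X y -> is_point (ratmap_eval idfun f y) ->
          same_point (ratmap_eval idfun f y) (phi y)]).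

Definition is_isomorphism (A B : multiproj) (L : fieldType)
    (X : hcoord A L -> Prop) (Y : hcoord B L -> Prop)
    (phi : hcoord A L -> hcoord B L) :=
  is_morphism X Y phi /\
  exists psi, [/\ is_morphism Y X psi,
    forall x, X x -> same_point x (psi (phi x))
    & forall y, Y y -> same_point y (phi (psi y))].

(* f and g are mutually inverse isomorphisms, over K, between the dense open
   subsets U of X and V of Y. *)
Definition birational_via (A B : multiproj) (K L : fieldType)
    (iota : {rmorphism K -> L})
    (X U : hcoord A L -> Prop) (Y V : hcoord B L -> Prop)
    (f : ratmap A B K) (g : ratmap B A K) :=
  [/\ open_over iota X U /\ dense_in X U,
      open_over iota Y V /\ dense_in Y V,
      ratmap_wf f /\ ratmap_wf g,
      forall x, U x -> V (ratmap_eval iota f x) /\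
        same_point x (ratmap_eval iota g (ratmap_eval iota f x))
    & forall y, V y -> U (ratmap_eval iota g y) /\
        same_point y (ratmap_eval iota f (ratmap_eval iota g y))].

Definition birational_over (A B : multiproj) (K L : fieldType)
    (iota : {rmorphism K -> L})
    (X : hcoord A L -> Prop) (Y : hcoord B L -> Prop) :=
  exists U V f g, @birational_via A B K L iota X U Y V f g.

Definition equivariantly_birational_over (A B : multiproj) (K L : fieldType)
    (iota : {rmorphism K -> L}) (gT : finGroupType) (G : {group gT})
    (actX : gT -> hcoord A L -> hcoord A L) (X : hcoord A L -> Prop)
    (actY : gT -> hcoord B L -> hcoord B L) (Y : hcoord B L -> Prop) :=
  exists U V f g,
    [/\ @birational_via A B K L iota X U Y V f g,
        forall a x, a \in G -> U x -> U (actX a x),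
        forall a y, a \in G -> V y -> V (actY a y)
      & forall a x, a \in G -> U x ->
          same_point (ratmap_eval iota f (actX a x))
                     (actY a (ratmap_eval iota f x))].

Definition projspace (d : nat) : multiproj :=
  @Multiproj unit 'I_d.+1 (fun=> tt).

Definition rational_over (A : multiproj) (K L : fieldType)
    (iota : {rmorphism K -> L}) (X : hcoord A L -> Prop) :=
  exists d, birational_over iota X (@is_point (projspace d) L).

Definition prod_mp (A B : multiproj) : multiproj :=
  @Multiproj (blocks A + blocks B)%type (coords A + coords B)%type
    (fun j => match j with inl a => inl (block a) | inr b => inr (block b) end).

Definition prod_set (A B : multiproj) (L : fieldType)
    (X : hcoord A L -> Prop) (Y : hcoord B L -> Prop) :
    hcoord (prod_mp A B) L -> Prop :=
  fun x => X (fun j => x (inl j)) /\ Y (fun j => x (inr j)).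

(** * Linearizability *)

Definition act_fst (A B : multiproj) (L : fieldType) (gT : finGroupType)
    (act : gT -> hcoord A L -> hcoord A L) (a : gT)
    (x : hcoord (prod_mp A B) L) : hcoord (prod_mp A B) L :=
  fun j => match j with
           | inl j1 => act a (fun j => x (inl j)) j1
           | inr j2 => x (inr j2)
           end.

(* Both this action and the action on pointed curves below are right actions,
   the convention for permutations and for representations on row vectors. *)
Definition proj_act (K L : fieldType) (iota : {rmorphism K -> L})
    (gT : finGroupType) (G : {group gT}) (d : nat)
    (rV : mx_representation K G d.+1) (a : gT) (x : hcoord (projspace d) L) :
    hcoord (projspace d) L :=
  fun j => ((\row_(k < d.+1) x k) *m map_mx iota (rV a)) 0 j.

Definition linearizable (A : multiproj) (K L : fieldType)
    (iota : {rmorphism K -> L}) (gT : finGroupType) (G : {group gT})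
    (act : gT -> hcoord A L -> hcoord A L) (X : hcoord A L -> Prop) :=
  exists d (rV : mx_representation K G d.+1),
    equivariantly_birational_over iota G act X
      (proj_act iota rV) (@is_point (projspace d) L).

Definition stably_linearizable (A : multiproj) (K L : fieldType)
    (iota : {rmorphism K -> L}) (gT : finGroupType) (G : {group gT})
    (act : gT -> hcoord A L -> hcoord A L) (X : hcoord A L -> Prop) :=
  exists r, linearizable iota G (@act_fst A (projspace r) L gT act)
              (prod_set X (@is_point (projspace r) L)).

(** * Stable pointed curves of genus zero and their moduli space *)

(* Homogeneous coordinates on P^1; two nonzero vectors define distinct points
   exactly when their bracket does not vanish. *)
Definition bracket (L : fieldType) (a b : 'rV[L]_2) : L :=
  a 0 0 * b 0 1 - a 0 1 * b 0 0.

(* A stable n-pointed nodal curve of genus 0 all of whose components are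
   projective lines. The special points of a component v are the marked points
   inl i lying on v and the nodes inr w where v meets another component w; the
   vector special_pt v s is the position of s on v, with no meaning if s is not
   special on v. Genus 0 means that the dual graph is a tree. *)
Record stable_curve (L : fieldType) (n : nat) := StableCurve {
  component : finType;
  meets : rel component;
  mark_on : 'I_n -> component;
  special_pt : component -> 'I_n + component -> 'rV[L]_2;
  special := fun v (s : 'I_n + component) =>
    match s with inl i => mark_on i == v | inr w => meets v w end;
  meets_irr : irreflexive meets;
  meets_sym : forall v w, meets v w = meets w v;
  dual_connected : forall v w, connect meets v w;
  dual_acyclic : forall c, ucycleb meets c -> (size c <= 2)%N;
  special_distinct : forall v s t, special v s -> special v t -> s != t ->
    bracket (special_pt v s) (special_pt v t) != 0;
  special_stable : forall v, (3 <= #|[pred s | special v s]|)%N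
}.

(* The contraction of the curve onto its component v sends the marked point i
   to the special point s of v. *)
Definition seen_at (L : fieldType) (n : nat) (E : stable_curve L n)
    (v : component E) (s : 'I_n + component E) (i : 'I_n) : bool :=
  match s with
  | inl j => (j == i) && (mark_on E i == v)
  | inr w => meets v w &&
      connect [rel x y | [&& meets x y, x != v & y != v]] w (mark_on E i)
  end.

Definition quad (n : nat) := {q : {ffun 'I_4 -> 'I_n} | injectiveb q}.

(* One factor P^1 = \bar M_{0,4} for each ordered quadruple of marked points. *)
Definition quad_space (n : nat) : multiproj :=
  @Multiproj (quad n) (quad n * 'I_2)%type fst.

(* The coordinates of E are the cross-ratios of the images in P^1 = v of the
   quadruples of marked points. When three of the four images coincide, the
   equation reads 0 = 0; this fails to happen for at least one v, and all such
   v give the same cross-ratio. *)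
Definition crossratios_of (L : fieldType) (n : nat) (E : stable_curve L n)
    (x : hcoord (quad_space n) L) :=
  is_point x /\
  forall (q : quad n) (v : component E) (s : 'I_4 -> 'I_n + component E),
    (forall t, seen_at v (s t) (val q t)) ->
    let a t := special_pt v (s t) in
    x (q, 0) * (bracket (a 0) (a 3) * bracket (a 1) (a 2)) =
    x (q, 1) * (bracket (a 0) (a 2) * bracket (a 1) (a 3)).

(* \bar M_{0,n} over a separably closed field L: isomorphism classes of stable
   n-pointed curves of genus 0 are identified with their systems of
   cross-ratios, and the structure of variety is that given by the closed
   embedding, by these cross-ratios, in a product of copies of \bar M_{0,4}
   (Gerritzen, Herrlich and van der Put). *)
Definition Mbar (L : fieldType) (n : nat) : hcoord (quad_space n) L -> Prop :=
  fun x => exists E : stable_curve L n, crossratios_of E x.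

Lemma perm_quad_inj (n : nat) (g : 'S_n) (q : quad n) :
  injectiveb [ffun t => g (val q t)].
Proof.
apply/injectiveP => s t; rewrite !ffunE => /perm_inj.
exact: (injectiveP _ (valP q)).
Qed.

Definition perm_quad (n : nat) (g : 'S_n) (q : quad n) : quad n :=
  exist _ [ffun t => g (val q t)] (perm_quad_inj g q).

(* The marked point i of a curve becomes the marked point g i of its image
   under g. *)
Definition perm_act (n : nat) (L : fieldType) (g : 'S_n)
    (x : hcoord (quad_space n) L) : hcoord (quad_space n) L :=
  fun j => x (perm_quad g^-1 j.1, j.2).

(** * Twists *)

Definition galois_act (A : multiproj) (F L : fieldType)
    (iota : {rmorphism F -> L}) (s : absGal iota) (x : hcoord A L) :
    hcoord A L := fun j => s (x j).

(* Y is the F-variety obtained by Galois descent from \bar M_{0,n} over L with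
   the twisted Galois action x |-> rho(s)(s(x)): it is a projective variety over
   F with an isomorphism to \bar M_{0,n} over L that carries the Galois action
   on the points of Y to the twisted one. *)
Definition is_twist_Mbar (n : nat) (F L : fieldType)
    (iota : {rmorphism F -> L}) (rho : absGal iota -> 'S_n)
    (A : multiproj) (Y : hcoord A L -> Prop) :=
  closed_over iota Y /\
  exists phi : hcoord A L -> hcoord (quad_space n) L,
    is_isomorphism Y (@Mbar L n) phi /\
    forall (s : absGal iota) y, Y y ->
      same_point (phi (galois_act s y))
                 (perm_act (rho s) (galois_act s (phi y))).

(* Main.v *)
(* Cauchy interpolation gives coordinates on M_{0,n} on which a permutation of order 2 m, with m odd, acts
   linearly.
   Let O be a set of 2 r + 3 marked points and let u_i in L^(2 + r), for i in O, be powers of distinct scalars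
   y_i. A rational function of degree r + 1 is determined by its values at the y_i; hence, up to PGL_2, a
   generic configuration is (u_i R) for i in O, with a unique matrix R whose first two rows are the identity,
   and the lower rows of R, together with affine coordinates for the points outside O, are coordinates. A
   permutation preserving O and the y_i permutes them. When all orbits are even, O is a union of two halves
   exchanged by the permutation; each half is interpolated separately and the two results are compared by an
   involution of the projective line, which adds three permuted parameters. When there are only fixed points
   and transpositions, r = 0 and constant u_i suffice.
   For a twist, take y_i in a separable closure permuted by the Galois group through rho; the coordinates are
   then permuted too, and Hilbert 90 makes them linear, so the twist is rational. For the stable statement,
   the y_i are replaced by functions on M_{0,n} x P^R, again permuted: R extra variables suffice to turn an
   equivariant system of labels of the marked points into a permutation representation (no-name lemma).
   Birationality is checked on the open set of smooth curves, which is dense since every stable curve is a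
   limit of smooth ones (plumbing). *)
Require Import Defs.
From HB Require Import structures.
From mathcomp Require Import all_boot all_order all_algebra all_fingroup cyclic.
From mathcomp Require Import separable mxrepresentation mpoly.
From mathcomp Require Import ring zify.
From mathcomp Require boolp classical_sets.
From Stdlib Require Import Classical ClassicalEpsilon.

Set Implicit Arguments.
Unset Strict Implicit.
Unset Printing Implicit Defensive.

Import GRing.Theory.
Local Open Scope ring_scope.

(** * Multihomogeneous forms and points *)

(** Proportionality of [u_i Q] and [Z_i] is one linear equation on the 2 r + 4 entries of [Q], so 2
    r + 3 nodes leave a single solution up to scalar; its entries are maximal minors, hence
    polynomial in the data. An invariant set of nodes, or half of one, must thus have odd size. This
    is where m odd enters: no cycle length is divisible by 4, so that, short cycles apart, there is
    an odd cycle, an even cycle completed by a fixed point, or an even cycle with odd halves. Each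
    case leaves n - 3 parameters. A twist has its parameters over the separable closure only,
    whereas open sets and maps must be over F. Identities are therefore proved on any open set, the
    maps are averaged over Galois conjugates, and irreducibility spreads the identities to the
    natural domains. In the stable case the nodes must be readable on the target. The labels are
    not, since they depend on the configuration to be rebuilt. The nodes are instead the values at
    the labels of a polynomial with indeterminate coefficients. *)

Section Multihomogeneous.
Variables (A : multiproj) (K : fieldType).
Implicit Types (D : blocks A -> nat) (p q : coord_ring A K).

Lemma mh0 D : multihomogeneous D (0 : coord_ring A K).
Proof. by move=> m; rewrite msupp0. Qed.

Lemma mhC (c : K) : multihomogeneous (fun=> 0%N) (c%:MP : coord_ring A K).
Proof.
move=> m; rewrite msuppC; case: eqP => // _; rewrite inE => /eqP -> i.
by rewrite big1 // => k _; rewrite mnm0E.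
Qed.

Lemma mhD D p q : multihomogeneous D p -> multihomogeneous D q ->
  multihomogeneous D (p + q).
Proof.
by move=> hp hq m /msuppD_le; rewrite mem_cat => /orP[/hp|/hq].
Qed.

Lemma mhN D p : multihomogeneous D p -> multihomogeneous D (- p).
Proof. by move=> hp m; rewrite (perm_mem (msuppN _)) => /hp. Qed.

Lemma mhM D1 D2 p q : multihomogeneous D1 p -> multihomogeneous D2 q ->
  multihomogeneous (fun i => D1 i + D2 i)%N (p * q).
Proof.
move=> hp hq m /msuppM_le /allpairsP[[m1 m2] /= [/hp h1 /hq h2 ->]] i.
by rewrite -h1 -h2 -big_split; apply: eq_bigr => k _; rewrite mnmDE.
Qed.

Lemma mh_eqD D1 D2 p : D1 =1 D2 ->
  multihomogeneous D1 p -> multihomogeneous D2 p.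
Proof. by move=> e h m hm i; rewrite -e h. Qed.

Lemma mhX (j : coords A) :
  multihomogeneous (fun i => (block j == i : nat))
    ('X_(enum_rank j) : coord_ring A K).
Proof.
move=> m; rewrite msuppX inE => /eqP -> i; under eq_bigr do rewrite mnm1E.
rewrite big_mkcond (bigD1 (enum_rank j)) //= enum_rankK eqxx big1 ?addn0.
  by case: ifP.
by move=> k; rewrite eq_sym => /negPf ->; case: ifP.
Qed.

Lemma mh_sum D (I : Type) (r : seq I) (P : pred I) (F : I -> coord_ring A K) :
  (forall i, P i -> multihomogeneous D (F i)) ->
  multihomogeneous D (\sum_(i <- r | P i) F i).
Proof.
move=> h; elim/big_rec: _ => [|i p Pi hp]; first exact: mh0.
by apply: mhD => //; apply: h.
Qed.

Lemma mh_prod (I : Type) (r : seq I) (P : pred I) (D : I -> blocks A -> nat)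
    (F : I -> coord_ring A K) :
  (forall i, P i -> multihomogeneous (D i) (F i)) ->
  multihomogeneous (fun b => \sum_(i <- r | P i) D i b)%N
    (\prod_(i <- r | P i) F i).
Proof.
move=> h; elim: r => [|i r ih].
  rewrite big_nil -mpolyC1; apply: (mh_eqD _ (@mhC 1)) => b; by rewrite big_nil.
rewrite big_cons; case: ifP => Pi; last first.
  by apply: (mh_eqD _ ih) => b; rewrite big_cons Pi.
by apply: (mh_eqD _ (mhM (h i Pi) ih)) => b; rewrite big_cons Pi.
Qed.

Lemma mhX_exp D p k : multihomogeneous D p ->
  multihomogeneous (fun i => k * D i)%N (p ^+ k).
Proof.
move=> hp; elim: k => [|k ih]; first by rewrite expr0 -mpolyC1; apply: mhC.
by rewrite exprS; apply: (mh_eqD _ (mhM hp ih)) => b; rewrite mulSn.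
Qed.

End Multihomogeneous.
Arguments mhC {A K} c.
Arguments mhX {A K} j.

Lemma mh_map (A : multiproj) (K K' : fieldType) (f : {rmorphism K -> K'})
    (D : blocks A -> nat) (p : coord_ring A K) :
  multihomogeneous D p -> multihomogeneous D (map_mpoly f p).
Proof.
move=> hp m hm; apply: hp; move: hm; rewrite !mcoeff_msupp mcoeff_map_mpoly.
by apply: contraNneq => ->; rewrite raddf0.
Qed.

Section Eval.
Variables (A : multiproj) (K L : fieldType) (iota : {rmorphism K -> L}).
Implicit Types (p q : coord_ring A K) (x y : hcoord A L).

Definition mev (x : hcoord A L) : coord_ring A K -> L :=
  mmap iota (fun k => x (enum_val k)).
HB.instance Definition _ x := GRing.RMorphism.on (mev x).

Lemma mevE x p : mh_eval iota p x = mev x p. Proof. by []. Qed.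

Lemma mh_eval1 x : mh_eval iota 1 x = 1 :> L.
Proof. by rewrite mevE rmorph1. Qed.
Lemma mh_evalD x p q : mh_eval iota (p + q) x = mh_eval iota p x + mh_eval iota q x.
Proof. by rewrite !mevE rmorphD. Qed.
Lemma mh_evalN x p : mh_eval iota (- p) x = - mh_eval iota p x.
Proof. by rewrite !mevE rmorphN. Qed.
Lemma mh_evalM x p q : mh_eval iota (p * q) x = mh_eval iota p x * mh_eval iota q x.
Proof. by rewrite !mevE rmorphM. Qed.
Lemma mh_evalXn x p k : mh_eval iota (p ^+ k) x = mh_eval iota p x ^+ k.
Proof. by rewrite !mevE rmorphXn. Qed.
Lemma mh_eval_sum x (I : Type) (r : seq I) (P : pred I) (F : I -> coord_ring A K) :
  mh_eval iota (\sum_(i <- r | P i) F i) x = \sum_(i <- r | P i) mh_eval iota (F i) x.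
Proof. by rewrite mevE rmorph_sum. Qed.
Lemma mh_eval_prod x (I : Type) (r : seq I) (P : pred I) (F : I -> coord_ring A K) :
  mh_eval iota (\prod_(i <- r | P i) F i) x = \prod_(i <- r | P i) mh_eval iota (F i) x.
Proof. by rewrite mevE rmorph_prod. Qed.
Lemma mh_evalC x (c : K) : mh_eval iota (c%:MP : coord_ring A K) x = iota c.
Proof. by rewrite /mh_eval mmapC. Qed.
Lemma mh_evalX x (j : coords A) :
  mh_eval iota ('X_(enum_rank j) : coord_ring A K) x = x j.
Proof. by rewrite /mh_eval mmapX mmap1U enum_rankK. Qed.

Lemma mh_eval_scale (D : blocks A -> nat) p (c : blocks A -> L) x y :
  multihomogeneous D p -> (forall j, y j = c (block j) * x j) ->
  mh_eval iota p y = (\prod_i c i ^+ D i) * mh_eval iota p x.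
Proof.
move=> hp hy; rewrite /mh_eval /mmap big_distrr /= big_seq [RHS]big_seq.
apply: eq_bigr => m hm; rewrite mulrCA; congr (_ * _).
have -> : mmap1 (fun k => y (enum_val k)) m =
    \prod_k (c (block (enum_val k)) ^+ m k * x (enum_val k) ^+ m k).
  by apply: eq_bigr => k _; rewrite hy exprMn.
rewrite big_split /=; congr (_ * _).
rewrite [LHS](partition_big (fun k => block (enum_val k)) predT) //=.
apply: eq_bigr => i _; rewrite -(hp m hm i) expr_sum.
by apply: eq_bigr => k /eqP ->.
Qed.

End Eval.

Lemma mh_eval_map (A : multiproj) (K K' L : fieldType) (f : {rmorphism K -> K'})
    (iota : {rmorphism K' -> L}) (iota' : {rmorphism K -> L}) (p : coord_ring A K) x :
  (forall a, iota (f a) = iota' a) ->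
  mh_eval iota (map_mpoly f p) x = mh_eval iota' p x.
Proof.
move=> e; pose w := maxn (msize p) (msize (map_mpoly f p)).
rewrite /mh_eval (mmapE w) ?leq_maxr // [RHS](mmapE w) ?leq_maxl //.
by apply: eq_bigr => m _; rewrite mcoeff_map_mpoly; congr (_ * _); exact: e.
Qed.

Lemma mh_eval_conj (A : multiproj) (L : fieldType) (s : {rmorphism L -> L})
    (p : coord_ring A L) (x : hcoord A L) :
  mh_eval idfun (map_mpoly s p) (fun j => s (x j)) = s (mh_eval idfun p x).
Proof.
rewrite (@mh_eval_map _ _ _ _ s idfun s) // /mh_eval /mmap rmorph_sum.
apply: eq_bigr => m _; rewrite rmorphM; congr (_ * _).
by rewrite rmorph_prod; apply: eq_bigr => k _; rewrite rmorphXn.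
Qed.

Section Points.
Variables (A : multiproj) (L : fieldType).
Implicit Types x y z : hcoord A L.

Lemma same_point_refl x : same_point x x.
Proof. by exists (fun=> 1); split=> [i|j]; rewrite ?oner_neq0 ?mul1r. Qed.

Lemma same_point_sym x y : same_point x y -> same_point y x.
Proof.
case=> c [c0 e]; exists (fun i => (c i)^-1); split=> [i|j].
  by rewrite invr_eq0.
by rewrite e mulKf.
Qed.

Lemma same_point_trans x y z : same_point x y -> same_point y z -> same_point x z.
Proof.
case=> c [c0 e] [d [d0 e']]; exists (fun i => d i * c i); split=> [i|j].
  by rewrite mulf_neq0.
by rewrite e' e mulrA.
Qed.

Lemma same_point_eq x y : x =1 y -> same_point x y.
Proof. by move=> e; exists (fun=> 1); split=> [i|j]; rewrite ?oner_neq0 ?mul1r. Qed.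

Lemma is_point_same x y : same_point x y -> is_point x -> is_point y.
Proof.
by case=> c [c0 e] hx i; have [j hj xj] := hx i; exists j => //; rewrite e mulf_neq0.
Qed.

Lemma same_point_cross x y : same_point x y ->
  forall j k, block j = block k -> x j * y k = x k * y j.
Proof. by case=> c [c0 e] j k h; rewrite !e h mulrCA [RHS]mulrCA [x j * _]mulrC. Qed.

Lemma cross_same_point x y : is_point x -> is_point y ->
  (forall j k, block j = block k -> x j * y k = x k * y j) -> same_point x y.
Proof.
move=> hx hy h.
have /fin_all_exists[c hc] : forall i : blocks A, exists c : L,
    c != 0 /\ forall j, block j = i -> y j = c * x j.
  move=> i; have [j hj xj] := hx i; have [k hk yk] := hy i.
  exists (y j / x j); split.
    rewrite mulf_neq0 ?invr_eq0 //; apply: contraNneq yk => yj.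
    have := h j k (etrans hj (esym hk)); rewrite yj mulr0 => /eqP.
    by rewrite mulf_eq0 (negPf xj).
  move=> l hl; have := h j l (etrans hj (esym hl)) => e.
  by rewrite mulrAC -[y j * _]mulrC -e mulrAC mulfV // mul1r.
exists c; split=> [i|j]; first by case: (hc i).
by case: (hc (block j)) => _; apply.
Qed.

End Points.

Lemma mh_eval_neq0_same (A : multiproj) (K L : fieldType) (iota : {rmorphism K -> L})
    D (p : coord_ring A K) (x y : hcoord A L) :
  multihomogeneous D p -> same_point x y ->
  mh_eval iota p x != 0 -> mh_eval iota p y != 0.
Proof.
move=> hp [c [c0 e]] h; rewrite (mh_eval_scale _ hp e) mulf_neq0 //.
by apply/prodf_neq0 => i _; rewrite expf_neq0.
Qed.

Lemma mh_eval_eq0_same (A : multiproj) (K L : fieldType) (iota : {rmorphism K -> L})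
    D (p : coord_ring A K) (x y : hcoord A L) :
  multihomogeneous D p -> same_point x y ->
  mh_eval iota p x = 0 -> mh_eval iota p y = 0.
Proof. by move=> hp [c [c0 e]] h; rewrite (mh_eval_scale _ hp e) h mulr0. Qed.

(** * Regular functions *)

Section Regular.
Variables (A : multiproj) (K L : fieldType) (iota : {rmorphism K -> L}).
Implicit Types (W X : hcoord A L -> Prop) (f g : hcoord A L -> L).
Local Notation ev := (mh_eval iota).

(** One quotient of forms of equal multidegree is asked for on all of [W], not a local one. The
    class is then stable under determinants and inverse matrices without coverings, and finitely
    many such functions combine into one rational map. *)
Definition regular W f := exists D (p q : coord_ring A K),
  [/\ multihomogeneous D p, multihomogeneous D q &
      forall x, W x -> ev q x != 0 /\ f x = ev p x / ev q x].

(** A single form is asked for, so that the relation is transitive: successive genericity conditions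
    multiply into one form. *)
Definition basic_open W W' := exists D (e : coord_ring A K),
  multihomogeneous D e /\ forall x, W' x <-> W x /\ ev e x != 0.

Lemma regular_sub W W' f : (forall x, W' x -> W x) -> regular W f -> regular W' f.
Proof.
by move=> s [D [p [q [hp hq h]]]]; exists D, p, q; split=> // x /s /h.
Qed.

Lemma regular_ext W f g : (forall x, W x -> f x = g x) -> regular W f -> regular W g.
Proof.
move=> s [D [p [q [hp hq h]]]]; exists D, p, q; split=> // x Wx.
by rewrite -s //; apply: h.
Qed.

Lemma regular_const W (c : K) : regular W (fun=> iota c).
Proof.
exists (fun=> 0%N), c%:MP, 1; split; first exact: mhC.
  by rewrite -mpolyC1; apply: mhC.
by move=> x _; rewrite mh_eval1 mh_evalC divr1 oner_neq0.
Qed.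

Lemma regular0 W : regular W (fun=> 0).
Proof. by apply: regular_ext (regular_const W 0) => x _; rewrite rmorph0. Qed.

Lemma regular1 W : regular W (fun=> 1).
Proof. by apply: regular_ext (regular_const W 1) => x _; rewrite rmorph1. Qed.

Lemma regularD W f g : regular W f -> regular W g -> regular W (fun x => f x + g x).
Proof.
move=> [D [p [q [hp hq h]]]] [D' [p' [q' [hp' hq' h']]]].
exists (fun i => D i + D' i)%N, (p * q' + p' * q), (q * q'); split.
- apply: mhD; first exact: mhM.
  by apply: (mh_eqD _ (mhM hp' hq)) => i; rewrite addnC.
- exact: mhM.
move=> x Wx; have [q0 ->] := h x Wx; have [q0' ->] := h' x Wx.
by rewrite !mh_evalD !mh_evalM mulf_neq0 // addf_div.
Qed.

Lemma regularM W f g : regular W f -> regular W g -> regular W (fun x => f x * g x).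
Proof.
move=> [D [p [q [hp hq h]]]] [D' [p' [q' [hp' hq' h']]]].
exists (fun i => D i + D' i)%N, (p * p'), (q * q'); split; try exact: mhM.
move=> x Wx; have [q0 ->] := h x Wx; have [q0' ->] := h' x Wx.
by rewrite !mh_evalM mulf_neq0 // mulf_div.
Qed.

Lemma regularN W f : regular W f -> regular W (fun x => - f x).
Proof.
move=> h; have := regularM (regular_const W (-1)) h.
by apply: regular_ext => x _; rewrite rmorphN rmorph1 mulN1r.
Qed.

Lemma regularB W f g : regular W f -> regular W g -> regular W (fun x => f x - g x).
Proof. by move=> hf /regularN hg; apply: regularD. Qed.

Lemma regularV W f : (forall x, W x -> f x != 0) -> regular W f ->
  regular W (fun x => (f x)^-1).
Proof.
move=> n0 [D [p [q [hp hq h]]]]; exists D, q, p; split=> // x Wx.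
have [q0 e] := h x Wx; have := n0 x Wx; rewrite e invf_div => pq0; split=> //.
by apply: contraNneq pq0 => ->; rewrite mul0r.
Qed.

Lemma regular_sum W (I : Type) (r : seq I) (P : pred I) (F : I -> hcoord A L -> L) :
  (forall i, P i -> regular W (F i)) -> regular W (fun x => \sum_(i <- r | P i) F i x).
Proof.
move=> h; elim: r => [|i r ih].
  by apply: regular_ext (regular0 W) => x _; rewrite big_nil.
case: (boolP (P i)) => Pi.
  apply: regular_ext (regularD (h i Pi) ih) => x _; by rewrite big_cons Pi.
by apply: regular_ext ih => x _; rewrite big_cons (negPf Pi).
Qed.

Lemma regular_prod W (I : Type) (r : seq I) (P : pred I) (F : I -> hcoord A L -> L) :
  (forall i, P i -> regular W (F i)) -> regular W (fun x => \prod_(i <- r | P i) F i x).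
Proof.
move=> h; elim: r => [|i r ih].
  by apply: regular_ext (regular1 W) => x _; rewrite big_nil.
case: (boolP (P i)) => Pi.
  apply: regular_ext (regularM (h i Pi) ih) => x _; by rewrite big_cons Pi.
by apply: regular_ext ih => x _; rewrite big_cons (negPf Pi).
Qed.

Lemma regularX W f k : regular W f -> regular W (fun x => f x ^+ k).
Proof.
move=> h; elim: k => [|k ih]; first exact: regular_ext (regular1 W).
by apply: regular_ext (regularM h ih) => x _; rewrite exprS.
Qed.

Lemma regular_coord W j k : block j = block k -> (forall x, W x -> x k != 0) ->
  regular W (fun x => x j / x k).
Proof.
move=> e n0; exists (fun i => (block j == i : nat)), 'X_(enum_rank j), 'X_(enum_rank k).
split; first exact: mhX.
  by rewrite e; apply: mhX.
by move=> x Wx; rewrite !mh_evalX n0.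
Qed.

Lemma regular_det W n (M : hcoord A L -> 'M[L]_n) :
  (forall i j, regular W (fun x => M x i j)) -> regular W (fun x => \det (M x)).
Proof.
move=> h; apply: regular_sum => s _; apply: regularM.
  apply: regular_ext (regular_const W ((-1) ^+ s)) => x _.
  by rewrite rmorph_sign.
exact: regular_prod.
Qed.

Lemma regular_mulmx W m n l (M : hcoord A L -> 'M[L]_(m, n))
    (N : hcoord A L -> 'M[L]_(n, l)) :
  (forall i j, regular W (fun x => M x i j)) ->
  (forall i j, regular W (fun x => N x i j)) ->
  forall i j, regular W (fun x => (M x *m N x) i j).
Proof.
move=> hM hN i j.
apply: (@regular_ext _ (fun x => \sum_k M x i k * N x k j)).
  by move=> x _; rewrite mxE.
by apply: regular_sum => k _; apply: regularM.
Qed.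

Lemma regular_adj W n (M : hcoord A L -> 'M[L]_n) :
  (forall i j, regular W (fun x => M x i j)) ->
  forall i j, regular W (fun x => \adj (M x) i j).
Proof.
move=> h i j.
apply: (@regular_ext _ (fun x => cofactor (M x) j i)).
  by move=> x _; rewrite mxE.
apply: regularM.
  apply: regular_ext (regular_const W ((-1) ^+ (j + i))) => x _.
  by rewrite rmorph_sign.
apply: regular_det => a b.
by apply: (@regular_ext _ (fun x => M x (lift j a) (lift i b))) => // x _; rewrite !mxE.
Qed.

Lemma regular_invmx W n (M : hcoord A L -> 'M[L]_n) :
  (forall x, W x -> M x \in unitmx) ->
  (forall i j, regular W (fun x => M x i j)) ->
  forall i j, regular W (fun x => invmx (M x) i j).
Proof.
move=> u h i j.
apply: (@regular_ext _ (fun x => (\det (M x))^-1 * \adj (M x) i j)).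
  by move=> x /u ux; rewrite /invmx ux [RHS]mxE.
apply: regularM; last exact: regular_adj.
apply: regularV (regular_det h) => x /u; by rewrite unitmxE unitfE.
Qed.

Lemma basic_refl W : basic_open W W.
Proof.
exists (fun=> 0%N), 1; split; first by rewrite -mpolyC1; apply: mhC.
by move=> x; rewrite mh_eval1 oner_neq0; split=> [//|[]].
Qed.

Lemma basic_trans W1 W2 W3 : basic_open W1 W2 -> basic_open W2 W3 -> basic_open W1 W3.
Proof.
move=> [D [e [he h]]] [D' [e' [he' h']]].
exists (fun i => D i + D' i)%N, (e * e'); split; first exact: mhM.
move=> x; rewrite h' h mh_evalM mulf_eq0 negb_or.
split; first by case=> [[? ->] ->].
by case=> ? /andP[].
Qed.

Lemma basic_sub W W' : basic_open W W' -> forall x, W' x -> W x.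
Proof. by case=> D [e [_ h]] x /h[]. Qed.

Lemma basic_step W f : regular W f -> basic_open W (fun x => W x /\ f x != 0).
Proof.
move=> [D [p [q [hp hq h]]]]; exists D, p; split=> // x.
split=> -[Wx]; have [q0 ->] := h x Wx; rewrite ?mulf_eq0 ?invr_eq0 ?(negPf q0) ?orbF.
  by [].
by [].
Qed.

Lemma basic_eq W W1 W2 : (forall x, W1 x <-> W2 x) -> basic_open W W1 -> basic_open W W2.
Proof. by move=> e [D [p [hp h]]]; exists D, p; split=> // x; rewrite -e h. Qed.

Lemma basic_all W (I : eqType) (r : seq I) (F : I -> hcoord A L -> L) :
  (forall i, i \in r -> regular W (F i)) ->
  basic_open W (fun x => W x /\ forall i, i \in r -> F i x != 0).
Proof.
move=> h; have := basic_step (@regular_prod W _ r (fun i => i \in r) F h).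
apply: basic_eq => x; split=> -[Wx H]; split=> //.
  by move: H; rewrite prodf_seq_neq0 => /allP H i ir; have := H i ir; rewrite ir.
by rewrite prodf_seq_neq0; apply/allP => i ir; rewrite ir H.
Qed.

Lemma regular_same W f x y : regular W f -> W x -> W y -> same_point x y -> f x = f y.
Proof.
move=> [D [p [q [hp hq h]]]] Wx Wy [c [c0 e]].
have [qx ->] := h x Wx; have [qy ->] := h y Wy.
rewrite (mh_eval_scale iota hp e) (mh_eval_scale iota hq e) -mulf_div mulfV ?mul1r //.
by apply/prodf_neq0 => i _; rewrite expf_neq0.
Qed.

Lemma basic_same W W' x y : basic_open W W' -> W' x -> W y -> same_point x y -> W' y.
Proof.
move=> [D [e [he h]]] /h [Wx ex] Wy s; apply/h; split=> //.
exact: mh_eval_neq0_same he s ex.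
Qed.

Lemma basic_open_over X W : basic_open X W -> open_over iota X W.
Proof.
move=> [D [e [he h]]]; exists [:: e]; split.
  by move=> p; rewrite inE => /eqP ->; exists D.
move=> x; rewrite h; split=> -[Xx].
  by move=> ex; split=> //; exists e; rewrite ?inE.
by case=> p; rewrite inE => /eqP ->.
Qed.

End Regular.

Section RegularEval.
Variables (A B : multiproj) (K L : fieldType) (iota : {rmorphism K -> L}).

(** Clearing denominators: each numerator is multiplied by the denominators of all the other
    coordinates. The products share one multidegree, and the factor [c] is the same in all
    blocks. *)
Lemma ratmap_of_regular (W : hcoord A L -> Prop) (F : coords B -> hcoord A L -> L) :
  (forall j, regular iota W (F j)) ->
  exists f : ratmap A B K, (exists D, forall j, multihomogeneous D (f j)) /\
    forall x, W x -> exists2 c, c != 0 & forall j, ratmap_eval iota f x j = c * F j x.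
Proof.
move=> /fin_all_exists[D /fin_all_exists[p /fin_all_exists[q h]]].
exists (fun j => p j * \prod_(k | k != j) q k); split.
  exists (fun b => \sum_(k : coords B) D k b)%N => j.
  apply: (@mh_eqD _ _ (fun b => D j b + \sum_(k | k != j) D k b)%N).
    by move=> b; rewrite [RHS](bigD1 j).
  have [hp _ _] := h j; apply: mhM => //.
  by apply: mh_prod => k _; case: (h k).
move=> x Wx; exists (\prod_k mh_eval iota (q k) x).
  by apply/prodf_neq0 => k _; have [_ _ /(_ x Wx)[]] := h k.
move=> j; rewrite /ratmap_eval mh_evalM mh_eval_prod [in RHS](bigD1 j) //=.
have [_ _ /(_ x Wx)[q0 ->]] := h j.
by field.
Qed.

Lemma ratmap_same (f : ratmap A B K) (x y : hcoord A L) : ratmap_wf f ->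
  same_point x y -> same_point (ratmap_eval iota f x) (ratmap_eval iota f y).
Proof.
move=> /fin_all_exists[D hD] [c [c0 e]].
exists (fun i => \prod_b c b ^+ D i b); split.
  by move=> i; apply/prodf_neq0 => b _; rewrite expf_neq0.
by move=> j; apply: mh_eval_scale (hD _ _ erefl) e.
Qed.

End RegularEval.

Section Pullback.
Variables (A B : multiproj) (K : fieldType).

Definition pullback (f : ratmap A B K) (p : coord_ring B K) : coord_ring A K :=
  mmap (@mpolyC _ K) (fun k => f (enum_val k)) p.

Lemma pullbackE (L : fieldType) (iota : {rmorphism K -> L}) f p (x : hcoord A L) :
  mh_eval iota (pullback f p) x = mh_eval iota p (ratmap_eval iota f x).
Proof.
rewrite /pullback /mmap mh_eval_sum; apply: eq_bigr => m _.
rewrite mh_evalM mh_evalC; congr (_ * _).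
by rewrite mh_eval_prod; apply: eq_bigr => k _; rewrite mh_evalXn.
Qed.

Lemma mh_pullback f (E : blocks B -> blocks A -> nat) D p :
  (forall j, multihomogeneous (E (block j)) (f j)) -> multihomogeneous D p ->
  multihomogeneous (fun a => \sum_b D b * E b a)%N (pullback f p).
Proof.
move=> hf hp; rewrite /pullback /mmap big_seq; apply: mh_sum => m hm.
have h1 := mh_prod (r := index_enum 'I_#|coords B|) (P := predT)
  (fun k _ => mhX_exp (k := m k) (hf (enum_val k))).
apply: (mh_eqD _ (mhM (mhC p@_m) h1)) => a /=; rewrite add0n.
rewrite (partition_big (fun k => block (enum_val k)) predT) //=.
apply: eq_bigr => b _; rewrite -(hp m hm b) big_distrl /=.
by apply: eq_bigr => k /eqP ->.
Qed.

Lemma mh_pullback_wf f D p : ratmap_wf f -> multihomogeneous D p ->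
  exists D', multihomogeneous D' (pullback f p).
Proof.
move=> /fin_all_exists[E hE] hp.
by exists (fun a => \sum_b D b * E b a)%N; apply: mh_pullback hp => j; apply: hE.
Qed.

End Pullback.

(** * Generic properties and irreducibility *)

Section Generic.
Variables (A : multiproj) (L : fieldType).
Implicit Types (X P Q : hcoord A L -> Prop) (x y : hcoord A L).
Local Notation ev := (mh_eval idfun).

(** Irreducibility phrased on forms: two nonempty principal open subsets meet. *)
Definition irreducible_set X := forall D1 D2 (h1 h2 : coord_ring A L),
  multihomogeneous D1 h1 -> multihomogeneous D2 h2 ->
  (exists2 x, X x & ev h1 x != 0) -> (exists2 x, X x & ev h2 x != 0) ->
  exists x, [/\ X x, ev h1 x != 0 & ev h2 x != 0].

Definition generically X P := exists D (h : coord_ring A L),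
  [/\ multihomogeneous D h, exists2 x, X x & ev h x != 0
    & forall x, X x -> ev h x != 0 -> P x].

Lemma generically_mono X P Q : (forall x, X x -> P x -> Q x) ->
  generically X P -> generically X Q.
Proof. by move=> s [D [h [hh he hP]]]; exists D, h; split=> // x Xx /(hP x Xx); apply: s. Qed.

Lemma generically_ex X P : generically X P -> exists2 x, X x & P x.
Proof. by case=> D [h [hh [x Xx hx] hP]]; exists x => //; apply: hP. Qed.

Lemma generically_basic X P : basic_open idfun X P -> (exists x, P x) -> generically X P.
Proof.
move=> [D [h [hh e]]] [x /e[Xx hx]]; exists D, h; split=> //; first by exists x.
by move=> y Xy hy; apply/e.
Qed.

Lemma generically_and X P Q : irreducible_set X ->
  generically X P -> generically X Q -> generically X (fun x => P x /\ Q x).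
Proof.
move=> irr [D [h [hh he hP]]] [D' [h' [hh' he' hQ]]].
exists (fun i => D i + D' i)%N, (h * h'); split; first exact: mhM.
  have [x [Xx hx hx']] := irr _ _ _ _ hh hh' he he'.
  by exists x => //; rewrite mh_evalM mulf_neq0.
move=> x Xx; rewrite mh_evalM mulf_eq0 negb_or => /andP[hx hx'].
by split; [apply: hP | apply: hQ].
Qed.

Lemma generically_true X : (exists x, X x) -> generically X X.
Proof. exact/generically_basic/basic_refl. Qed.

Lemma generically_all X (I : eqType) (r : seq I) (P : I -> hcoord A L -> Prop) :
  irreducible_set X -> (exists x, X x) ->
  (forall i, i \in r -> generically X (P i)) ->
  generically X (fun x => forall i, i \in r -> P i x).
Proof.
move=> irr X0; elim: r => [|i r ih] h.
  by apply: generically_mono (generically_true X0).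
have hi := h i (mem_head _ _).
have hr : generically X (fun x => forall j, j \in r -> P j x).
  by apply: ih => j jr; apply: h; rewrite inE jr orbT.
apply: generically_mono (generically_and irr hi hr) => x _ [Pi Pr] j.
by rewrite inE => /orP[/eqP ->|/Pr].
Qed.

Lemma generically_dense X P : irreducible_set X -> generically X P -> dense_in X P.
Proof.
move=> irr [D [h [hh he hP]]] D' h' hh' v x Xx; apply/eqP/negP => /negP n0.
have [y [Xy hy /eqP hy']] := irr _ _ _ _ hh hh' he (ex_intro2 _ _ x Xx n0).
by apply: hy'; apply: v; apply: hP.
Qed.

Lemma generically_zero X D (h : coord_ring A L) : irreducible_set X ->
  multihomogeneous D h -> generically X (fun x => ev h x = 0) ->
  forall x, X x -> ev h x = 0.
Proof. by move=> irr hh g; apply: (generically_dense irr g hh). Qed.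

End Generic.

Lemma basic_openL (A : multiproj) (K L : fieldType) (iota : {rmorphism K -> L})
    (X W : hcoord A L -> Prop) : basic_open iota X W -> basic_open idfun X W.
Proof.
move=> [D [e [he h]]]; exists D, (map_mpoly iota e); split; first exact: mh_map.
by move=> x; rewrite h (@mh_eval_map _ _ _ _ iota idfun iota).
Qed.

(** * Polynomial one-parameter families, limits and irreducibility *)

Section Families.
Variables (A : multiproj) (L : fieldType).
Hypothesis Linf : forall s : seq L, exists x, x \notin s.

Lemma poly_nonroot (p : {poly L}) : p != 0 -> exists t, p.[t] != 0.
Proof.
move=> p0; case: (classic (exists t, p.[t] != 0)) => // H; exfalso.
have r0 t : root p t.
  by apply/rootP/eqP/negPn/negP => h; apply: H; exists t.
have [s us sz] : exists2 s : seq L, uniq s & size s = size p.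
  elim: (size p) => [|n [s us <-]]; first by exists [::].
  by have [x xs] := Linf s; exists (x :: s) => //=; rewrite xs.
by have := max_poly_roots p0 (introT allP (fun t _ => r0 t)) us; rewrite sz ltnn.
Qed.

Definition fam_at (X : coords A -> {poly L}) (t : L) : hcoord A L := fun j => (X j).[t].

Lemma fam_eval (X : coords A -> {poly L}) (h : coord_ring A L) :
  exists P : {poly L}, forall t, P.[t] = mh_eval idfun h (fam_at X t).
Proof.
exists (\sum_(m <- msupp h) h@_m *: \prod_k X (enum_val k) ^+ m k) => t.
rewrite horner_sum; apply: eq_bigr => m _; rewrite hornerZ horner_prod.
by congr (_ * _); apply: eq_bigr => k _; rewrite horner_exp.
Qed.

(** A form evaluated along a polynomial family is a polynomial in t. If it vanishes wherever [b]
    does not, its product with [b] vanishes on the infinite field [L], so it is zero and vanishes at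
    the special value [t0] too. *)
Lemma fam_zero (X : coords A -> {poly L}) D (h : coord_ring A L) (b : {poly L}) t0 x :
  multihomogeneous D h -> b != 0 ->
  (forall t, b.[t] != 0 -> mh_eval idfun h (fam_at X t) = 0) ->
  same_point (fam_at X t0) x -> mh_eval idfun h x = 0.
Proof.
move=> hh b0 H s; apply: mh_eval_eq0_same hh s _.
have [P hP] := fam_eval X h; rewrite -hP.
have [->|Pn0] := eqVneq P 0; first by rewrite horner0.
have [t] := poly_nonroot (mulf_neq0 b0 Pn0).
by rewrite hornerM mulf_eq0 negb_or => /andP[/H e]; rewrite (hP t) e eqxx.
Qed.

Variables X X0 : hcoord A L -> Prop.
Hypothesis limits : forall x, X x -> exists (F : coords A -> {poly L}) (b : {poly L}),
  [/\ b != 0, same_point (fam_at F 0) x & forall t, b.[t] != 0 -> X0 (fam_at F t)].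

Lemma limit_zero D (h : coord_ring A L) : multihomogeneous D h ->
  (forall x, X0 x -> mh_eval idfun h x = 0) -> forall x, X x -> mh_eval idfun h x = 0.
Proof.
move=> hh v x /limits[F [b [b0 s H]]]; apply: fam_zero hh b0 _ s => t /H.
exact: v.
Qed.

(** Taking limits reduces to points [x] and [y] of [X0] where the respective forms are nonzero.
    Along a family through [x] at t = 0 and [y] at t = 1 both forms become nonzero polynomials in t,
    and a value of t off their roots and those of [b] gives a common point of nonvanishing. *)
Lemma irreducible_of_families :
  (forall x y, X0 x -> X0 y -> exists (F : coords A -> {poly L}) (b : {poly L}),
    [/\ b != 0, same_point (fam_at F 0) x, same_point (fam_at F 1) y
      & forall t, b.[t] != 0 -> X (fam_at F t)]) ->
  irreducible_set X.
Proof.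
move=> con D1 D2 h1 h2 hh1 hh2.
have red D h : multihomogeneous D h -> (exists2 x, X x & mh_eval idfun h x != 0) ->
    exists2 x, X0 x & mh_eval idfun h x != 0.
  move=> hh [x Xx hx]; apply: NNPP => N; move/eqP: hx; apply.
  apply: (limit_zero hh) => // y X0y; apply/eqP/negPn/negP => hy.
  by apply: N; exists y.
move=> /(red _ _ hh1)[x X0x hx] /(red _ _ hh2)[y X0y hy].
have [F [b [b0 s0 s1 H]]] := con x y X0x X0y.
have [P1 hP1] := fam_eval F h1; have [P2 hP2] := fam_eval F h2.
have P10 : P1 != 0.
  apply: contraNneq (mh_eval_neq0_same hh1 (same_point_sym s0) hx) => e.
  by rewrite -hP1 e horner0.
have P20 : P2 != 0.
  apply: contraNneq (mh_eval_neq0_same hh2 (same_point_sym s1) hy) => e.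
  by rewrite -hP2 e horner0.
have [t] := poly_nonroot (mulf_neq0 b0 (mulf_neq0 P10 P20)).
rewrite !hornerM !mulf_eq0 !negb_or => /andP[bt /andP[]].
by rewrite hP1 hP2 => ? ?; exists (fam_at F t); split=> //; apply: H.
Qed.

End Families.

(** Being a point asks for one nonzero coordinate in each block. The products that choose one
    coordinate per block turn this into the nonvanishing of some form in a finite list, as
    [open_over] requires. *)
Definition point_tests (A B : multiproj) (K : fieldType) (f : ratmap A B K) :=
  image (fun k : {ffun blocks B -> coords B} => \prod_b f (k b))
    [pred k : {ffun blocks B -> coords B} | [forall b, block (k b) == b]].

Section PointTests.
Variables (A B : multiproj) (K L : fieldType) (iota : {rmorphism K -> L}).
Variables (f : ratmap A B K) (f_wf : ratmap_wf f).

Lemma point_testsP x : is_point (ratmap_eval iota f x) <->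
  exists2 p, p \in point_tests f & mh_eval iota p x != 0.
Proof.
split=> [/fin_all_exists2[k hk fk]|[p /imageP[k /forallP hk ->]]].
  exists (\prod_b f (k b)); last by rewrite mh_eval_prod; apply/prodf_neq0 => b _; apply: fk.
  apply/imageP; exists [ffun b => k b]; last by apply: eq_bigr => b _; rewrite ffunE.
  by apply/forallP => b; rewrite ffunE hk.
rewrite mh_eval_prod => /prodf_neq0 h b.
by exists (k b); [apply/eqP | apply: h].
Qed.

Lemma point_tests_mh p : p \in point_tests f -> exists D, multihomogeneous D p.
Proof.
move=> /imageP[k /forallP hk ->]; have /fin_all_exists[D hD] := f_wf.
exists (fun a => \sum_b D b a)%N; apply: mh_prod => b _.
by apply: hD; apply/eqP.
Qed.

End PointTests.

(** * Birational maps from identities that hold generically *)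

Section BirationalCriterion.
Variables (K L : fieldType) (iota : {rmorphism K -> L}).

Definition inverse_at (A B : multiproj) (f : ratmap A B K) (g : ratmap B A K)
    (Y : hcoord B L -> Prop) (x : hcoord A L) :=
  [/\ Y (ratmap_eval iota f x), is_point (ratmap_eval iota g (ratmap_eval iota f x))
    & same_point x (ratmap_eval iota g (ratmap_eval iota f x))].

(** These natural domains serve as the open sets of [birational_via]: they are cut out over [K],
    whatever the open set over [L] on which the inverse identities are first proved, and [f] and [g]
    exchange them. *)
Definition roundtrip_dom (A B : multiproj) (f : ratmap A B K) (g : ratmap B A K)
    (X : hcoord A L -> Prop) (x : hcoord A L) :=
  [/\ X x, is_point (ratmap_eval iota f x)
    & is_point (ratmap_eval iota g (ratmap_eval iota f x))].

Lemma closed_vanish (A : multiproj) (X : hcoord A L -> Prop) D (p : coord_ring A K) :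
  irreducible_set X -> multihomogeneous D p ->
  generically X (fun x => mh_eval iota p x = 0) -> forall x, X x -> mh_eval iota p x = 0.
Proof.
move=> irr hp g x Xx; rewrite -(@mh_eval_map _ _ _ _ iota idfun iota) //.
apply: (@generically_zero _ _ X D _ irr (mh_map hp) _ x Xx).
by apply: generically_mono g => y _ e; rewrite (@mh_eval_map _ _ _ _ iota idfun iota).
Qed.

(** Membership in the closed set [Y] and proportionality of coordinates are both vanishing
    conditions for forms over [K] on [X]. Holding generically on an irreducible set, they hold
    wherever the maps are defined. *)
Lemma roundtrip (A B : multiproj) (f : ratmap A B K) (g : ratmap B A K)
    (X : hcoord A L -> Prop) (Y : hcoord B L -> Prop) :
  ratmap_wf f -> ratmap_wf g -> closed_over iota X -> closed_over iota Y ->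
  irreducible_set X -> generically X (inverse_at f g Y) ->
  forall x, roundtrip_dom f g X x -> Y (ratmap_eval iota f x) /\
    same_point x (ratmap_eval iota g (ratmap_eval iota f x)).
Proof.
move=> wf wg [eX [_ cX]] [eY [hY cY]] irr gen x [Xx fx gfx]; split.
  apply/cY; split=> // p pe; have [D hD] := hY p pe.
  have [D' hD'] := mh_pullback_wf wf hD.
  rewrite -pullbackE; apply: (closed_vanish irr hD') => //.
  by apply: generically_mono gen => y _ [/cY[_ /(_ p pe)]]; rewrite pullbackE.
apply: cross_same_point => //; first by case/cX: Xx.
move=> j k jk; have [D hD] := wg (block k).
have /fin_all_exists[E hE] := wf.
have hj := mh_pullback (fun j => hE _ _ erefl) (hD j jk).
have hk := mh_pullback (fun j => hE _ _ erefl) (hD k erefl).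
pose q := 'X_(enum_rank j) * pullback f (g k) - 'X_(enum_rank k) * pullback f (g j).
have [D' hq] : exists D', multihomogeneous D' q.
  eexists; apply: (mhD (mhM (mhX j) hk)).
  by apply: mhN; apply: (mh_eqD _ (mhM (mhX k) hj)) => i; rewrite jk.
have : mh_eval iota q x = 0.
  apply: (closed_vanish irr hq) => //; apply: generically_mono gen.
  move=> y _ [_ _ /same_point_cross s].
  by rewrite mh_evalD mh_evalN !mh_evalM !mh_evalX !pullbackE /ratmap_eval s // subrr.
rewrite mh_evalD mh_evalN !mh_evalM !mh_evalX !pullbackE => /eqP.
by rewrite subr_eq0 => /eqP.
Qed.

Lemma roundtrip_open (A B : multiproj) (f : ratmap A B K) (g : ratmap B A K)
    (X : hcoord A L -> Prop) : ratmap_wf f -> ratmap_wf g ->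
  open_over iota X (roundtrip_dom f g X).
Proof.
move=> wf wg.
exists [seq p * pullback f q | p <- point_tests f, q <- point_tests g]; split.
  move=> r /allpairsP[[p q] /= [hp hq ->]].
  have [D hD] := point_tests_mh wf hp; have [D' hD'] := point_tests_mh wg hq.
  have [E hE] := mh_pullback_wf wf hD'.
  by eexists; apply: mhM hD hE.
move=> x; split.
  case=> Xx /point_testsP[p hp px] /point_testsP[q hq qx]; split=> //.
  exists (p * pullback f q); first by apply/allpairsP; exists (p, q).
  by rewrite mh_evalM pullbackE mulf_neq0.
case=> Xx [r /allpairsP[[p q] /= [hp hq ->]]].
rewrite mh_evalM pullbackE mulf_eq0 negb_or => /andP[px qx].
by split=> //; apply/point_testsP; [exists p | exists q].
Qed.

(** Since g f x is the point x, the coordinates of f g f x are those of f x up to scalars, hence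
    define a point. *)
Lemma roundtrip_mem (A B : multiproj) (f : ratmap A B K) (g : ratmap B A K)
    (X : hcoord A L -> Prop) (Y : hcoord B L -> Prop) :
  ratmap_wf f -> ratmap_wf g -> closed_over iota X -> closed_over iota Y ->
  irreducible_set X -> generically X (inverse_at f g Y) ->
  forall x, roundtrip_dom f g X x -> roundtrip_dom g f Y (ratmap_eval iota f x).
Proof.
move=> wf wg cX cY irr gen x Ux.
have [Yfx s] := roundtrip wf wg cX cY irr gen Ux.
have [Xx fx gfx] := Ux; split=> //.
exact: is_point_same (ratmap_same iota wf s) fx.
Qed.

Lemma birational_of_generic (A B : multiproj) (f : ratmap A B K) (g : ratmap B A K)
    (X : hcoord A L -> Prop) (Y : hcoord B L -> Prop) :
  ratmap_wf f -> ratmap_wf g -> closed_over iota X -> closed_over iota Y ->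
  irreducible_set X -> irreducible_set Y ->
  generically X (inverse_at f g Y) -> generically Y (inverse_at g f X) ->
  birational_over iota X Y.
Proof.
move=> wf wg cX cY iX iY gX gY.
have dn (C E : multiproj) (f' : ratmap C E K) (g' : ratmap E C K) X' Y' :
    irreducible_set X' -> closed_over iota Y' -> generically X' (inverse_at f' g' Y') ->
    dense_in X' (roundtrip_dom f' g' X').
  move=> iX' [e [_ cY']] gX'; apply: (generically_dense iX').
  by apply: generically_mono gX' => x Xx [/cY'[]].
exists (roundtrip_dom f g X), (roundtrip_dom g f Y), f, g; split=> //.
- by split; [apply: roundtrip_open | apply: (dn _ _ _ _ _ Y)].
- by split; [apply: roundtrip_open | apply: (dn _ _ _ _ _ X)].
- move=> x Ux; split; first exact: (roundtrip_mem wf wg cX cY iX gX).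
  by case: (roundtrip wf wg cX cY iX gX Ux).
- move=> y Vy; split; first exact: (roundtrip_mem wg wf cY cX iY gY).
  by case: (roundtrip wg wf cY cX iY gY Vy).
Qed.

End BirationalCriterion.

(** * Plumbing of stable curves *)

Section TreePaths.
Variables (V : finType) (e : rel V).
Hypothesis e_irr : irreflexive e.
Hypothesis e_sym : forall v w, e v w = e w v.
Hypothesis e_conn : forall v w, connect e v w.
Hypothesis e_acyclic : forall c, ucycleb e c -> (size c <= 2)%N.

Definition simple_path v m p := [&& path e v p, uniq (v :: p) & last v p == m].

Local Notation avoid v := [rel x y | [&& e x y, x != v & y != v]].

Lemma path_avoid v w p : path e w p -> v \notin w :: p -> path (avoid v) w p.
Proof.
elim: p w => //= x p ih w /andP[ewx pp]; rewrite !inE !negb_or => /and3P[vw vx vp].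
by rewrite ewx eq_sym vw eq_sym vx ih // inE negb_or vx.
Qed.

Lemma avoid_sym v : connect_sym (avoid v).
Proof. by apply: sym_connect_sym => x y /=; rewrite e_sym; congr (_ && _); rewrite andbC. Qed.

Lemma avoid_path v w p : path (avoid v) w p -> w != v -> path e w p /\ v \notin w :: p.
Proof.
elim: p w => [|x p ih] w /=; first by rewrite inE eq_sym.
case/andP=> /and3P[ewx wv xv] /ih/(_ xv)[-> n] _.
by rewrite ewx inE negb_or eq_sym wv.
Qed.

(** Otherwise a simple path from [w] to [w'] off [v] closes up through [v] into a cycle of length at
    least 3. *)
Lemma acyclic_branch v w w' : e v w -> e v w' -> connect (avoid v) w w' -> w = w'.
Proof.
move=> evw evw' /connectP[p pp lw]; rewrite lw in evw' *.
have wv : w != v by apply: contraTneq evw => ->; rewrite e_irr.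
case/shortenP: pp => q /avoid_path/(_ wv)[qe vq] uq _ in evw' *.
case: q => [|x q] // in qe vq uq evw' *; exfalso.
suff /e_acyclic : ucycleb e (v :: w :: x :: q) by [].
have /= /andP[exw qe'] := qe.
rewrite /ucycleb /= rcons_path evw exw qe' e_sym evw' vq /=.
by move: uq; rewrite /= => ->.
Qed.

Lemma simple_path_uniq v m p p' : simple_path v m p -> simple_path v m p' -> p = p'.
Proof.
elim: p v p' => [|w p ih] v [|w' p'] //=.
- case/and3P=> _ _ /eqP/= vm /and3P[_ /andP[vp _] /eqP/= lm].
  by move: vp; rewrite vm -lm mem_last.
- case/and3P=> _ /andP[vp _] /eqP/= lm /and3P[_ _ /eqP/= vm].
  by move: vp; rewrite vm -lm mem_last.
move=> /and3P[/andP[evw pp] /andP[vp up] /eqP lp] /and3P[/andP[evw' pp'] /andP[vp' up'] /eqP lp'].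
have ww : w = w'.
  apply: (acyclic_branch evw evw'); apply: (@connect_trans _ _ m).
    by apply/connectP; exists p => //; apply: path_avoid.
  by rewrite avoid_sym; apply/connectP; exists p' => //; apply: path_avoid.
rewrite -ww in pp' up' lp' *; congr (_ :: _).
by apply: (ih w); apply/and3P; split=> //; apply/eqP.
Qed.

Lemma simple_path_ex v m : exists p, simple_path v m p.
Proof.
have /connectP[p pp ->] := e_conn v m; case/shortenP: pp => q qe uq _.
by exists q; rewrite /simple_path qe uq eqxx.
Qed.

Definition tree_path v m := xchoose (simple_path_ex v m).

Lemma tree_pathP v m : simple_path v m (tree_path v m).
Proof. exact: xchooseP. Qed.

Lemma tree_path_eq v m p : simple_path v m p -> tree_path v m = p.
Proof. exact/simple_path_uniq/tree_pathP. Qed.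

Lemma tree_path_nil v m : tree_path v m = [::] -> v = m.
Proof. by move=> h; have := tree_pathP v m; rewrite h => /and3P[_ _ /eqP]. Qed.

Lemma tree_path_cons v m w p : tree_path v m = w :: p -> tree_path w m = p.
Proof.
move=> h; have := tree_pathP v m; rewrite h => /and3P[/= /andP[_ pp] /andP[_ up] lp].
by apply: tree_path_eq; apply/and3P.
Qed.

Lemma tree_path_edge v m w p : tree_path v m = w :: p -> e v w.
Proof. by move=> h; have := tree_pathP v m; rewrite h => /and3P[/= /andP[]]. Qed.

Lemma tree_path_avoid v m w p : tree_path v m = w :: p -> connect (avoid v) w m.
Proof.
move=> h; have := tree_pathP v m; rewrite h => /and3P[/= /andP[_ pp] /andP[vp _] /eqP lp].
by apply/connectP; exists p => //; apply: path_avoid.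
Qed.

Lemma avoid_tree_path v m w : e v w -> connect (avoid v) w m ->
  tree_path v m = w :: tree_path w m.
Proof.
move=> evw /connectP[p pp lm].
have wv : w != v by apply: contraTneq evw => ->; rewrite e_irr.
case/shortenP: pp lm => q /avoid_path/(_ wv)[qe vq] uq _ lm.
have h : simple_path v m (w :: q) by rewrite /simple_path /= evw qe vq -lm eqxx -/(uniq (w :: q)) uq.
by rewrite (tree_path_eq h) (tree_path_cons (tree_path_eq h)).
Qed.

(** If the path from [v] to [m] misses [u], prepending [u] to the path keeps it simple. If it visits
    [u], its tail after [u] avoids [v], so the path must start with the edge from [v] to [u]. *)
Lemma tree_path_adj u v m : e u v ->
  tree_path u m = v :: tree_path v m \/ tree_path v m = u :: tree_path u m.
Proof.
move=> euv; case: (boolP (u \in tree_path v m)) => [up|nup]; last first.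
  left; apply: avoid_tree_path => //; have /and3P[pp _ /eqP lp] := tree_pathP v m.
  apply/connectP; exists (tree_path v m) => //; apply: path_avoid => //.
  rewrite inE negb_or nup andbT; by apply: contraTneq euv => ->; rewrite e_irr.
right; apply: avoid_tree_path; first by rewrite e_sym.
have /and3P[pp uq /eqP lp] := tree_pathP v m; move: pp uq lp.
case/splitPr: up => p1 p2; rewrite cat_path last_cat /= => /and3P[_ _ p2e] uq lp.
apply/connectP; exists p2 => //; apply: path_avoid => //.
move: uq => /andP[]; by rewrite mem_cat negb_or => /andP[].
Qed.

Lemma tree_path_next_edge v m w p : tree_path v m = w :: p ->
  forall w' p', tree_path w m = w' :: p' -> w' != v.
Proof.
move=> h w' p' h'; have := tree_pathP v m; rewrite h.
rewrite -(tree_path_cons h) h' => /and3P[_ /= /andP[]].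
by rewrite !inE !negb_or => /and3P[_ vw' _] _ _; rewrite eq_sym.
Qed.

End TreePaths.

(** * Brackets, cross-ratios and configurations of points of the line *)

Section Bracket.
Variable R : comNzRingType.
Implicit Types a b c d : 'rV[R]_2.

Definition br a b : R := a 0 0 * b 0 1 - a 0 1 * b 0 0.

Lemma br_anti a b : br a b = - br b a.
Proof. by rewrite /br; ring. Qed.

Lemma br_self a : br a a = 0.
Proof. by rewrite /br; ring. Qed.

Lemma brZl k a b : br (k *: a) b = k * br a b.
Proof. by rewrite /br !mxE; ring. Qed.

Lemma brZr k a b : br a (k *: b) = k * br a b.
Proof. by rewrite /br !mxE; ring. Qed.

Lemma br0l a : br 0 a = 0.
Proof. by rewrite /br !mxE; ring. Qed.

Lemma mul_rV2 (a : 'rV[R]_2) n (M : 'M[R]_(2, n)) j :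
  (a *m M) 0 j = a 0 0 * M 0 j + a 0 1 * M 1 j.
Proof. by rewrite mxE !big_ord_recl big_ord0 addr0; congr (_ + a 0 _ * M _ j); apply/val_inj. Qed.

Lemma det2 (M : 'M[R]_2) : \det M = M 0 0 * M 1 1 - M 0 1 * M 1 0.
Proof.
rewrite (expand_det_row _ 0) !big_ord_recl big_ord0 addr0 /cofactor !det_mx11 !mxE /=.
rewrite !expr0 !mul1r expr1 mulN1r mulrN.
by congr (M _ _ * M _ _ - M _ _ * M _ _); apply/val_inj.
Qed.

Lemma br_mul a b (M : 'M[R]_2) : br (a *m M) (b *m M) = \det M * br a b.
Proof. by rewrite det2 /br !mul_rV2; ring. Qed.

Lemma br_plucker a b p q : br p a * br q b - br p b * br q a = br p q * br a b.
Proof. by rewrite /br; ring. Qed.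

Lemma row2_eq a b : a 0 0 = b 0 0 -> a 0 1 = b 0 1 -> a = b.
Proof.
move=> h0 h1; apply/rowP => j; case: (unliftP ord0 j) => [k|] -> //.
by rewrite (_ : lift ord0 k = 1) // (ord1 k); apply/val_inj.
Qed.

Lemma br_solve a b c : br b c *: a = br a c *: b - br a b *: c.
Proof. by apply: row2_eq; rewrite /br !mxE; ring. Qed.

End Bracket.

Section BracketField.
Variable L : fieldType.
Implicit Types a b : 'rV[L]_2.

Lemma bracketE a b : bracket a b = br a b. Proof. by []. Qed.

Lemma br_neq0l a b : br a b != 0 -> a != 0.
Proof. by apply: contraNneq => ->; rewrite br0l. Qed.

Definition transverse a : 'rV[L]_2 := \row_j (if a 0 0 == 0 then j == 0 else j == 1)%:R.

Lemma transverseP a : a != 0 -> br a (transverse a) != 0.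
Proof.
move=> a0; rewrite /br !mxE; have [a00|a00] /= := eqVneq (a 0 0) 0.
  rewrite a00 mul0r sub0r oppr_eq0 mulr1.
  by apply: contraNneq a0 => a01; apply/eqP/row2_eq; rewrite mxE.
by rewrite mulr1 mulr0 subr0.
Qed.

Lemma br_eq0P a b : a != 0 -> br a b = 0 -> exists k, b = k *: a.
Proof.
move=> a0 h; have hc := transverseP a0; set c := transverse a in hc.
exists (br b c / br a c); have := br_solve b a c.
have -> : br b a = 0 by rewrite br_anti h oppr0.
rewrite scale0r subr0 => e.
by rewrite mulrC -scalerA -e scalerA mulVf ?scale1r.
Qed.

End BracketField.

Section CrossRatios.
Variables (R : comNzRingType) (n : nat).

(** Numerator and denominator of the cross-ratio in the order of [crossratios_of]: coordinate 0 over
    coordinate 1 is [z0 z2][z1 z3] / [z0 z3][z1 z2]. The ring is arbitrary, so that configurations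
    over [{poly L}] are covered. *)
Definition crs (Z : 'I_n -> 'rV[R]_2) (j : quad n * 'I_2) : R :=
  let z t := Z (val j.1 t) in
  if j.2 == 0 then br (z 0) (z 2) * br (z 1) (z 3) else br (z 0) (z 3) * br (z 1) (z 2).

End CrossRatios.

Section Configurations.
Variables (L : fieldType) (n : nat).
Implicit Types Z : 'I_n -> 'rV[L]_2.

Definition distinct_pts Z := forall i j, i != j -> br (Z i) (Z j) != 0.

Lemma quad_neq (q : quad n) s t : s != t -> val q s != val q t.
Proof. by apply: contra => /eqP /(injectiveP _ (valP q)) ->. Qed.

Lemma crs_neq0 Z j : distinct_pts Z -> crs Z j != 0.
Proof.
by move=> d; rewrite /crs; case: ifP => _; rewrite mulf_neq0 // d // quad_neq.
Qed.

Lemma crs_point Z : distinct_pts Z -> @is_point (quad_space n) L (crs Z).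
Proof. by move=> d q; exists (q, 0) => //; apply: crs_neq0. Qed.

Lemma crs_ord2 (d : 'I_2) : d = 0 \/ d = 1.
Proof. by case: d => [[|[|//]] h]; [left | right]; apply/val_inj. Qed.

Section Irreducible_curve.
Variables (Z : 'I_n -> 'rV[L]_2) (Zd : distinct_pts Z) (n3 : (3 <= n)%N).

Let meets0 : rel unit := [rel _ _ | false].
Let pt (_ : unit) (s : 'I_n + unit) : 'rV[L]_2 := if s is inl i then Z i else 0.
Let sp (v : unit) (s : 'I_n + unit) := match s with inl i => tt == v | inr w => meets0 v w end.

Fact one_connected v w : connect meets0 v w. Proof. by case: v; case: w. Qed.

Fact one_acyclic c : ucycleb meets0 c -> (size c <= 2)%N.
Proof. by case: c => [|[] [|[] c]] //=; rewrite /ucycleb /= andbF. Qed.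

Fact one_distinct v s t : sp v s -> sp v t -> s != t -> bracket (pt v s) (pt v t) != 0.
Proof. by case: s => // i _; case: t => // j _ ij; apply: Zd; apply: contraNneq ij => ->. Qed.

Fact one_stable v : (3 <= #|[pred s | sp v s]|)%N.
Proof.
apply: leq_trans n3 _; rewrite -[X in (X <= _)%N]card_ord.
rewrite -(card_image (f := @inl 'I_n unit)); last by move=> i j [].
by apply: subset_leq_card; apply/subsetP => s /imageP[i _ ->]; case: v.
Qed.

Definition smooth_curve : stable_curve L n :=
  @StableCurve L n unit meets0 (fun=> tt) pt (fun=> erefl) (fun _ _ => erefl)
    one_connected one_acyclic one_distinct one_stable.

Lemma crs_Mbar : @Mbar L n (crs Z).
Proof.
exists smooth_curve; split; first exact: crs_point.
move=> q v s; case: v => /= hs.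
have e t : s t = inl (val q t) by have := hs t; case: (s t) => //= i /andP[/eqP ->].
by rewrite /= !e /= /crs /= !bracketE mulrC.
Qed.

End Irreducible_curve.

Lemma Mbar_same (x y : hcoord (quad_space n) L) : same_point x y -> Mbar x -> Mbar y.
Proof.
move=> s [E [px ex]]; exists E; split; first exact: is_point_same s px.
case: s => c [c0 e] q v t ht /=; have := ex q v t ht => /= H.
by rewrite !e /= -!mulrA H !mulrA.
Qed.

Lemma crs_mul Z (M : 'M[L]_2) j : crs (fun i => Z i *m M) j = (\det M) ^+ 2 * crs Z j.
Proof. by rewrite /crs !br_mul; case: ifP => _; ring. Qed.

Lemma crs_scale Z (c : 'I_n -> L) j :
  crs (fun i => c i *: Z i) j = (\prod_t c (val j.1 t)) * crs Z j.
Proof.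
rewrite /crs !brZl !brZr !big_ord_recl big_ord0.
have -> : lift ord0 (lift ord0 (lift ord0 ord0)) = 3 :> 'I_4 by apply/val_inj.
have -> : lift ord0 (lift ord0 ord0) = 2 :> 'I_4 by apply/val_inj.
have -> : lift ord0 ord0 = 1 :> 'I_4 by apply/val_inj.
by case: ifP => _; ring.
Qed.

Definition same_config Z Z' := exists2 M : 'M[L]_2, M \in unitmx &
  forall i, exists2 c, c != 0 & Z' i = c *: (Z i *m M).

Lemma same_config_sym Z Z' : same_config Z Z' -> same_config Z' Z.
Proof.
case=> M uM h; exists (invmx M); first by rewrite unitmx_inv.
move=> i; have [c c0 ->] := h i; exists c^-1; first by rewrite invr_eq0.
by rewrite -scalemxAl scalerA mulVf // scale1r mulmxK.
Qed.

Lemma same_config_distinct Z Z' : same_config Z Z' -> distinct_pts Z -> distinct_pts Z'.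
Proof.
case=> M uM h d i j ij; have [c c0 ->] := h i; have [k k0 ->] := h j.
rewrite brZl brZr br_mul !mulf_neq0 // ?d //.
by move: uM; rewrite unitmxE unitfE.
Qed.

Lemma same_config_crs Z Z' : same_config Z Z' ->
  @same_point (quad_space n) L (crs Z) (crs Z').
Proof.
case=> M uM /fin_all_exists2[c c0 h].
exists (fun q : quad n => (\prod_t c (val q t)) * (\det M) ^+ 2); split.
  move=> q; rewrite mulf_neq0 //; first by apply/prodf_neq0.
  by rewrite expf_neq0 //; move: uM; rewrite unitmxE unitfE.
move=> j; have -> : crs Z' j = crs (fun i => c i *: (Z i *m M)) j.
  by rewrite /crs !h.
by rewrite crs_scale crs_mul mulrA.
Qed.

End Configurations.

(** * Smoothing all the nodes of a stable curve with one parameter *)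

Section Plumbing.
Variables (L : fieldType) (n : nat) (E : stable_curve L n).
Hypothesis n3 : (3 <= n)%N.
Local Notation V := (component E).
Local Notation e := (@meets L n E).
Local Notation mark := (mark_on E).
Local Notation tp := (tree_path (@dual_connected L n E)).
Local Notation C := (map_mx (@polyC L)).
Implicit Types (u v w : V) (i j : 'I_n) (P Q : 'rV[{poly L}]_2).

Let irr := @meets_irr L n E.
Let sym := @meets_sym L n E.
Let acyc := @dual_acyclic L n E.

Let node v w := special_pt v (inr w : 'I_n + V).

Lemma special_neq0 v s : special v s -> special_pt v s != 0.
Proof.
move=> hs; have := special_stable v.
rewrite (cardD1 s) inE hs add1n ltnS => /ltnW /card_gt0P[t].
rewrite !inE => /andP[ts ht]; rewrite eq_sym in ts.
exact: br_neq0l (special_distinct hs ht ts).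
Qed.

Lemma node_neq0 v w : e v w -> node v w != 0.
Proof. by move=> h; apply: special_neq0. Qed.

Let node' v w := transverse (node v w).

(* The coordinate of v is glued to that of u near their common node. *)
Definition glue u v P : 'rV[{poly L}]_2 :=
  br P (C (node v u)) *: C (node u v) + ('X * br P (C (node' v u))) *: C (node' u v).

Definition pt_at (t : L) P : 'rV[L]_2 := \row_k (P 0 k).[t].

Lemma br_C (a b : 'rV[L]_2) : br (C a) (C b) = (br a b)%:P.
Proof. by rewrite /br !mxE rmorphB !rmorphM. Qed.

Lemma br_at t P Q : br (pt_at t P) (pt_at t Q) = (br P Q).[t].
Proof. by rewrite /br !mxE hornerD hornerN !hornerM. Qed.

Lemma pt_at_C t (a : 'rV[L]_2) : pt_at t (C a) = a.
Proof. by apply/rowP => k; rewrite !mxE hornerC. Qed.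

Lemma pt_at_glue u v P : pt_at 0 (glue u v P) = br (pt_at 0 P) (node v u) *: node u v.
Proof.
have -> : br (pt_at 0 P) (node v u) = (br P (C (node v u))).[0].
  by rewrite -br_at pt_at_C.
apply/rowP => k; rewrite !mxE hornerD !hornerM !hornerC.
by rewrite hornerX !mul0r addr0.
Qed.

Let del u v := br (node u v) (node' u v) * br (node v u) (node' v u).

Lemma del_neq0 u v : e u v -> del u v != 0.
Proof. by move=> h; rewrite mulf_neq0 // transverseP // node_neq0 // sym. Qed.

(** Gluing is linear with determinant [del u v] times 'X: invertible for t nonzero, and of rank one
    at t = 0, where what lies beyond the node collapses to it. *)
Lemma br_glue u v P Q : br (glue u v P) (glue u v Q) = (del u v)%:P * 'X * br P Q.
Proof.
rewrite /glue /del polyCM -!br_C.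
move: (C (node u v)) (C (node' u v)) (C (node v u)) (C (node' v u)) => a a' b b'.
have := br_plucker b b' P Q; rewrite /br !mxE => H.
transitivity ('X * (a 0 0 * a' 0 1 - a 0 1 * a' 0 0) * (
   (P 0 0 * b 0 1 - P 0 1 * b 0 0) * (Q 0 0 * b' 0 1 - Q 0 1 * b' 0 0) -
     (P 0 0 * b' 0 1 - P 0 1 * b' 0 0) * (Q 0 0 * b 0 1 - Q 0 1 * b 0 0))); first by ring.
by rewrite H; ring.
Qed.

Lemma glue_glue u v P : glue v u (glue u v P) = (- (del u v)%:P * 'X) *: P.
Proof.
rewrite /glue /del polyCM -!br_C.
move: (C (node u v)) (C (node' u v)) (C (node v u)) (C (node' v u)) => a a' b b'.
by apply: row2_eq; rewrite /br !mxE; ring.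
Qed.

Fixpoint glue_path v (p : seq V) P := if p is w :: q then glue v w (glue_path w q P) else P.

(** The marked point [i] seen from [v]: its position on its own component, carried to [v] through
    the nodes along the tree path. All nodes have the same smoothing parameter 'X. *)
Definition pos v i := glue_path v (tp v (mark i)) (C (special_pt (mark i) (inl i))).

Definition img v i : 'I_n + V := if tp v (mark i) is w :: _ then inr w else inl i.

Lemma img_special v i : special v (img v i).
Proof.
rewrite /img; case h : (tp v (mark i)) => [|w p] /=.
  by rewrite (tree_path_nil h) eqxx.
exact: tree_path_edge h.
Qed.

Lemma img_seen v i : seen_at v (img v i) i.
Proof.
rewrite /img; case h : (tp v (mark i)) => [|w p] /=.
  by rewrite (tree_path_nil h) !eqxx.
by rewrite (tree_path_edge h) (tree_path_avoid h).
Qed.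

Lemma pos_cons v i w p : tp v (mark i) = w :: p -> pos v i = glue v w (pos w i).
Proof. by move=> h; rewrite /pos h /= (tree_path_cons irr sym acyc h). Qed.

(** Induction on the path. At t = 0 a gluing sends to the node every point of [w] other than the one
    at the node towards [v]; the path does not backtrack, so the image of [i] on [w] is another
    special point. *)
Lemma pos_at0 v i : exists2 c, c != 0 & pt_at 0 (pos v i) = c *: special_pt v (img v i).
Proof.
move: {2}(size (tp v (mark i))) (erefl (size (tp v (mark i)))) => k.
elim: k v => [|k ih] v.
  move/size0nil => h; exists 1; first exact: oner_neq0.
  by rewrite /pos /img h /= pt_at_C scale1r (tree_path_nil h).
case h : (tp v (mark i)) => [//|w p] /= [sp].
have sw : size (tp w (mark i)) = k by rewrite (tree_path_cons irr sym acyc h).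
have [c c0 ec] := ih w sw; rewrite (pos_cons h) pt_at_glue ec /img h.
exists (br (c *: special_pt w (img w i)) (node w v)) => //.
rewrite brZl mulf_neq0 //; apply: special_distinct (img_special w i) _ _ => /=.
  by rewrite sym (tree_path_edge h).
rewrite /img; case h' : (tp w (mark i)) => [//|w' p'].
by apply: contraNneq (tree_path_next_edge irr sym acyc h h') => -[->].
Qed.

Lemma pos_adj u v i : e u v -> pos u i = glue u v (pos v i) \/ pos v i = glue v u (pos u i).
Proof.
move=> euv; case: (tree_path_adj irr sym (@dual_connected L n E) acyc (mark i) euv) => h.
  by left; apply: pos_cons h.
by right; apply: pos_cons h.
Qed.

(** Agreement of the positions seen from [v] and from [w] up to a linear change and rescaling of the
    points, expressed on brackets and without denominators. All these factors cancel in
    cross-ratios. *)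
Definition related v w := exists (D D' : {poly L}) (l l' : 'I_n -> {poly L}),
  [/\ D != 0, D' != 0, forall i, l i != 0 & forall i, l' i != 0] /\
  forall i j, D * l i * l j * br (pos v i) (pos v j) =
              D' * l' i * l' j * br (pos w i) (pos w j).

Lemma related_refl v : related v v.
Proof. by exists 1, 1, (fun=> 1), (fun=> 1); split=> //; split=> *; exact: oner_neq0. Qed.

Lemma related_trans u v w : related u v -> related v w -> related u w.
Proof.
move=> [D [D' [l [l' [[D0 D'0 l0 l'0] h]]]]] [F [F' [m [m' [[F0 F'0 m0 m'0] k]]]]].
exists (D * F), (D' * F'), (fun i => l i * m i), (fun i => l' i * m' i); split.
  by split=> *; rewrite mulf_neq0.
move=> i j; transitivity (F * m i * m j * (D * l i * l j * br (pos u i) (pos u j))).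
  by ring.
rewrite h; transitivity (D' * l' i * l' j * (F * m i * m j * br (pos v i) (pos v j))).
  by ring.
by rewrite k; ring.
Qed.

Lemma related_adj u v : e u v -> related u v.
Proof.
move=> euv; pose d : {poly L} := - (del v u)%:P * 'X.
have euv' : e v u by rewrite sym.
have d0 : d != 0 by rewrite mulf_neq0 ?polyX_eq0 // oppr_eq0 polyC_eq0 del_neq0.
have /fin_all_exists[l hl] : forall i, exists l : {poly L}, l != 0 /\
    l *: pos u i = glue u v (pos v i).
  move=> i; case: (pos_adj i euv) => ->.
    by exists 1; rewrite oner_neq0 scale1r.
  by exists d; rewrite glue_glue.
exists 1, ((del u v)%:P * 'X), l, (fun=> 1); split.
  split=> [||i|i]; try exact: oner_neq0; last by case: (hl i).
  by rewrite mulf_neq0 ?polyX_eq0 ?polyC_eq0 ?del_neq0.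
move=> i j; rewrite mul1r !mulr1 -br_glue; have [_ <-] := hl i; have [_ <-] := hl j.
by rewrite brZl brZr; ring.
Qed.

Lemma related_all v w : related v w.
Proof.
have /connectP[p pp ->] := @dual_connected L n E v w.
elim: p v pp => [|x p ih] v /=; first by move=> _; apply: related_refl.
by case/andP=> evx pp; apply: related_trans (related_adj evx) (ih x pp).
Qed.

(** The component that minimises the total distance to the three marked points. If two of them had
    the same image there, a step towards them would bring both nearer by one and the third farther
    by at most one. *)
Lemma median i j k : i != j -> i != k -> j != k ->
  exists v, [/\ img v i != img v j, img v i != img v k & img v j != img v k].
Proof.
move=> ij ik jk; pose len v i := size (tp v (mark i)).
have lenS v a b : a != b -> img v a = img v b -> exists w,
    [/\ e v w, (len v a = (len w a).+1)%N & (len v b = (len w b).+1)%N].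
  move=> ab; rewrite /img /len; case ha : (tp v (mark a)) => [|x p];
    case hb : (tp v (mark b)) => [|y q] //.
    by case=> e'; rewrite e' eqxx in ab.
  case=> exy; subst y; exists x; split; [exact: tree_path_edge ha| |].
    by rewrite (tree_path_cons irr sym acyc ha).
  by rewrite (tree_path_cons irr sym acyc hb).
have lenL v w a : e v w -> (len w a <= (len v a).+1)%N.
  move=> evw; rewrite /len.
  case: (tree_path_adj irr sym (@dual_connected L n E) acyc (mark a) evw) => -> /=.
    by rewrite leqW.
  by [].
pose f v := (len v i + len v j + len v k)%N.
pose v := [arg min_(v < mark i) f v].
have fmin w : (f v <= f w)%N by rewrite /v; case: arg_minnP => // w' _; apply.
exists v; split; apply/negP => /eqP.
- case/(lenS v i j ij) => w [evw h1 h2]; have := fmin w; have := lenL v w k evw.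
  by rewrite /f h1 h2; lia.
- case/(lenS v i k ik) => w [evw h1 h2]; have := fmin w; have := lenL v w j evw.
  by rewrite /f h1 h2; lia.
- case/(lenS v j k jk) => w [evw h1 h2]; have := fmin w; have := lenL v w i evw.
  by rewrite /f h1 h2; lia.
Qed.

Lemma br_pos_at0 v i j : img v i != img v j -> (br (pos v i) (pos v j)).[0] != 0.
Proof.
move=> ij; rewrite -br_at; have [c c0 ->] := pos_at0 v i; have [d d0 ->] := pos_at0 v j.
rewrite brZl brZr !mulf_neq0 //.
exact: special_distinct (img_special v i) (img_special v j) ij.
Qed.

Lemma third i j : exists k : 'I_n, (i != k) && (j != k).
Proof.
have : (0 < #|~: [set i; j]|)%N.
  have := cardsC [set i; j]; rewrite card_ord; have := leq_card_setU [set i] [set j].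
  by rewrite !cards1; case=> h _; lia.
case/card_gt0P => k; rewrite !inE negb_or => /andP[ki kj].
by exists k; rewrite eq_sym ki eq_sym.
Qed.

(** At a median component of [i], [j] and a third point the bracket is nonzero even at t = 0. Being
    nonzero as a polynomial then passes to every component by [related_all]. *)
Lemma br_pos_neq0 w i j : i != j -> br (pos w i) (pos w j) != 0.
Proof.
move=> ij; have [k /andP[ik jk]] := third i j.
have [v [h _ _]] := median ij ik jk.
have [D [D' [l [l' [[D0 D'0 l0 l'0] H]]]]] := related_all v w.
apply: contraNneq (br_pos_at0 h) => e0.
have := H i j; rewrite e0 mulr0 => /eqP; rewrite !mulf_eq0.
rewrite (negPf D0) (negPf (l0 i)) (negPf (l0 j)) /= => /eqP ->.
by rewrite horner0.
Qed.

Lemma crs_cross v w (q : quad n) :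
  crs (pos v) (q, 0) * crs (pos w) (q, 1) = crs (pos v) (q, 1) * crs (pos w) (q, 0).
Proof.
have [D [D' [l [l' [[D0 D'0 l0 l'0] H]]]]] := related_all v w.
rewrite /crs /=; set a := val q.
pose m := D' * D' * l' (a 0) * l' (a 1) * l' (a 2) * l' (a 3).
have m0 : m != 0 by rewrite !mulf_neq0.
apply: (mulfI m0).
have h02 := H (a 0) (a 2); have h13 := H (a 1) (a 3).
have h03 := H (a 0) (a 3); have h12 := H (a 1) (a 2).
transitivity (br (pos v (a 0)) (pos v (a 2)) * br (pos v (a 1)) (pos v (a 3)) *
   ((D' * l' (a 0) * l' (a 3) * br (pos w (a 0)) (pos w (a 3))) *
    (D' * l' (a 1) * l' (a 2) * br (pos w (a 1)) (pos w (a 2))))); first by rewrite /m; ring.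
rewrite -h03 -h12.
transitivity (br (pos v (a 0)) (pos v (a 3)) * br (pos v (a 1)) (pos v (a 2)) *
   ((D * l (a 0) * l (a 2) * br (pos v (a 0)) (pos v (a 2))) *
    (D * l (a 1) * l (a 3) * br (pos v (a 1)) (pos v (a 3))))); first by ring.
by rewrite h02 h13 /m; ring.
Qed.

Lemma crs_at0 v (q : quad n) x : crossratios_of E x ->
  x (q, 0) * (crs (pos v) (q, 1)).[0] = x (q, 1) * (crs (pos v) (q, 0)).[0].
Proof.
move=> [_ H]; have := H q v (fun t => img v (val q t)) (fun t => img_seen v _) => /=.
rewrite /crs /= !hornerM -!br_at !bracketE.
have [c0 _ ->] := pos_at0 v (val q 0); have [c1 _ ->] := pos_at0 v (val q 1).
have [c2 _ ->] := pos_at0 v (val q 2); have [c3 _ ->] := pos_at0 v (val q 3).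
rewrite !brZl !brZr => h.
transitivity (c0 * c1 * c2 * c3 * (x (q, 0) *
  (br (special_pt v (img v (val q 0))) (special_pt v (img v (val q 3))) *
   br (special_pt v (img v (val q 1))) (special_pt v (img v (val q 2)))))); first by ring.
by rewrite h; ring.
Qed.

(** At a median component of the points 0, 1 and 2 of [q] their images are distinct. Both
    coordinates could vanish at t = 0 only if the image of the point 3 coincided with those of 0 and
    of 1 at once. *)
Lemma crs_pos_point (q : quad n) : exists v,
  ((crs (pos v) (q, 0)).[0] != 0) || ((crs (pos v) (q, 1)).[0] != 0).
Proof.
have qn s t : s != t -> val q s != val q t := @quad_neq n q s t.
have [v [h1 h2 h3]] := median (qn 0 1 isT) (qn 0 2 isT) (qn 1 2 isT).
exists v; rewrite /crs /= !hornerM.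
have n02 := br_pos_at0 h2; have n12 := br_pos_at0 h3; have n01 := br_pos_at0 h1.
rewrite !mulf_eq0 (negPf n02) (negPf n12) orbF /= -negb_and.
apply/negP => /andP[/eqP e13 /eqP e03]; move: n01 e13 e03; rewrite -!br_at => n01 e13 e03.
have p3 : pt_at 0 (pos v (val q 3)) != 0.
  have [c c0 ->] := pos_at0 v (val q 3).
  by rewrite scaler_eq0 negb_or c0 special_neq0 // img_special.
have [k0 e0] : exists k, pt_at 0 (pos v (val q 0)) = k *: pt_at 0 (pos v (val q 3)).
  by apply: br_eq0P => //; rewrite br_anti e03 oppr0.
have [k1 e1] : exists k, pt_at 0 (pos v (val q 1)) = k *: pt_at 0 (pos v (val q 3)).
  by apply: br_eq0P => //; rewrite br_anti e13 oppr0.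
by move: n01; rewrite e0 e1 brZl brZr br_self !mulr0 eqxx.
Qed.

Lemma curve_smoothing (x : hcoord (quad_space n) L) : crossratios_of E x ->
  exists (F : coords (quad_space n) -> {poly L}) (b : {poly L}),
    [/\ b != 0, same_point (fam_at F 0) x & forall t, b.[t] != 0 ->
      exists2 Z : 'I_n -> 'rV[L]_2, distinct_pts Z & same_point (fam_at F t) (crs Z)].
Proof.
move=> ex; have /fin_all_exists[cv hv] := crs_pos_point.
have n0 : (0 < n)%N by apply: leq_trans n3.
pose r : V := mark (Ordinal n0).
(* The component depends on the quadruple, because at t = 0 its cross-ratio may be 0/0 on a given
   component. As polynomials in t the cross-ratios agree on all components by [crs_cross], so for
   general t the configuration can be read on the single component [r]. *)
pose F (j : coords (quad_space n)) := crs (pos (cv j.1)) j.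
pose b := \prod_i \prod_(j | i != j) (br (pos r i) (pos r j) *
  \prod_q br (pos (cv q) i) (pos (cv q) j)).
have b0 : b != 0.
  apply/prodf_neq0 => i _; apply/prodf_neq0 => j ij; rewrite mulf_neq0 ?br_pos_neq0 //.
  by apply/prodf_neq0 => q _; apply: br_pos_neq0.
exists F, b; split=> //.
  apply: cross_same_point; [|by case: ex|].
    by move=> q; case/orP: (hv q) => h; [exists (q, 0) | exists (q, 1)].
  move=> [q d] [q' d'] /= e'; rewrite -{}e' /fam_at /F /=.
  have := crs_at0 (cv q) q ex.
  by case: (crs_ord2 d) => ->; case: (crs_ord2 d') => -> h //; [rewrite mulrC -h mulrC
    | rewrite mulrC h mulrC].
move=> t; rewrite horner_prod => /prodf_neq0 bt.
have bt' i j : i != j -> (br (pos r i) (pos r j)).[t] != 0 /\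
    forall q, (br (pos (cv q) i) (pos (cv q) j)).[t] != 0.
  move=> ij; have := bt i isT; rewrite horner_prod => /prodf_neq0/(_ j ij).
  rewrite hornerM mulf_eq0 negb_or horner_prod => /andP[-> /prodf_neq0 h].
  by split=> // q; apply: h.
exists (fun i => pt_at t (pos r i)).
  by move=> i j ij; rewrite br_at; case: (bt' i j ij).
have crs_at v (j : quad n * 'I_2) : crs (fun i => pt_at t (pos v i)) j = (crs (pos v) j).[t].
  by rewrite /crs !br_at -!hornerM; case: ifP.
apply: cross_same_point.
- move=> q; exists (q, 0) => //; rewrite /fam_at /F /= -crs_at.
  by apply: crs_neq0 => i j ij; rewrite br_at; case: (bt' i j ij).
- by apply: crs_point => i j ij; rewrite br_at; case: (bt' i j ij).
move=> [q d] [q' d'] /= e'; rewrite -{}e' /fam_at /F /= !crs_at -!hornerM; congr (_.[t]).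
have := crs_cross (cv q) r q.
by case: (crs_ord2 d) => ->; case: (crs_ord2 d') => -> h.
Qed.

End Plumbing.

(** * The smooth locus *)

Section GoodFamilies.
Variable L : fieldType.
Hypothesis Linf : forall s : seq L, exists x, x \notin s.

(** Families are recorded rather than irreducibility itself because this property passes directly to
    products, as is needed for the product with a projective space. *)
Definition good_families (A : multiproj) (X X0 : hcoord A L -> Prop) :=
  (forall x, X0 x -> X x) /\
  (forall x, X x -> exists (F : coords A -> {poly L}) (b : {poly L}),
    [/\ b != 0, same_point (fam_at F 0) x & forall t, b.[t] != 0 -> X0 (fam_at F t)]) /\
  (forall x y, X0 x -> X0 y -> exists (F : coords A -> {poly L}) (b : {poly L}),
    [/\ b != 0, same_point (fam_at F 0) x, same_point (fam_at F 1) y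
      & forall t, b.[t] != 0 -> X0 (fam_at F t)]).

Lemma good_families_irreducible (A : multiproj) (X X0 : hcoord A L -> Prop) :
  good_families X X0 -> irreducible_set X.
Proof.
case=> sub [lim con]; apply: (irreducible_of_families Linf lim) => x y hx hy.
have [F [b [b0 s0 s1 H]]] := con x y hx hy.
by exists F, b; split=> // t /H /sub.
Qed.

Lemma same_point_prod (A B : multiproj) (x y : hcoord (prod_mp A B) L) :
  same_point (fun j => x (inl j)) (fun j => y (inl j)) ->
  same_point (fun j => x (inr j)) (fun j => y (inr j)) -> same_point x y.
Proof.
move=> [c [c0 hc]] [d [d0 hd]].
exists (fun b => match b with inl i => c i | inr i => d i end); split.
  by case.
by case=> j /=; [apply: hc | apply: hd].
Qed.

Lemma same_point_fst (A B : multiproj) (x y : hcoord (prod_mp A B) L) :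
  same_point x y -> same_point (fun j => x (inl j)) (fun j => y (inl j)).
Proof. by case=> c [c0 h]; exists (fun i => c (inl i)); split=> // j; rewrite h. Qed.

Lemma same_point_snd (A B : multiproj) (x y : hcoord (prod_mp A B) L) :
  same_point x y -> same_point (fun j => x (inr j)) (fun j => y (inr j)).
Proof. by case=> c [c0 h]; exists (fun i => c (inr i)); split=> // j; rewrite h. Qed.

Lemma good_families_prod (A B : multiproj) (X X0 : hcoord A L -> Prop)
    (Y Y0 : hcoord B L -> Prop) : good_families X X0 -> good_families Y Y0 ->
  good_families (prod_set X Y) (prod_set X0 Y0).
Proof.
move=> [sX [lX cX]] [sY [lY cY]]; split; first by move=> x [/sX ? /sY].
pose glueF (F : coords A -> {poly L}) (G : coords B -> {poly L})
  (j : coords (prod_mp A B)) : {poly L} := match j with inl a => F a | inr b => G b end.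
split=> [x [/lX[F [b [b0 s H]]] /lY[G [c [c0 s' H']]]]|].
  exists (glueF F G), (b * c); split; first exact: mulf_neq0.
    exact: same_point_prod.
  move=> t; rewrite hornerM mulf_eq0 negb_or => /andP[/H ? /H' ?]; by split.
move=> x y [hx hx'] [hy hy'].
have [F [b [b0 s0 s1 H]]] := cX _ _ hx hy; have [G [c [c0 s0' s1' H']]] := cY _ _ hx' hy'.
exists (glueF F G), (b * c); split; first exact: mulf_neq0.
- exact: same_point_prod.
- exact: same_point_prod.
move=> t; rewrite hornerM mulf_eq0 negb_or => /andP[/H ? /H' ?]; by split.
Qed.

Lemma projspace_point d (x : hcoord (projspace d) L) : is_point x <-> exists j, x j != 0.
Proof.
split=> [/(_ tt)[j _ h]|[j h] []]; first by exists j.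
by exists j.
Qed.

Lemma projspace_families d : @good_families (projspace d) (@is_point _ L) (@is_point _ L).
Proof.
split=> //; split=> [x px|x y /projspace_point[j xj] _].
  exists (fun j => (x j)%:P), 1; rewrite oner_neq0; split=> //.
    by apply: same_point_eq => j; rewrite /fam_at hornerC.
  move=> t _; apply: is_point_same px; apply: same_point_eq => j.
  by rewrite /fam_at hornerC.
pose F (k : 'I_d.+1) : {poly L} := (x k)%:P + 'X * (y k - x k)%:P.
have F0 k : (F k).[0] = x k by rewrite /F hornerD hornerM hornerX !hornerC mul0r addr0.
have F1 k : (F k).[1] = y k by rewrite /F hornerD hornerM hornerX !hornerC mul1r addrC subrK.
exists F, (F j); split.
- by apply: contraNneq xj => h; rewrite -F0 h horner0.
- by apply: same_point_eq => k; apply: F0.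
- by apply: same_point_eq => k; apply: F1.
by move=> t h; apply/projspace_point; exists j.
Qed.

End GoodFamilies.

Section SmoothLocus.
Variables (L : fieldType) (n : nat).
Hypothesis Linf : forall s : seq L, exists x, x \notin s.
Hypothesis n3 : (3 <= n)%N.

Definition smooth_locus (x : hcoord (quad_space n) L) :=
  exists2 Z : 'I_n -> 'rV[L]_2, distinct_pts Z & same_point x (crs Z).

(** Limits are provided by plumbing; two configurations are joined by the segment between their
    coordinate vectors. *)
Lemma Mbar_families : good_families (@Mbar L n) smooth_locus.
Proof.
split=> [x [Z d /same_point_sym s]|].
  by apply: Mbar_same s (crs_Mbar d n3).
split=> [x [E /(curve_smoothing n3)[F [b [b0 s H]]]]|].
  by exists F, b; split.
move=> x y [Z d s] [Z' d' s'].
pose Zt i : 'rV[{poly L}]_2 := map_mx polyC (Z i) + 'X *: map_mx polyC (Z' i - Z i).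
have at0 i : pt_at 0 (Zt i) = Z i.
  by apply/rowP => k; rewrite !mxE hornerD hornerM hornerX !hornerC mul0r addr0.
have at1 i : pt_at 1 (Zt i) = Z' i.
  by apply/rowP => k; rewrite !mxE hornerD hornerM hornerX !hornerC mul1r; ring.
have crs_at t (j : quad n * 'I_2) : (crs Zt j).[t] = crs (fun i => pt_at t (Zt i)) j.
  by rewrite /crs !br_at -!hornerM; case: ifP.
pose b := \prod_i \prod_(j | i != j) br (Zt i) (Zt j).
exists (crs Zt), b; split.
- apply/prodf_neq0 => i _; apply/prodf_neq0 => j ij.
  by apply: contraNneq (d i j ij) => h; rewrite -(at0 i) -(at0 j) br_at h horner0.
- apply: same_point_trans _ (same_point_sym s); apply: same_point_eq => j.
  by rewrite /fam_at crs_at /crs !at0.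
- apply: same_point_trans _ (same_point_sym s'); apply: same_point_eq => j.
  by rewrite /fam_at crs_at /crs !at1.
move=> t; rewrite horner_prod => /prodf_neq0 h.
exists (fun i => pt_at t (Zt i)); last by apply: same_point_eq => j; rewrite /fam_at crs_at.
move=> i j ij; rewrite br_at; have := h i isT.
by rewrite horner_prod => /prodf_neq0; apply.
Qed.

Lemma smooth_nonzero x j : smooth_locus x -> x j != 0.
Proof.
case=> Z d /same_point_sym[c [c0 e]]; rewrite e mulf_neq0 //; exact: crs_neq0.
Qed.

Lemma smooth_same x y : same_point x y -> smooth_locus x -> smooth_locus y.
Proof.
by move=> s [Z d h]; exists Z => //; apply: same_point_trans (same_point_sym s) h.
Qed.

Let i0 : 'I_n := Ordinal (leq_trans (isT : 1 <= 3)%N n3).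
Let i1 : 'I_n := Ordinal (leq_trans (isT : 2 <= 3)%N n3).
Let i2 : 'I_n := Ordinal n3.

Definition quad_of (q0 : quad n) a b c d : quad n :=
  insubd q0 [ffun t : 'I_4 => nth a [:: a; b; c; d] t].

Lemma quad_ofE q0 a b c d : uniq [:: a; b; c; d] ->
  [/\ val (quad_of q0 a b c d) 0 = a, val (quad_of q0 a b c d) 1 = b,
      val (quad_of q0 a b c d) 2 = c & val (quad_of q0 a b c d) 3 = d].
Proof.
move=> u; have inj : injectiveb [ffun t : 'I_4 => nth a [:: a; b; c; d] t].
  apply/injectiveP => s t; rewrite !ffunE => /eqP.
  by rewrite nth_uniq // => /eqP /val_inj.
by rewrite /quad_of !val_insubd inj !ffunE.
Qed.

Lemma crs_quad_of (R : comNzRingType) (Z : 'I_n -> 'rV[R]_2) q0 a b c d :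
  uniq [:: a; b; c; d] ->
  crs Z (quad_of q0 a b c d, 0) = br (Z a) (Z c) * br (Z b) (Z d) /\
  crs Z (quad_of q0 a b c d, 1) = br (Z a) (Z d) * br (Z b) (Z c).
Proof. by case/(quad_ofE q0) => e0 e1 e2 e3; rewrite /crs /= e0 e1 e2 e3. Qed.

Variable q0 : quad n.

Definition row2 (a b : L) : 'rV[L]_2 := \row_k if k == 0 then a else b.

(* The representative of a configuration whose first three points are infinity, 0 and 1. *)
Definition normal_config (x : hcoord (quad_space n) L) (i : 'I_n) : 'rV[L]_2 :=
  if i == i0 then row2 1 0 else if i == i1 then row2 0 1 else if i == i2 then row2 1 1
  else row2 (x (quad_of q0 i0 i1 i2 i, 0) / x (quad_of q0 i0 i1 i2 i, 1)) 1.

Lemma normal_config_same x y : same_point x y -> normal_config x = normal_config y.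
Proof.
case=> c [c0 e]; apply: boolp.funext => i; rewrite /normal_config !e /=.
by rewrite -mulf_div mulfV ?mul1r.
Qed.

Lemma br_row2 (a b c d : L) : br (row2 a b) (row2 c d) = a * d - b * c.
Proof. by rewrite /br !mxE. Qed.

Lemma normal_config_crs (Z : 'I_n -> 'rV[L]_2) : distinct_pts Z ->
  same_config Z (normal_config (crs Z)).
Proof.
move=> d; set z0 := Z i0; set z1 := Z i1; set z2 := Z i2.
have n01 : br z0 z1 != 0 by apply: d.
have n02 : br z0 z2 != 0 by apply: d.
have n12 : br z1 z2 != 0 by apply: d.
pose M : 'M[L]_2 := \matrix_(i, j) (if j == 0 then br z0 z2 * (if i == 0 then - z1 0 1 else z1 0 0)
   else br z1 z2 * (if i == 0 then - z0 0 1 else z0 0 0)).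
have mulM w : w *m M = row2 (br z0 z2 * br z1 w) (br z1 z2 * br z0 w).
  by apply: row2_eq; rewrite mul_rV2 !mxE /= /br; ring.
exists M.
  rewrite unitmxE unitfE det2 !mxE /=.
  have -> : br z0 z2 * - z1 0 1 * (br z1 z2 * z0 0 0) - br z1 z2 * - z0 0 1 * (br z0 z2 * z1 0 0)
     = - (br z0 z2 * br z1 z2 * br z0 z1) by rewrite [br z0 z1]/br; ring.
  by rewrite oppr_eq0 !mulf_neq0.
move=> i; rewrite mulM /normal_config; have [->|ni0] := eqVneq i i0.
  rewrite -/z0 br_self; exists (br z0 z2 * br z1 z0)^-1.
    by rewrite invr_eq0 mulf_neq0 // br_anti oppr_eq0.
  apply: row2_eq; rewrite !mxE /= ?mulr0 // mulVf // mulf_neq0 //.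
  by rewrite br_anti oppr_eq0.
have [->|ni1] := eqVneq i i1.
  rewrite -/z1 br_self; exists (br z1 z2 * br z0 z1)^-1.
    by rewrite invr_eq0 mulf_neq0.
  by apply: row2_eq; rewrite !mxE /= ?mulr0 // mulVf // mulf_neq0.
have [->|ni2] := eqVneq i i2.
  rewrite -/z2; exists (br z0 z2 * br z1 z2)^-1.
    by rewrite invr_eq0 mulf_neq0.
  apply: row2_eq; rewrite !mxE /=; first by rewrite mulVf // mulf_neq0.
  by rewrite [br z1 z2 * _]mulrC mulVf // mulf_neq0.
have u : uniq [:: i0; i1; i2; i] by rewrite /= !inE !negb_or ![_ == i]eq_sym ni0 ni1 ni2.
have [-> ->] := crs_quad_of Z q0 u; rewrite -/z0 -/z1 -/z2.
have n0i : br z0 (Z i) != 0 by apply: d; rewrite eq_sym.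
exists (br z1 z2 * br z0 (Z i))^-1; first by rewrite invr_eq0 mulf_neq0.
apply: row2_eq; rewrite !mxE /=; last by rewrite mulVf // mulf_neq0.
by rewrite mulrC [br z1 z2 * _]mulrC.
Qed.

Lemma regular_normal_config (K : fieldType) (iota : {rmorphism K -> L})
    (W : hcoord (quad_space n) L -> Prop) i k :
  (forall x j, W x -> x j != 0) -> regular iota W (fun x => normal_config x i 0 k).
Proof.
move=> h; have cst a b : regular iota W (fun=> row2 (iota a) (iota b) 0 k).
  apply: regular_ext (regular_const iota W (if k == 0 then a else b)) => x _.
  by rewrite mxE; case: ifP.
have c0 : iota 0 = 0 by apply: rmorph0.
have c1 : iota 1 = 1 by apply: rmorph1.
rewrite /normal_config; have [_|n0] := eqVneq i i0; first by have := cst 1 0; rewrite c1 c0.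
have [_|n1] := eqVneq i i1; first by have := cst 0 1; rewrite c1 c0.
have [_|n2] := eqVneq i i2; first by have := cst 1 1; rewrite c1.
apply: (@regular_ext _ _ _ _ _ (fun x : hcoord (quad_space n) L => if k == 0 then x (quad_of q0 i0 i1 i2 i, 0) /
   x (quad_of q0 i0 i1 i2 i, 1) else 1)); first by move=> x _; rewrite mxE.
case: eqP => _; last exact: regular1.
by apply: (@regular_coord (quad_space n)) => // x Wx; apply: h.
Qed.

Lemma regular_br (A : multiproj) (K : fieldType) (iota : {rmorphism K -> L})
    (W : hcoord A L -> Prop) (P Q : hcoord A L -> 'rV[L]_2) :
  (forall k, regular iota W (fun x => P x 0 k)) ->
  (forall k, regular iota W (fun x => Q x 0 k)) -> regular iota W (fun x => br (P x) (Q x)).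
Proof. by move=> hP hQ; apply: regularB; apply: regularM. Qed.

Lemma regular_crs (A : multiproj) (K : fieldType) (iota : {rmorphism K -> L})
    (W : hcoord A L -> Prop) (Z : hcoord A L -> 'I_n -> 'rV[L]_2) j :
  (forall i k, regular iota W (fun x => Z x i 0 k)) -> regular iota W (fun x => crs (Z x) j).
Proof.
case: j => q d h; rewrite /crs /=.
by case: (crs_ord2 d) => -> /=; apply: regularM; apply: regular_br.
Qed.

(** A smooth point is the cross-ratio system of its normal configuration. This relation, as the
    vanishing of the numerator of [phi], passes to limits of smooth points, hence to all of [Mbar];
    where no coordinate of x vanishes the denominator is nonzero as well. *)
Lemma Mbar_crs_normal x (q : quad n) : Mbar x -> (forall j, x j != 0) ->
  x (q, 0) * crs (normal_config x) (q, 1) = x (q, 1) * crs (normal_config x) (q, 0).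
Proof.
move=> Mx x0; pose W (y : hcoord (quad_space n) L) := forall j, y j != 0.
pose phi y := y (q, 0) / y (q, 1) * crs (normal_config y) (q, 1) - crs (normal_config y) (q, 0).
have [D [p [r [hp hr H]]]] : regular idfun W phi.
  have rn i k : regular idfun W (fun y => normal_config y i 0 k).
    by apply: regular_normal_config => y j; apply.
  apply: regularB; last exact: regular_crs.
  apply: regularM; last exact: regular_crs.
  by apply: (@regular_coord (quad_space n)) => // y; apply.
have [_ [lim _]] := Mbar_families.
have p0 : mh_eval idfun p x = 0.
  apply: (limit_zero Linf lim hp) => // y sy.
  have Wy : W y by move=> j; apply: smooth_nonzero.
  have [ry] := H y Wy; case: sy => Z d s.
  have /same_config_crs sc := normal_config_crs d.
  have := same_point_cross (same_point_trans s sc) (erefl : block (_ : coords (quad_space n)) = block _)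
     (j := (q, 0)) (k := (q, 1)).
  rewrite /phi (normal_config_same s) => e /eqP; rewrite mulrAC e mulrAC mulfV // mul1r subrr.
  by rewrite eq_sym mulf_eq0 invr_eq0 (negPf ry) orbF => /eqP.
have [_] := H x x0; rewrite p0 mul0r => /eqP; rewrite subr_eq0 => /eqP <-.
by field.
Qed.

(** For the converse, if two points of the normal configuration coincided, some coordinate of x
    would vanish by [Mbar_crs_normal]. The criterion makes the smooth locus a principal open subset
    over every field of definition. *)
Lemma smooth_locusP x : smooth_locus x <-> Mbar x /\ forall j, x j != 0.
Proof.
split=> [sx|[Mx x0]].
  split; last by move=> j; apply: smooth_nonzero.
  by have [sub _] := Mbar_families; apply: sub.
have H q := Mbar_crs_normal q Mx x0.
set Z := normal_config x in H.
have Z0 : Z i0 = row2 1 0 by rewrite /Z /normal_config eqxx.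
have Z1 : Z i1 = row2 0 1 by rewrite /Z /normal_config.
have Z2 : Z i2 = row2 1 1 by rewrite /Z /normal_config.
have Zi i : i != i0 -> i != i1 -> i != i2 -> exists2 z, z != 0 & Z i = row2 z 1.
  move=> /negPf ni0 /negPf ni1 /negPf ni2; rewrite /Z /normal_config ni0 ni1 ni2.
  by eexists; last reflexivity; rewrite mulf_neq0 ?invr_eq0.
have n0 i : i != i0 -> br (Z i0) (Z i) != 0.
  move=> h0; rewrite Z0; have [->|h1] := eqVneq i i1; first by rewrite Z1 br_row2 mulr1 mul0r subr0 oner_neq0.
  have [->|h2] := eqVneq i i2; first by rewrite Z2 br_row2 mulr1 mul0r subr0 oner_neq0.
  by have [z _ ->] := Zi i h0 h1 h2; rewrite br_row2 mulr1 mul0r subr0 oner_neq0.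
have n1 i : i != i1 -> br (Z i1) (Z i) != 0.
  move=> h1; have [->|h0] := eqVneq i i0; first by rewrite br_anti oppr_eq0 n0.
  rewrite Z1; have [->|h2] := eqVneq i i2; first by rewrite Z2 br_row2 mul1r mul0r sub0r oppr_eq0 oner_neq0.
  by have [z z0 ->] := Zi i h0 h1 h2; rewrite br_row2 mul1r mul0r sub0r oppr_eq0.
have d : distinct_pts Z.
  move=> i j ij.
  have [e|hi0] := eqVneq i i0; first by rewrite e n0 // -e eq_sym.
  have [e|hj0] := eqVneq j i0; first by rewrite e br_anti oppr_eq0 n0.
  have [e|hi1] := eqVneq i i1; first by rewrite e n1 // -e eq_sym.
  have [e|hj1] := eqVneq j i1; first by rewrite e br_anti oppr_eq0 n1.
  (* In the cross-ratio of this quadruple the bracket of [i] and [j] is the only factor not yet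
     known to be nonzero. *)
  have u : uniq [:: i; i0; j; i1].
    by rewrite /= !inE !negb_or hi0 ij hi1 [i0 == j]eq_sym hj0 hj1.
  have := H (quad_of q0 i i0 j i1); have [-> ->] := crs_quad_of Z q0 u.
  move=> e; apply: contraTneq (x0 (quad_of q0 i i0 j i1, 0)) => e'.
  move/eqP: e; rewrite e' mul0r mulr0 mulf_eq0 negbK => /orP[//|].
  by rewrite mulf_eq0 (negPf (n0 j hj0)) br_anti oppr_eq0 (negPf (n1 i hi1)).
exists Z => //; apply: cross_same_point; [by case: Mx => E [] | exact: crs_point |].
move=> [q a] [q' b] /= e; rewrite -{}e; have h := H q.
by case: (crs_ord2 a) => ->; case: (crs_ord2 b) => ->; rewrite ?h.
Qed.

End SmoothLocus.

(** * Cauchy interpolation of configurations *)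

Section CofactorKernel.
Variables (F : fieldType) (l : nat).
Implicit Types (M : 'M[F]_(l, 1 + l)) (w : 'rV[F]_(1 + l)) (v : 'cV[F]_(1 + l)).

(** The signed maximal minors of [M], as cofactors along an added first row. They do not depend on
    that row, which is taken to be zero. They are polynomial in the entries and span the kernel of
    [M] when it is a line. *)
Definition cofactor_vec M : 'cV[F]_(1 + l) := col 0 (\adj (col_mx (0 : 'rV_(1 + l)) M)).

Lemma cofactor_vecE w M : col 0 (\adj (col_mx w M)) = cofactor_vec M.
Proof.
apply/colP => c; rewrite !mxE /cofactor; congr (_ * \det _).
apply/matrixP => i j; do 2![rewrite [LHS]mxE [RHS]mxE].
have -> : lift (0 : 'I_(1 + l)) i = rshift 1 i by apply/val_inj.
by rewrite !col_mxEd.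
Qed.

Lemma mul_cofactor_vec M : M *m cofactor_vec M = 0.
Proof.
have := congr1 dsubmx (mul_mx_adj (col_mx (0 : 'rV_(1 + l)) M)).
rewrite -mul_dsub_mx col_mxKd => e; rewrite /cofactor_vec colE mulmxA e -colE.
by apply/colP => i; rewrite !mxE -val_eqE /= mulr0n.
Qed.

Lemma det_col_mx w M : \det (col_mx w M) = (w *m cofactor_vec M) 0 0.
Proof.
have /(congr1 (fun A : 'M_(1 + l) => A 0 0)) := mul_mx_adj (col_mx w M).
rewrite [RHS]mxE eqxx mulr1n => <-; rewrite -(cofactor_vecE w) !mxE.
apply: eq_bigr => k _; rewrite [in RHS]mxE; congr (_ * _).
by have -> : 0 = lshift l 0 :> 'I_(1 + l); [apply/val_inj | rewrite col_mxEu].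
Qed.

(** Put on top of [M] the row that picks the coordinate [c]. Both sides are the adjugate of this
    square matrix times the matrix times [v], bracketed in the two ways. *)
Lemma cofactor_vec_uniq M v c : M *m v = 0 ->
  cofactor_vec M c 0 *: v = v c 0 *: cofactor_vec M.
Proof.
move=> Mv; pose w : 'rV[F]_(1 + l) := delta_mx 0 c.
have wv (v' : 'cV[F]_(1 + l)) : (w *m v') 0 0 = v' c 0 by rewrite -rowE mxE.
have /(congr1 (fun A => A *m v)) := mul_adj_mx (col_mx w M).
rewrite det_col_mx wv mul_scalar_mx => <-.
rewrite -mulmxA mul_col_mx Mv -(cofactor_vecE w); apply/colP => k.
rewrite [LHS]mxE [RHS]mxE [col 0 _ k 0]mxE (bigD1 0) //= big1 ?addr0; last first.
  move=> j j0; have [j' ->] : exists j', j = rshift 1 j'.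
    case: (unliftP 0 j) j0 => [j' -> _|-> /eqP //]; exists j'; exact/val_inj.
  by rewrite col_mxEd [X in _ * X]mxE mulr0.
have {2}-> : 0 = lshift l 0 :> 'I_(1 + l) by apply/val_inj.
by rewrite col_mxEu wv mulrC.
Qed.

(** If all minors vanish, [M] with any row [w] on top is singular, so [w] kills a nonzero vector of
    the kernel, a multiple of [v0]. Then every row kills [v0], so [v0] is zero, and so is the
    kernel, although [M] has more columns than rows. *)
Lemma cofactor_vec_neq0 M v0 :
  (forall v, M *m v = 0 -> exists a, v = a *: v0) -> cofactor_vec M != 0.
Proof.
move=> H; apply/eqP => k0.
have v0w w : w *m v0 = 0.
  have /det0P[x x0 xM] : \det (col_mx w M)^T == 0.
    by rewrite det_tr det_col_mx k0 mulmx0 mxE eqxx.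
  have : col_mx w M *m x^T = 0.
    by apply: trmx_inj; rewrite trmx_mul trmxK xM trmx0.
  rewrite mul_col_mx => /eqP; rewrite col_mx_eq0 => /andP[/eqP wx /eqP Mx].
  have [a ea] := H _ Mx; move: wx; rewrite ea -scalemxAr => /eqP.
  rewrite scaler_eq0 => /orP[/eqP a0|/eqP //].
  by move: x0; rewrite -[x]trmxK ea a0 scale0r trmx0 eqxx.
have v00 : v0 = 0 by apply/colP => c; have := v0w (delta_mx 0 c); rewrite -rowE => /rowP/(_ 0); rewrite !mxE.
have /det0P[x x0 xM] : \det (col_mx (0 : 'rV_(1 + l)) M)^T == 0.
  by rewrite det_tr det_col_mx k0 mulmx0 mxE eqxx.
have : col_mx (0 : 'rV_(1 + l)) M *m x^T = 0.
  by apply: trmx_inj; rewrite trmx_mul trmxK xM trmx0.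
rewrite mul_col_mx => /eqP; rewrite col_mx_eq0 => /andP[_ /eqP Mx].
have [a ea] := H _ Mx.
by move: x0; rewrite -[x]trmxK ea v00 scaler0 trmx0 eqxx.
Qed.

End CofactorKernel.

(** * The linear system of an interpolation problem and its solution by minors *)

Section FrameSystem.
Variables (L : fieldType) (n r : nat).
Local Notation l := (r + r.+2).+1.
Variable o : 'I_l -> 'I_n.
Implicit Types (u : 'I_n -> 'rV[L]_(2 + r)) (Z : 'I_n -> 'rV[L]_2) (Q : 'M[L]_(2 + r, 2)).

(** One linear equation for each of the 2 r + 3 nodes, on the 2 r + 4 entries of [Q]. The number of
    nodes is written [(r + r.+2).+1] so that its successor is convertible to [(2 + r) + (2 + r)], as
    [cofactor_vec] needs. *)
Definition solves u Z Q := forall a, br (u (o a) *m Q) (Z (o a)) = 0.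

Definition system u Z : 'M[L]_(l, (2 + r) + (2 + r)) :=
  \matrix_(a, c) row_mx (Z (o a) 0 1 *: u (o a)) (- Z (o a) 0 0 *: u (o a)) 0 c.

Definition stack Q : 'cV[L]_((2 + r) + (2 + r)) := col_mx (col 0 Q) (col 1 Q).

Definition unstack (v : 'cV[L]_((2 + r) + (2 + r))) : 'M[L]_(2 + r, 2) :=
  row_mx (usubmx v) (dsubmx v).

Lemma stackK v : stack (unstack v) = v.
Proof.
rewrite /stack /unstack -[RHS]vsubmxK; congr col_mx; apply/colP => i; rewrite !mxE.
  have -> : 0 = lshift 1 0 :> 'I_(1 + 1) by apply/val_inj.
  by rewrite (unsplitK (inl _)) mxE.
have -> : 1 = rshift 1 0 :> 'I_(1 + 1) by apply/val_inj.
by rewrite (unsplitK (inr _)) mxE.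
Qed.

Lemma unstackK Q : unstack (stack Q) = Q.
Proof.
rewrite /unstack /stack col_mxKu col_mxKd; apply/matrixP => i j; rewrite mxE.
case: splitP => k /= jk; rewrite mxE; congr (Q i _); apply/val_inj; rewrite /= jk ord1 //.
Qed.

Lemma solvesP u Z Q : solves u Z Q <-> system u Z *m stack Q = 0.
Proof.
have E a : (system u Z *m stack Q) a 0 = br (u (o a) *m Q) (Z (o a)).
  have -> : (system u Z *m stack Q) a 0 =
     (row_mx (Z (o a) 0 1 *: u (o a)) (- Z (o a) 0 0 *: u (o a)) *m stack Q) 0 0.
    by rewrite !mxE; apply: eq_bigr => c _; rewrite mxE.
  rewrite mul_row_col -!scalemxAl !colE !mulmxA -!colE /br.
  by move: (u (o a) *m Q) => X; rewrite !mxE; ring.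
split=> [h|h a]; last by rewrite -E h mxE.
by apply/colP => a; rewrite E h mxE.
Qed.

Definition frame_sol u Z : 'M[L]_(2 + r, 2) := unstack (cofactor_vec (system u Z)).

Lemma frame_sol_solves u Z : solves u Z (frame_sol u Z).
Proof. by apply/solvesP; rewrite stackK; apply: mul_cofactor_vec. Qed.

Lemma unstackZ k v : unstack (k *: v) = k *: unstack v.
Proof. by apply/matrixP => i j; rewrite !mxE; case: split => a; rewrite !mxE. Qed.

Lemma frame_sol_uniq u Z Q : solves u Z Q -> frame_sol u Z != 0 ->
  exists k, Q = k *: frame_sol u Z.
Proof.
move=> /solvesP h n0.
have [c hc] : exists c, cofactor_vec (system u Z) c 0 != 0.
  apply: NNPP => N; move/eqP: n0; apply; rewrite /frame_sol.
  suff -> : cofactor_vec (system u Z) = 0 by rewrite -(scale0r 0) unstackZ scale0r.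
  apply/colP => c; rewrite [RHS]mxE; apply/eqP/negPn/negP => hc; by apply: N; exists c.
exists (stack Q c 0 / cofactor_vec (system u Z) c 0).
have := cofactor_vec_uniq c h => e.
by rewrite /frame_sol -unstackZ mulrC -scalerA -e scalerA mulVf // scale1r unstackK.
Qed.

Lemma frame_sol_neq0 u Z Q0 : (forall Q, solves u Z Q -> exists k, Q = k *: Q0) ->
  frame_sol u Z != 0.
Proof.
move=> H; have : cofactor_vec (system u Z) != 0.
  apply: (@cofactor_vec_neq0 _ _ _ (stack Q0)) => v hv.
  have [k hk] : exists k, unstack v = k *: Q0 by apply: H; apply/solvesP; rewrite stackK.
  exists k; rewrite -[v]stackK hk; apply/colP => i.
  by rewrite !mxE; case: split => a; rewrite ?mxE.
apply: contraNneq => e; rewrite -[cofactor_vec _]stackK -/(frame_sol u Z) e.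
by apply/eqP/colP => i; rewrite mxE [RHS]mxE; case: split => j; rewrite !mxE.
Qed.

Lemma regular_frame_sol (A : multiproj) (K : fieldType) (iota : {rmorphism K -> L})
    (W : hcoord A L -> Prop) (u : hcoord A L -> 'I_n -> 'rV[L]_(2 + r))
    (Z : hcoord A L -> 'I_n -> 'rV[L]_2) :
  (forall i k, regular iota W (fun x => u x i 0 k)) ->
  (forall i k, regular iota W (fun x => Z x i 0 k)) ->
  forall i j, regular iota W (fun x => frame_sol (u x) (Z x) i j).
Proof.
move=> hu hZ i j.
have hS a c : regular iota W (fun x => system (u x) (Z x) a c).
  apply: (@regular_ext _ _ _ _ _ (fun x => match split c with
    inl k => Z x (o a) 0 1 * u x (o a) 0 k | inr k => - Z x (o a) 0 0 * u x (o a) 0 k end)).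
    by move=> x _; rewrite !mxE; case: split => k; rewrite mxE.
  by case: split => k; apply: regularM => //; apply: regularN.
have hC c : regular iota W (fun x => cofactor_vec (system (u x) (Z x)) c 0).
  apply: (@regular_ext _ _ _ _ _ (fun x => \adj (col_mx (0 : 'rV_(1 + l)) (system (u x) (Z x))) c 0)).
    by move=> x _; rewrite [RHS]mxE.
  apply: regular_adj => a b.
  apply: (@regular_ext _ _ _ _ _ (fun x => match split a with
    inl _ => 0 | inr k => system (u x) (Z x) k b end)).
    move=> x _; rewrite /col_mx [RHS]mxE; case: split => k //; by rewrite mxE.
  by case: split => k; [exact: regular0 | exact: hS].
have hS1 (k : 'I_((2 + r) + (2 + r))) :
    regular iota W (fun x => cofactor_vec (system (u x) (Z x)) k 0) by apply: hC.
pose k0 : 'I_((2 + r) + (2 + r)) :=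
  match split (j : 'I_(1 + 1)) with inl _ => lshift _ i | inr _ => rshift _ i end.
have E x : frame_sol (u x) (Z x) i j = cofactor_vec (system (u x) (Z x)) k0 0.
  by rewrite /frame_sol /unstack mxE /k0; case: split => k; rewrite mxE ord1.
by apply: regular_ext (hS1 _) => x _; rewrite E.
Qed.

End FrameSystem.

(* The marked points in O carry the interpolation nodes; sgn separates the two halves exchanged by the
   group when switch holds, and nodes s enumerates the half of O of sign s. *)
Record layout (n r : nat) := Layout {
  sgn : 'I_n -> bool;
  inO : pred 'I_n;
  switch : bool;
  nodes : bool -> 'I_(r + r.+2).+1 -> 'I_n;
  sgn_switch : forall i, sgn i || switch;
  nodes_in : forall s a, s || switch -> inO (nodes s a) /\ sgn (nodes s a) = s;
  nodes_onto : forall i, inO i -> exists a, nodes (sgn i) a = i;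
  nodes_inj : forall s, s || switch -> injective (nodes s)
}.

(** Lower rows of the frame of each half, three entries of the switch, one affine coordinate for
    each marked point. The type does not depend on the layout, so that permutations act on it
    directly; [used] cuts out the n - 3 entries that are coordinates. *)
Definition param_ix (n r : nat) := ((bool * ('I_r * 'I_2)) + 'I_3 + 'I_n)%type.

Section Parametrization.
Variables (L : fieldType) (n r : nat) (D : layout n r).
Local Notation l := (r + r.+2).+1.
Local Notation sw := (switch D).
Local Notation ix := (param_ix n r).
Implicit Types (u : 'I_n -> 'rV[L]_(2 + r)) (p : ix -> L) (Z : 'I_n -> 'rV[L]_2).

Definition used (x : ix) : bool :=
  match x with inl (inl (s, _)) => s || sw | inl (inr _) => sw | inr i => ~~ inO D i end.

Definition par_frame p s (a : 'I_r) (b : 'I_2) : L := p (inl (inl (s, (a, b)))).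
Definition par_switch p (k : 'I_3) : L := p (inl (inr k)).

Definition frame p s : 'M[L]_(2 + r, 2) := col_mx 1%:M (\matrix_(a, b) par_frame p s a b).

(** The upper right entry is normalised to 1, and exchanging the parameters 0 and 1 gives minus the
    adjugate, which is the inverse in PGL_2. Hence exchanging the two halves, which inverts the
    transition between them, merely permutes the parameters. *)
Definition switch_mx p : 'M[L]_2 := \matrix_(i, j)
  if i == 0 then (if j == 0 then - par_switch p 1 else 1)
  else (if j == 0 then - par_switch p 2 else par_switch p 0).

Definition frame_pt u p i : 'rV[L]_2 :=
  if inO D i then u i *m frame p (sgn D i) else row2 1 (p (inr i)).

Definition Psi u p i : 'rV[L]_2 :=
  if sgn D i then frame_pt u p i else frame_pt u p i *m switch_mx p.

(** Besides distinct points, the nodes must determine each frame up to scalar, so that the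
    parameters can be read off the configuration. *)
Definition good u p := distinct_pts (Psi u p) /\
  forall s, s || sw -> forall Q,
    solves (nodes D s) u (fun i => u i *m frame p s) Q -> exists k, Q = k *: frame p s.

Definition self_sol u p s := frame_sol (nodes D s) u (fun i => u i *m frame p s).

Lemma frame00 p s : frame p s 0 0 = 1.
Proof.
have {1}-> : 0 = lshift r 0 :> 'I_(2 + r) by apply/val_inj.
by rewrite col_mxEu mxE.
Qed.

Lemma frame_solves u p s : solves (nodes D s) u (fun i => u i *m frame p s) (frame p s).
Proof. by move=> a; rewrite br_self. Qed.

(** Uniqueness becomes an open condition: the solution by minors is a multiple of the frame, whose
    upper left entry is 1, so it is nonzero exactly when that entry is. *)
Lemma goodP u p : good u p <->
  distinct_pts (Psi u p) /\ forall s, s || sw -> self_sol u p s 0 0 != 0.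
Proof.
split=> -[d h]; split=> // s hs.
  have n0 : self_sol u p s != 0 by apply: frame_sol_neq0 (h s hs).
  have [k e] := h s hs _ (frame_sol_solves (nodes D s) u (fun i => u i *m frame p s)).
  rewrite /self_sol e mxE frame00 mulr1.
  by apply: contraNneq n0 => k0; rewrite /self_sol e k0 scale0r.
have n0 : self_sol u p s != 0.
  by apply: contraNneq (h s hs) => ->; rewrite mxE.
move=> Q hQ; have [k ->] := frame_sol_uniq hQ n0.
have [k' e] := frame_sol_uniq (frame_solves u p s) n0.
have k'0 : k' != 0.
  by apply: contraTneq (oner_neq0 L) => k0; rewrite -(frame00 p s) e k0 scale0r mxE eqxx.
exists (k / k'); rewrite [in RHS]e scalerA divfK //.
Qed.

Lemma frame_pt_neq0 u p i : (1 < n)%N -> distinct_pts (Psi u p) -> frame_pt u p i != 0.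
Proof.
move=> n1 d; have [j ij] : exists j : 'I_n, i != j.
  have [e|] := eqVneq i (Ordinal (ltnW n1)); last by exists (Ordinal (ltnW n1)).
  by exists (Ordinal n1); rewrite e -val_eqE.
apply: contraNneq (br_neq0l (d i j ij)) => e.
by rewrite /Psi e mul0mx; case: ifP.
Qed.

Lemma det_switch u p : sw -> distinct_pts (Psi u p) -> \det (switch_mx p) != 0.
Proof.
move=> hs d; have hs' : false || sw by [].
have [i1 s1] := nodes_in (0 : 'I_l) hs'; have [i2 s2] := nodes_in (ord_max : 'I_l) hs'.
have ne : nodes D false 0 != nodes D false ord_max.
  by apply/eqP => /(nodes_inj hs') /(congr1 val) /=; rewrite addnS.
have := d _ _ ne; rewrite /Psi s1 s2 br_mul.
by apply: contraNneq => ->; rewrite mul0r.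
Qed.

Definition sol u Z s := frame_sol (nodes D s) u Z.
Definition base u Z s : 'M[L]_2 := usubmx (sol u Z s).
Definition transition u Z := base u Z false *m invmx (base u Z true).
Definition coord_at u Z i := Z i *m invmx (base u Z (sgn D i)).

(** The inverse of [Psi]. The solution by minors is normalised by its upper square block, which is
    also the change from normalised to given coordinates. The quotient of the blocks of the two
    halves is the switch, scaled to have upper right entry 1. *)
Definition Phi u Z (x : ix) : L :=
  if used x then match x with
  | inl (inl (s, (a, b))) => (dsubmx (sol u Z s) *m invmx (base u Z s)) a b
  | inl (inr k) => (if k == 0 then transition u Z 1 1 else
      if k == 1 then - transition u Z 0 0 else - transition u Z 1 0) / transition u Z 0 1
  | inr i => coord_at u Z i 0 1 / coord_at u Z i 0 0
  end else 0.

Definition solvable u Z := [/\ forall s, s || sw -> \det (base u Z s) != 0,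
  sw -> transition u Z 0 1 != 0 & forall i, ~~ inO D i -> coord_at u Z i 0 0 != 0].

Lemma unit_det (M : 'M[L]_2) : \det M != 0 -> M \in unitmx.
Proof. by rewrite unitmxE unitfE. Qed.

Lemma used_sgn i : sgn D i || sw. Proof. exact: sgn_switch. Qed.

Lemma ord3 (k : 'I_3) : [\/ k = 0, k = 1 | k = 2].
Proof.
by case: k => [[|[|[|//]]] h]; [constructor 1 | constructor 2 | constructor 3]; apply/val_inj.
Qed.

Lemma Phi_config u Z : (1 < n)%N -> distinct_pts Z -> solvable u Z ->
  distinct_pts (Psi u (Phi u Z)) -> same_config Z (Psi u (Phi u Z)).
Proof.
move=> n1 dZ [hb ht hc] d; set p := Phi u Z.
have ub s : s || sw -> base u Z s \in unitmx by move=> /hb /unit_det.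
have fr s : s || sw -> frame p s *m base u Z s = sol u Z s.
  move=> hs; rewrite mul_col_mx mul1mx -[RHS]vsubmxK; congr col_mx.
  have -> : (\matrix_(a, b) par_frame p s a b : 'M_(r, 2)) = dsubmx (sol u Z s) *m invmx (base u Z s).
    by apply/matrixP => a b; rewrite mxE /par_frame /p /Phi /= hs.
  by rewrite mulmxKV // ub.
have pt i : exists2 c, c != 0 & frame_pt u p i = c *: coord_at u Z i.
  have us := ub _ (used_sgn i).
  have f0 := frame_pt_neq0 i n1 d; move: f0; rewrite /frame_pt -/p.
  case: ifP => [Oi|/negbT nOi] f0.
    have [a ea] := nodes_onto Oi.
    have := frame_sol_solves (nodes D (sgn D i)) u Z a; rewrite ea -/(sol u Z _) -fr ?used_sgn //.
    rewrite mulmxA; set w := u i *m _ in f0 * => e.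
    have w0 : w *m base u Z (sgn D i) != 0.
      by apply: contraNneq f0 => w0; rewrite -[w](mulmxK us) w0 mul0mx.
    have [k ek] := br_eq0P w0 e.
    have k0 : k != 0.
      apply/eqP => k0; have [j ij] : exists j : 'I_n, i != j.
        have [e'|] := eqVneq i (Ordinal (ltnW n1)); last by exists (Ordinal (ltnW n1)).
        by exists (Ordinal n1); rewrite e' -val_eqE.
      by have := dZ i j ij; rewrite ek k0 scale0r br0l eqxx.
    exists k^-1; first by rewrite invr_eq0.
    by rewrite /coord_at ek -scalemxAl mulmxK // scalerA mulVf // scale1r.
  exists (coord_at u Z i 0 0)^-1; first by rewrite invr_eq0 hc.
  apply: row2_eq; rewrite [LHS]mxE [RHS]mxE /=; first by rewrite mulVf ?hc.
  by rewrite /p /Phi /= nOi mulrC.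
have sm : sw -> switch_mx p = (transition u Z 0 1)^-1 *: transition u Z.
  move=> hs; apply/matrixP => i j; rewrite [LHS]mxE [RHS]mxE /par_switch /p /Phi /= hs /=.
  case: (crs_ord2 i) => ->; case: (crs_ord2 j) => -> /=; rewrite ?mulNr ?opprK //.
  - by rewrite [RHS]mulrC.
  - by rewrite mulVf // ht.
  - by rewrite [RHS]mulrC.
  - by rewrite [RHS]mulrC.
exists (invmx (base u Z true)); first by rewrite unitmx_inv ub.
move=> i; have [c c0 e] := pt i; rewrite /Psi -/p.
move: e (used_sgn i); rewrite /coord_at; case: (sgn D i) => e.
  by exists c.
move=> /= hs; exists (c / transition u Z 0 1); first by rewrite mulf_neq0 ?invr_eq0 ?ht.
rewrite e (sm hs) -scalemxAl -scalemxAr scalerA; congr (_ *: _).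
by rewrite /transition mulmxA mulmxKV // ub.
Qed.

(** As the nodes determine the frame of [p], the solution for [Z] is that frame times the matrix [G]
    that carries the half to [Z], up to a scalar. Division by the upper block removes both. *)
Lemma Phi_uniq u Z p : good u p -> same_config Z (Psi u p) ->
  solvable u Z /\ forall x, used x -> Phi u Z x = p x.
Proof.
case=> d gd /same_config_sym[S uS /fin_all_exists2[c c0 hc]].
pose G s := if s then S else switch_mx p *m S.
have uG s : s || sw -> G s \in unitmx.
  case: s => //= hs; rewrite unitmx_mul uS andbT.
  by apply/unit_det/(det_switch (u := u)).
have Ze i : Z i = c i *: (frame_pt u p i *m G (sgn D i)).
  by rewrite hc /Psi /G; case: (sgn D i) => //; rewrite mulmxA.
have solE s : s || sw -> exists2 k, k != 0 & sol u Z s = k *: (frame p s *m G s).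
  move=> hs; have H Q : solves (nodes D s) u Z Q -> exists k, Q = k *: (frame p s *m G s).
    move=> hQ; have [k ek] : exists k, Q *m invmx (G s) = k *: frame p s.
      apply: gd => // a; have [Oa sa] := nodes_in a hs.
      have := hQ a; rewrite Ze /frame_pt Oa sa brZr => /eqP; rewrite mulf_eq0 (negPf (c0 _)) /=.
      rewrite -{1}[Q](mulmxKV (uG s hs)) [u _ *m (_ *m G s)]mulmxA br_mul mulf_eq0.
      by have := uG s hs; rewrite unitmxE unitfE => /negPf -> /= /eqP.
    by exists k; rewrite -[Q](mulmxKV (uG s hs)) ek scalemxAl.
  have [k ek] := H _ (frame_sol_solves _ _ _); exists k => //.
  have := frame_sol_neq0 H; rewrite -/(sol u Z s).
  by apply: contraNneq => k0; rewrite /sol ek k0 scale0r.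
have baseE s : s || sw -> exists2 k, k != 0 &
    base u Z s = k *: G s /\ sol u Z s = k *: (frame p s *m G s).
  move=> hs; have [k k0 e] := solE s hs; exists k => //; split=> //.
  by rewrite /base e linearZ /= mul_col_mx col_mxKu mul1mx.
have invE s : s || sw -> exists2 k, k != 0 &
    invmx (base u Z s) = k^-1 *: invmx (G s) /\ base u Z s = k *: G s /\
    sol u Z s = k *: (frame p s *m G s).
  move=> hs; have [k k0 [e e']] := baseE s hs; exists k => //.
  by rewrite e invmxZ // unitmxZ ?unitfE // uG.
have coordE i : exists2 k, k != 0 & coord_at u Z i = k *: frame_pt u p i.
  have [k k0 [ei _]] := invE _ (used_sgn i).
  exists (k^-1 * c i); first by rewrite mulf_neq0 ?invr_eq0.
  by rewrite /coord_at ei Ze -scalemxAr -scalemxAl mulmxK ?uG ?used_sgn // scalerA.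
have trE : sw -> exists2 k, k != 0 & transition u Z = k *: switch_mx p.
  move=> hs; have [k k0 [_ [e _]]] := invE false hs.
  have [k' k'0 [ei' _]] := invE true isT.
  exists (k'^-1 * k); first by rewrite mulf_neq0 ?invr_eq0.
  by rewrite /transition e ei' -scalemxAr -scalemxAl /G mulmxK // scalerA.
split.
  split=> [s hs|hs|i nOi].
  - by have [k k0 [_ [-> _]]] := invE s hs; rewrite detZ mulf_neq0 ?expf_neq0 //;
      have := uG s hs; rewrite unitmxE unitfE.
  - by have [k k0 ->] := trE hs; rewrite !mxE /= mulr1.
  - by have [k k0 ->] := coordE i; rewrite /frame_pt (negPf nOi) !mxE /= mulr1.
move=> [[[s [a b]]|k]|i] hx; rewrite /Phi hx; move: hx => /= hx.
- have [k k0 [ei [_ es]]] := invE s hx; rewrite ei es /frame mul_col_mx scale_col_mx col_mxKd.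
  by rewrite -scalemxAl -scalemxAr scalerA mulfV // scale1r mulmxK ?uG // mxE.
- have [c' c'0 ->] := trE hx; rewrite !mxE /= mulr1.
  by case: (ord3 k) => -> /=; rewrite ?mulrN ?opprK mulrAC mulfV // mul1r.
have [k k0 ->] := coordE i; rewrite /frame_pt (negPf hx) !mxE /= mulr1.
by rewrite mulrAC mulfV // mul1r.
Qed.

End Parametrization.

Section RegularParametrization.
Variables (L : fieldType) (n r : nat) (D : layout n r).
Variables (A : multiproj) (K : fieldType) (iota : {rmorphism K -> L}).
Local Notation ix := (param_ix n r).
Local Notation sw := (switch D).
Implicit Types (W : hcoord A L -> Prop).

Lemma regular_frame W (pf : hcoord A L -> ix -> L) s i j :
  (forall x, regular iota W (fun w => pf w x)) ->
  regular iota W (fun w => frame (pf w) s i j).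
Proof.
move=> hp; case: (split_ordP i) => k ->.
  apply: (@regular_ext _ _ _ _ _ (fun=> (k == j)%:R)).
    by move=> w _; rewrite col_mxEu mxE.
  by case: eqP => _; [exact: regular1 | exact: regular0].
apply: (@regular_ext _ _ _ _ _ (fun w => pf w (inl (inl (s, (k, j)))))) => //.
by move=> w _; rewrite col_mxEd mxE.
Qed.

Lemma regular_Psi W (uf : hcoord A L -> 'I_n -> 'rV[L]_(2 + r)) (pf : hcoord A L -> ix -> L) :
  (forall i k, regular iota W (fun w => uf w i 0 k)) ->
  (forall x, regular iota W (fun w => pf w x)) ->
  forall i k, regular iota W (fun w => Psi D (uf w) (pf w) i 0 k).
Proof.
move=> hu hp i k.
have hf j : regular iota W (fun w => frame_pt D (uf w) (pf w) i 0 j).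
  rewrite /frame_pt; case: (inO D i); last first.
    apply: (@regular_ext _ _ _ _ _ (fun w => if j == 0 then 1 else pf w (inr i))).
      by move=> w _; rewrite mxE.
    by case: eqP => _; [exact: regular1 | exact: hp].
  apply: regular_mulmx => a b; last exact: regular_frame.
  by rewrite (ord1 a).
rewrite /Psi; case: (sgn D i); first exact: hf.
apply: regular_mulmx => [a b|a b]; first by rewrite (ord1 a).
apply: (@regular_ext _ _ _ _ _ (fun w => if a == 0 then
    (if b == 0 then - pf w (inl (inr 1)) else 1)
  else (if b == 0 then - pf w (inl (inr 2)) else pf w (inl (inr 0))))).
  by move=> w _; rewrite mxE.
case: (a == 0); case: (b == 0) => //; first exact: regularN.
  exact: regular1.
exact: regularN.
Qed.

Lemma basic_distinct W (Zf : hcoord A L -> 'I_n -> 'rV[L]_2) :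
  (forall i k, regular iota W (fun w => Zf w i 0 k)) ->
  basic_open iota W (fun w => W w /\ distinct_pts (Zf w)).
Proof.
move=> hZ; have := @basic_all A K L iota W _ [seq x <- enum {: 'I_n * 'I_n} | x.1 != x.2]
  (fun x w => br (Zf w x.1) (Zf w x.2)) (fun x _ => regular_br (hZ x.1) (hZ x.2)).
apply: basic_eq => w; split=> -[Ww h]; split=> //.
  by move=> i j ij; apply: (h (i, j)); rewrite mem_filter mem_enum ij.
by move=> [i j]; rewrite mem_filter => /andP[/= ij _]; apply: h.
Qed.

Lemma basic_good W (uf : hcoord A L -> 'I_n -> 'rV[L]_(2 + r)) (pf : hcoord A L -> ix -> L) :
  (forall i k, regular iota W (fun w => uf w i 0 k)) ->
  (forall x, regular iota W (fun w => pf w x)) ->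
  basic_open iota W (fun w => W w /\ good D (uf w) (pf w)).
Proof.
move=> hu hp; have h1 := basic_distinct (regular_Psi hu hp).
have h2 := @basic_all A K L iota (fun w => W w /\ distinct_pts (Psi D (uf w) (pf w))) _
  [seq s <- [:: true; false] | s || sw] (fun s w => self_sol D (uf w) (pf w) s 0 0).
apply: (basic_trans h1); apply: basic_eq (h2 _) => [w|s _].
  split=> [[[Ww d] h]|[Ww /goodP[d h]]].
    split=> //; apply/goodP; split=> // s hs; apply: h.
    by rewrite mem_filter hs; case: s {hs}.
  by split=> // s; rewrite mem_filter => /andP[/h].
apply: regular_frame_sol => i k.
  by apply: regular_sub (hu i k) => w [].
apply: regular_mulmx => [a b|a b].
  by rewrite (ord1 a); apply: regular_sub (hu i b) => w [].
by apply: regular_frame => x; apply: regular_sub (hp x) => w [].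
Qed.

(** The nodes [uf] may vary with the point: they are constant for a twist and functions on the
    product in the stable case. The last two clauses identify [W'] with the set of points of [W]
    that have a good parameter, so it is nonempty as soon as one such point is known. *)
Theorem regular_parameters W (uf : hcoord A L -> 'I_n -> 'rV[L]_(2 + r))
    (Zf : hcoord A L -> 'I_n -> 'rV[L]_2) : (1 < n)%N ->
  (forall i k, regular iota W (fun w => uf w i 0 k)) ->
  (forall i k, regular iota W (fun w => Zf w i 0 k)) ->
  (forall w, W w -> distinct_pts (Zf w)) ->
  exists W' (pf : hcoord A L -> ix -> L), [/\ basic_open iota W W',
    forall x, regular iota W' (fun w => pf w x),
    forall w, W' w -> good D (uf w) (pf w) /\ same_config (Zf w) (Psi D (uf w) (pf w))
  & forall w p, W w -> good D (uf w) p -> same_config (Zf w) (Psi D (uf w) p) ->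
      W' w /\ forall x, used D x -> pf w x = p x].
Proof.
move=> n1 hu hZ dZ; pose pf w := Phi D (uf w) (Zf w).
have hsol s i j : regular iota W (fun w => sol D (uf w) (Zf w) s i j).
  exact: regular_frame_sol.
have hbase s i j : regular iota W (fun w => base D (uf w) (Zf w) s i j).
  by apply: regular_ext (hsol s (lshift _ i) j) => w _; rewrite [RHS]mxE.
pose W1 w := W w /\ forall s, s \in [seq s <- [:: true; false] | s || sw] ->
  \det (base D (uf w) (Zf w) s) != 0.
have b1 : basic_open iota W W1 by apply: basic_all => s _; apply: regular_det.
have W1P w : W1 w <-> W w /\ forall s, s || sw -> \det (base D (uf w) (Zf w) s) != 0.
  split=> -[Ww h]; split=> // s; first by move=> hs; apply: h; rewrite mem_filter hs; case: s {hs}.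
  by rewrite mem_filter => /andP[/h].
have hinv s : s || sw -> forall i j, regular iota W1 (fun w => invmx (base D (uf w) (Zf w) s) i j).
  move=> hs; apply: regular_invmx => [w /W1P[_ /(_ s hs)]|i j]; first exact: unit_det.
  by apply: regular_sub (hbase s i j) => w /W1P[].
have htr : sw -> forall i j, regular iota W1 (fun w => transition D (uf w) (Zf w) i j).
  move=> hs; apply: regular_mulmx => [i j|]; last exact: hinv.
  by apply: regular_sub (hbase false i j) => w /W1P[].
have hco i j : regular iota W1 (fun w => coord_at D (uf w) (Zf w) i 0 j).
  apply: regular_mulmx => [a b|]; last by apply: hinv; apply: used_sgn.
  by rewrite (ord1 a); apply: regular_sub (hZ i b) => w /W1P[].
pose W2 w := W1 w /\ forall s, s \in [seq s <- [:: true] | sw] ->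
  transition D (uf w) (Zf w) 0 1 != 0.
have b2 : basic_open iota W1 W2.
  by apply: basic_all => s; rewrite mem_filter => /andP[hs _]; apply: htr.
pose W3 w := W2 w /\ forall i, i \in [seq i <- enum 'I_n | ~~ inO D i] ->
  coord_at D (uf w) (Zf w) i 0 0 != 0.
have s21 w : W2 w -> W1 w by case.
have b3 : basic_open iota W2 W3.
  by apply: basic_all => i _; apply: regular_sub (hco i 0).
have W3P w : W3 w <-> W w /\ solvable D (uf w) (Zf w).
  split=> [[[/W1P[Ww h1] h2] h3]|[Ww [h1 h2 h3]]].
    split=> //; split=> // [hs|i hi]; first by apply: (h2 true); rewrite mem_filter hs.
    by apply: h3; rewrite mem_filter hi mem_enum.
  split; first split; first by apply/W1P.
    by move=> s; rewrite mem_filter => /andP[/h2].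
  by move=> i; rewrite mem_filter => /andP[/h3].
have s31 w : W3 w -> W1 w by case=> -[].
have hpf x : regular iota W3 (fun w => pf w x).
  rewrite /pf /Phi; case: (boolP (used D x)) => [|_]; last exact: regular0.
  case: x => [[[s [a b]]|k]|i] /= hx.
  - apply: regular_mulmx => i j; last by apply: regular_sub (hinv s hx i j).
    apply: regular_ext (regular_sub _ (hsol s (rshift 2 i) j)) => w; first by rewrite [RHS]mxE.
    by case/W3P.
  - have ht i j : regular iota W3 (fun w => transition D (uf w) (Zf w) i j).
      exact: regular_sub (htr hx i j).
    apply: regularM; last by apply: regularV => // w /W3P[_ []] _ /(_ hx).
    by case: (k == 0) => //; case: (k == 1); apply: regularN.
  - apply: regularM; first exact: regular_sub (hco i 1).
    by apply: regularV; [move=> w /W3P[_ [_ _ /(_ i hx)]] | exact: regular_sub (hco i 0)].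
pose W4 w := W3 w /\ good D (uf w) (pf w).
have b4 : basic_open iota W3 W4.
  apply: basic_good => // i k; apply: regular_sub (hu i k) => w; by case/W3P.
exists W4, pf; split.
- exact: basic_trans (basic_trans (basic_trans b1 b2) b3) b4.
- by move=> x; apply: regular_sub (hpf x) => w [].
- move=> w [/W3P[Ww sv] g]; split=> //.
  by apply: Phi_config => //; [apply: dZ | case: g].
move=> w p Ww g s; have [sv e] := Phi_uniq g s; split=> //; split; first exact/W3P.
have fe s' : s' || sw -> frame (pf w) s' = frame p s'.
  move=> hs; congr (col_mx _ _); apply/matrixP => a b; rewrite !mxE; exact: e.
have fpe i : frame_pt D (uf w) (pf w) i = frame_pt D (uf w) p i.
  rewrite /frame_pt fe ?used_sgn //; case: ifP => // /negbT nO.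
  by congr row2; apply: e.
have pe i : Psi D (uf w) (pf w) i = Psi D (uf w) p i.
  rewrite /Psi fpe; have := used_sgn D i; case: (sgn D i) => //= hs; congr (_ *m _).
  have e' k : par_switch (pf w) k = par_switch p k by apply: e.
  by apply/matrixP => a b; rewrite !mxE !e'.
case: g => d g; split=> [i j ij|s' hs Q]; first by rewrite !pe; apply: d.
by rewrite fe //; apply: g.
Qed.

End RegularParametrization.

(** * Permutations and field automorphisms acting on the parameters *)

Section Symmetry.
Variables (L : fieldType) (n r : nat) (D : layout n r).
Local Notation ix := (param_ix n r).
Local Notation sw := (switch D).
Implicit Types (u : 'I_n -> 'rV[L]_(2 + r)) (p : ix -> L).

(** [chi] tells whether [h] exchanges the two halves. If so, the frames are exchanged and the switch
    is inverted, which is the transposition of its parameters 0 and 1. *)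
Definition param_act (chi : bool) (h : 'I_n -> 'I_n) (x : ix) : ix :=
  match x with
  | inl (inl (s, ab)) => inl (inl (s (+) chi, ab))
  | inl (inr k) => inl (inr (if chi then tperm 0 1 k else k))
  | inr i => inr (h i)
  end.

Definition compatible (chi : bool) (h : 'I_n -> 'I_n) := [/\ injective h, chi -> sw,
  forall i, inO D (h i) = inO D i & forall i, sgn D (h i) = sgn D i (+) chi].

Lemma used_act chi h x : compatible chi h -> used D (param_act chi h x) = used D x.
Proof.
case=> _ cs hO _; case: x => [[[s ab]|k]|i] //=; last by rewrite hO.
by case: chi cs; case: s => //= cs; rewrite ?(cs isT).
Qed.

Variables (chi : bool) (h : 'I_n -> 'I_n) (ch : compatible chi h).
Variables (u u' : 'I_n -> 'rV[L]_(2 + r)) (p p' : ix -> L).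
Hypothesis hu : forall i, inO D i -> u' (h i) = u i.
Hypothesis hp : forall x, used D x -> p' (param_act chi h x) = p x.

Lemma frame_act s : s || sw -> frame p' (s (+) chi) = frame p s.
Proof.
move=> hs; congr (col_mx _ _); apply/matrixP => a b; rewrite !mxE.
exact: (hp (x := inl (inl (s, (a, b))))).
Qed.

Lemma frame_pt_act i : frame_pt D u' p' (h i) = frame_pt D u p i.
Proof.
have [_ _ hO hs] := ch; rewrite /frame_pt hO hs frame_act ?used_sgn //.
case: ifP => [Oi|/negbT nOi]; first by rewrite hu.
by congr row2; apply: (hp (x := inr i)).
Qed.

(** Without exchange the two configurations are equal. With exchange they differ by the new switch
    matrix, whose product with the old one is scalar. *)
Lemma Psi_act : good D u p -> same_config (Psi D u p) (fun i => Psi D u' p' (h i)).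
Proof.
case=> d _; have [_ cs hO hs] := ch.
have ps k : sw -> par_switch p' (if chi then tperm 0 1 k else k) = par_switch p k.
  by move=> h'; apply: (hp (x := inl (inr k))).
case echi : chi ps cs hs => ps cs hs; last first.
  exists 1%:M; first exact: unitmx1.
  move=> i; exists 1; rewrite ?oner_neq0 // scale1r mulmx1 /Psi hs addbF frame_pt_act.
  have := used_sgn D i; case: (sgn D i) => //= h'; congr (_ *m _).
  by apply/matrixP => a b; rewrite !mxE !ps.
have {}cs : sw by apply: cs.
have t0 : tperm 0 1 0 = 1 :> 'I_3 by rewrite tpermL.
have t1 : tperm 0 1 1 = 0 :> 'I_3 by rewrite tpermR.
have t2 : tperm 0 1 2 = 2 :> 'I_3 by rewrite tpermD.
have p0 := ps 0 cs; have p1 := ps 1 cs; have p2 := ps 2 cs; rewrite t0 in p0; rewrite t1 in p1.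
rewrite t2 in p2.
have TT : switch_mx p *m switch_mx p' = (- \det (switch_mx p))%:M.
  apply/matrixP => a b; rewrite det2 mxE !big_ord_recl big_ord0 !mxE /= p0 p1 p2.
  by case: (crs_ord2 a) => ->; case: (crs_ord2 b) => -> /=; rewrite ?mulr1n ?mulr0n; ring.
have T0 := det_switch cs d.
have T0' : \det (switch_mx p') != 0.
  have := congr1 determinant TT; rewrite det_mulmx det_scalar => e.
  apply: contraNneq T0 => e'; move/eqP: e; rewrite e' mulr0 eq_sym expf_eq0 oppr_eq0.
  by case/andP.
exists (switch_mx p'); first exact: unit_det.
move=> i; rewrite /Psi hs frame_pt_act; case: (sgn D i) => /=.
  by exists 1; rewrite ?oner_neq0 // scale1r.
exists (- \det (switch_mx p))^-1; first by rewrite invr_eq0 oppr_eq0.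
by rewrite -mulmxA TT mul_mx_scalar scalerA mulVf ?oppr_eq0 // scale1r.
Qed.

Lemma good_act : good D u p -> good D u' p'.
Proof.
move=> g; have [hi cs hO hs] := ch; have [d gk] := g; split.
  have d' := same_config_distinct (Psi_act g) d.
  move=> i j ij; have [k hk hk'] := injF_bij hi.
  have := d' (k i) (k j); rewrite /= !hk'; apply.
  by apply: contraNneq ij => /(congr1 h); rewrite !hk' => ->.
move=> s0; have -> : s0 = (s0 (+) chi) (+) chi by rewrite -addbA addbb addbF.
move: (s0 (+) chi) => s hs'.
have hs1 : s || sw by case: (chi) cs hs'; case: (s) => //= cs _; apply: cs.
move=> Q hQ; rewrite frame_act //; apply: gk => // a.
have [Oa sa] := nodes_in a hs1.
have [a' ea'] : exists a', nodes D (s (+) chi) a' = h (nodes D s a).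
  by have := @nodes_onto _ _ D (h (nodes D s a)); rewrite hO hs sa; apply.
by have := hQ a'; rewrite ea' hu // frame_act.
Qed.

End Symmetry.

Section FieldMorphism.
Variables (L : fieldType) (n r : nat) (D : layout n r) (f : {rmorphism L -> L}).
Implicit Types (u : 'I_n -> 'rV[L]_(2 + r)) (p : param_ix n r -> L).

Lemma br_map (a b : 'rV[L]_2) : br (map_mx f a) (map_mx f b) = f (br a b).
Proof. by rewrite /br !mxE rmorphB !rmorphM. Qed.

Lemma map_row2 a b : map_mx f (row2 a b) = row2 (f a) (f b).
Proof. by apply/rowP => k; rewrite !mxE; case: ifP. Qed.

Lemma frame_map p s : map_mx f (frame p s) = frame (fun x => f (p x)) s.
Proof.
rewrite map_col_mx map_mx1; congr col_mx.
by apply/matrixP => a b; rewrite !mxE.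
Qed.

Lemma Psi_map u p i :
  map_mx f (Psi D u p i) = Psi D (fun i => map_mx f (u i)) (fun x => f (p x)) i.
Proof.
have E : map_mx f (frame_pt D u p i) = frame_pt D (fun i => map_mx f (u i)) (fun x => f (p x)) i.
  rewrite /frame_pt; case: ifP => _; last by rewrite map_row2 rmorph1.
  by rewrite map_mxM frame_map.
rewrite /Psi; case: ifP => _ //; rewrite map_mxM E; congr (_ *m _).
by apply/matrixP => a b; rewrite !mxE; do 2!case: ifP => _; rewrite ?rmorphN ?rmorph1.
Qed.

Lemma frame_sol_map (o : 'I_(r + r.+2).+1 -> 'I_n) u (Z : 'I_n -> 'rV[L]_2) :
  map_mx f (frame_sol o u Z) = frame_sol o (fun i => map_mx f (u i)) (fun i => map_mx f (Z i)).
Proof.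
have E : map_mx f (system o u Z) = system o (fun i => map_mx f (u i)) (fun i => map_mx f (Z i)).
  apply/matrixP => a b; rewrite !mxE; case: split => k; rewrite !mxE rmorphM //.
  by rewrite rmorphN.
have E' : map_mx f (cofactor_vec (system o u Z)) =
    cofactor_vec (system o (fun i => map_mx f (u i)) (fun i => map_mx f (Z i))).
  by rewrite /cofactor_vec map_col map_mx_adj map_col_mx map_mx0 E.
rewrite /frame_sol -E'; move: (cofactor_vec _) => v.
by apply/matrixP => a b; rewrite !mxE; case: split => k; rewrite !mxE.
Qed.

Lemma good_map u p : good D u p -> good D (fun i => map_mx f (u i)) (fun x => f (p x)).
Proof.
move=> /goodP[d g]; apply/goodP; split.
  by move=> i j ij; rewrite -!Psi_map br_map fmorph_eq0; apply: d.
move=> s hs; have e : self_sol D (fun i => map_mx f (u i)) (fun x => f (p x)) s =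
    map_mx f (self_sol D u p s).
  rewrite /self_sol frame_sol_map; congr (frame_sol _ _ _).
  by apply: boolp.funext => i; rewrite map_mxM frame_map.
by rewrite e mxE fmorph_eq0; apply: g.
Qed.

End FieldMorphism.

(** * Existence of good parameters *)

Section ExistsGood.
Variables (L : fieldType).
Hypothesis Linf : forall s : seq L, exists x, x \notin s.
Variables (n r : nat).
Local Notation l := (r + r.+2).+1.

Definition framing (u : 'I_n -> 'rV[L]_(2 + r)) (o : 'I_l -> 'I_n) (ab : 'M[L]_(r, 2)) :=
  let R : 'M[L]_(2 + r, 2) := col_mx 1%:M ab in
  (forall Q, solves o u (fun i => u i *m R) Q -> exists k, Q = k *: R) /\
  (forall a b, a != b -> br (u (o a) *m R) (u (o b) *m R) != 0).

Lemma poly_neq0_at0 (P : {poly L}) : P.[0] != 0 -> P != 0.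
Proof. by apply: contraNneq => ->; rewrite horner0. Qed.

Local Ltac nonzero_at0 := apply: poly_neq0_at0; rewrite !hornerE /= ?expr0n /=
  ?(mulr0, mul0r, addr0, add0r, mulr1, mul1r) ?mulf_neq0 ?oner_neq0.

Section Generic_position.
Variables (D : layout n r) (u : 'I_n -> 'rV[L]_(2 + r)) (ab : bool -> 'M[L]_(r, 2)).
Hypothesis fr : forall s, s || switch D -> framing u (nodes D s) (ab s).

Let R s : 'M[L]_(2 + r, 2) := col_mx 1%:M (ab s).

Let fp i : 'rV[{poly L}]_2 := if inO D i then map_mx polyC (u i *m R (sgn D i))
  else \row_k if k == 0 then 1 else 'X^(i.+1).

(** The remaining parameters are powers of one indeterminate. With 'X, 'X^2, 'X^4 for the switch,
    the bracket of constant vectors v and w of opposite signs is v0 w0 + v0 w1 'X + v1 w0 'X^2 + v1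
    w1 'X^4; the exponents are distinct, so it is not the zero polynomial. *)
Let T : 'M[{poly L}]_2 := \matrix_(i, j)
  if i == 0 then (if j == 0 then - 'X^2 else 1) else (if j == 0 then - 'X^4 else 'X).

Let PP i := if sgn D i then fp i else fp i *m T.

Let par (x : L) (k : param_ix n r) : L := match k with
  | inl (inl (s, (a, b))) => ab s a b
  | inl (inr k) => if k == 0 then x else if k == 1 then x ^+ 2 else x ^+ 4
  | inr i => x ^+ i.+1 end.

Let detT : \det T = 'X^4 - 'X^3.
Proof. by rewrite det2 !mxE /=; ring. Qed.

Let detT0 : \det T != 0.
Proof.
rewrite detT (_ : 'X^4 - 'X^3 = 'X^3 * ('X - 1%:P)); last by rewrite polyC1; ring.
by rewrite mulf_neq0 ?expf_neq0 ?polyX_eq0 ?polyXsubC_eq0.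
Qed.

Let node_neq0 i : inO D i -> u i *m R (sgn D i) != 0.
Proof.
move=> Oi; have [a ea] := nodes_onto Oi.
have [_ h] := fr (used_sgn D i).
have [b ba] : exists b : 'I_l, a != b.
  have [->|n0] := eqVneq a 0; last by exists 0.
  by exists ord_max; rewrite -val_eqE /= addnS.
by have := br_neq0l (h a b ba); rewrite ea.
Qed.

Let shape i : (exists a b : L, [/\ (a != 0) || (b != 0), fp i 0 0 = a%:P & fp i 0 1 = b%:P]) \/
  (fp i 0 0 = 1 /\ fp i 0 1 = 'X^(i.+1)).
Proof.
rewrite /fp; case: ifP => [Oi|_]; last by right; rewrite !mxE.
left; have := node_neq0 Oi; move: (u i *m _) => v v0.
exists (v 0 0), (v 0 1); rewrite !mxE; split=> //; rewrite -negb_and.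
by apply: contra v0 => /andP[/eqP v00 /eqP v01]; apply/eqP/row2_eq; rewrite ?v00 ?v01 mxE.
Qed.

Let same_sign i j : i != j -> sgn D i = sgn D j -> br (fp i) (fp j) != 0.
Proof.
move=> ij sij; rewrite /fp; case: ifP => Oi; case: ifP => Oj.
- rewrite br_C polyC_eq0 -sij.
  have [a ea] := nodes_onto Oi; have [b eb] := nodes_onto Oj; rewrite -sij in eb.
  have [_ h] := fr (used_sgn D i).
  have := h a b; rewrite ea eb; apply; apply: contraNneq ij => e; by rewrite -ea -eb e.
- have := node_neq0 Oi; move: (u i *m _) => v v0; rewrite /br !mxE /= mulr1.
  have [e0|n1] := eqVneq (v 0 1) 0.
    have n0 : v 0 0 != 0 by apply: contraNneq v0 => e; apply/eqP/row2_eq; rewrite ?e ?e0 mxE.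
    by rewrite e0 subr0 mulf_neq0 ?polyC_eq0 ?expf_neq0 ?polyX_eq0.
  apply: poly_neq0_at0; rewrite !hornerE /= expr0n /= mulr0 sub0r oppr_eq0 //.
- have := node_neq0 Oj; move: (u j *m _) => v v0; rewrite /br !mxE /= mul1r.
  have [e0|n1] := eqVneq (v 0 1) 0.
    have n0 : v 0 0 != 0 by apply: contraNneq v0 => e; apply/eqP/row2_eq; rewrite ?e ?e0 mxE.
    by rewrite e0 sub0r oppr_eq0 mulf_neq0 ?polyC_eq0 ?expf_neq0 ?polyX_eq0.
  apply: poly_neq0_at0; rewrite !hornerE /= expr0n /= mul0r subr0 //.
rewrite /br !mxE /= mul1r mulr1 subr_eq0; apply: contraNneq ij => e.
have := congr1 (fun P : {poly L} => size P) e; rewrite !size_polyXn => -[e'].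
by apply/eqP/val_inj; rewrite /= e'.
Qed.

Let cross_sign (v w : 'rV[{poly L}]_2) :
  br v (w *m T) = v 0 0 * (w 0 0 + 'X * w 0 1) + 'X^2 * v 0 1 * (w 0 0 + 'X^2 * w 0 1).
Proof. by rewrite /br !mul_rV2 !mxE /=; ring. Qed.

Let opposite_sign i j : br (fp i) (fp j *m T) != 0.
Proof.
rewrite cross_sign.
have X0 : 'X != 0 :> {poly L} by rewrite polyX_eq0.
case: (shape i) => [[a [b [ab0 -> ->]]]|[-> ->]]; case: (shape j) => [[c [d [cd0 -> ->]]]|[-> ->]].
- have [a0|a0] := eqVneq a 0; last have [c0|c0] := eqVneq c 0.
  + rewrite a0 mul0r add0r mulf_neq0 ?expf_neq0 //.
      by rewrite mulf_neq0 ?expf_neq0 // polyC_eq0; move: ab0; rewrite a0 eqxx.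
    have [c0|c0] := eqVneq c 0.
      by rewrite c0 add0r mulf_neq0 ?expf_neq0 // polyC_eq0; move: cd0; rewrite c0 eqxx.
    by nonzero_at0.
  + have d0 : d != 0 by move: cd0; rewrite c0 eqxx.
    rewrite c0 !add0r (_ : _ + _ = 'X * d%:P * (a%:P + 'X^3 * b%:P)); last by ring.
    rewrite !mulf_neq0 ?polyC_eq0 //; by nonzero_at0.
  by nonzero_at0.
- have [a0|a0] := eqVneq a 0.
    have b0 : b != 0 by move: ab0; rewrite a0 eqxx.
    rewrite a0 mul0r add0r !mulf_neq0 ?expf_neq0 ?polyC_eq0 //.
    by nonzero_at0.
  by nonzero_at0.
- have [c0|c0] := eqVneq c 0.
    have d0 : d != 0 by move: cd0; rewrite c0 eqxx.
    rewrite c0 !add0r (_ : _ + _ = 'X * d%:P * (1 + 'X^3 * 'X^(i.+1))); last by ring.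
    rewrite !mulf_neq0 ?polyC_eq0 //; by nonzero_at0.
  by nonzero_at0.
by nonzero_at0.
Qed.

Let PP_neq0 i j : i != j -> br (PP i) (PP j) != 0.
Proof.
move=> ij; rewrite /PP; case si : (sgn D i); case sj : (sgn D j).
- by rewrite same_sign // si sj.
- exact: opposite_sign.
- by rewrite br_anti oppr_eq0 opposite_sign.
by rewrite br_mul mulf_neq0 // same_sign // si sj.
Qed.

Let frame_par x s : frame (par x) s = R s.
Proof. by congr col_mx; apply/matrixP => a b; rewrite !mxE. Qed.

Let PP_at x i : pt_at x (PP i) = Psi D u (par x) i.
Proof.
have E : pt_at x (fp i) = frame_pt D u (par x) i.
  rewrite /frame_pt frame_par /fp; case: ifP => _; first exact: pt_at_C.
  by apply: row2_eq; rewrite !mxE /= !hornerE.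
rewrite /PP /Psi; case: ifP => _ //; rewrite -E.
by apply: row2_eq; rewrite mxE !mul_rV2 !mxE /= /par_switch /= !hornerE /=; ring.
Qed.

Lemma good_of_framings : exists p, good D u p.
Proof.
pose b := \prod_i \prod_(j | i != j) br (PP i) (PP j).
have [x] : exists x, b.[x] != 0.
  apply: (poly_nonroot Linf); apply/prodf_neq0 => i _; apply/prodf_neq0 => j ij.
  exact: PP_neq0.
rewrite horner_prod => /prodf_neq0 h; exists (par x); split.
  move=> i j ij; rewrite -!PP_at br_at; have := h i isT.
  by rewrite horner_prod => /prodf_neq0; apply.
by move=> s hs Q; rewrite frame_par; case: (fr hs) => H _; apply: H.
Qed.

End Generic_position.

(* Cauchy interpolation: a rational function of degree r + 1 is determined by its values at 2 r + 3 points. *)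
Lemma framing_powers (y : 'I_n -> L) (o : 'I_l -> 'I_n) : injective (fun a => y (o a)) ->
  exists ab, framing (fun i => \row_j y i ^+ j) o ab.
Proof.
move=> yinj.
have [c [c0 hc]] : exists c, c != 0 /\ forall a b, a != b ->
    y (o a) - y (o b) + c * (y (o a) ^+ r.+1 - y (o b) ^+ r.+1) != 0.
  pose b := 'X * \prod_a \prod_(b | a != b)
    ((y (o a) - y (o b))%:P + 'X * (y (o a) ^+ r.+1 - y (o b) ^+ r.+1)%:P).
  have [c] : exists c, b.[c] != 0.
    apply: (poly_nonroot Linf); rewrite mulf_neq0 ?polyX_eq0 //.
    apply/prodf_neq0 => i _; apply/prodf_neq0 => j ij; apply: poly_neq0_at0.
    rewrite !hornerE /= subr_eq0; by apply: contraNneq ij => /yinj ->.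
  rewrite hornerM hornerX mulf_eq0 negb_or horner_prod => /andP[c0 /prodf_neq0 h].
  exists c; split=> // i j ij; have := h i isT; rewrite horner_prod => /prodf_neq0/(_ j ij).
  by rewrite !hornerE.
(* The frame lists the coefficients of the pair (1, B). Constant term 0 and linear term 1 in B make
   its first two rows the identity, and the top term makes B of degree r + 1 with distinct values at
   the nodes. For r = 0 the top term is the linear one, whose coefficient must stay 1, so B = 'X. *)
pose k := if r == 0%N then 0 else c.
pose B : {poly L} := 'X + k *: 'X^(r.+1).
have B0 : B`_0 = 0 by rewrite !coefE /= mulr0 addr0.
have B1 : B`_1 = 1 by rewrite !coefE /= /k; case: (r) => [|r'] /=; rewrite ?mul0r ?mulr0 addr0.
have sB : size B = r.+2.
  rewrite /B /k; case er : (r) => [|r'] /=; first by rewrite scale0r addr0 size_polyX.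
  by rewrite addrC size_polyDl size_scale // size_polyXn // size_polyX.
pose Bc (j : 'I_2) : {poly L} := if j == 0 then 1 else B.
pose ab : 'M[L]_(r, 2) := \matrix_(a, b) (Bc b)`_(2 + a).
pose R : 'M[L]_(2 + r, 2) := col_mx 1%:M ab.
have RE i j : R i j = (Bc j)`_i.
  rewrite /R; case: (split_ordP i) => a ->; rewrite ?col_mxEu ?col_mxEd mxE //.
  rewrite /Bc; case: (crs_ord2 a) => ->; case: (crs_ord2 j) => ->; rewrite /= ?B0 ?B1 ?coef1 //.
pose pq (Q : 'M[L]_(2 + r, 2)) (j : 'I_2) : {poly L} := \poly_(i < 2 + r) Q (inord i) j.
have pqE Q i j : (pq Q j)`_i = if (i < 2 + r)%N then Q (inord i) j else 0.
  by rewrite coef_poly.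
have pq_at Q i j : ((\row_j y i ^+ j : 'rV_(2 + r)) *m Q) 0 j = (pq Q j).[y i].
  rewrite mxE horner_poly; apply: eq_bigr => a _; rewrite mxE mulrC; congr (Q _ _ * _).
  by rewrite inord_val.
have pqR j : pq R j = Bc j.
  apply/polyP => i; rewrite pqE; case: ltnP => hi; first by rewrite RE inordK.
  rewrite nth_default // /Bc; case: ifP => _; last by rewrite sB.
  by rewrite size_poly1; apply: leq_trans hi.
exists ab; rewrite /framing -/R; split=> [Q hQ|a b aneb].
  pose f := pq Q 0; pose g := pq Q 1.
  have sf : (size f <= r.+2)%N by apply: size_poly.
  have sg : (size g <= r.+2)%N by apply: size_poly.
  (* f B - g has degree at most 2 r + 2 and vanishes at 2 r + 3 points. Then g = f B has degree at
     most r + 1, the degree of B, which forces f to be constant. *)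
  have fB : f * B = g.
    apply/eqP; rewrite -subr_eq0; apply/negPn/negP => n0.
    have rts : all (root (f * B - g)) [seq y (o a) | a <- enum 'I_l].
      apply/allP => x /mapP[a _ ->]; apply/rootP.
      have := hQ a; rewrite /br !pq_at !pqR /Bc /= hornerC => e.
      by rewrite hornerD hornerN hornerM -[RHS]e mulr1.
    have := max_poly_roots n0 rts; rewrite map_inj_uniq ?enum_uniq // => /(_ isT).
    rewrite size_map size_enum_ord ltnNge => /negP; apply.
    apply: leq_trans (size_polyD _ _) _; rewrite size_polyN geq_max.
    apply/andP; split; last by apply: leq_trans sg _; lia.
    apply: leq_trans (size_polyMleq _ _) _; rewrite sB; move: (size f) sf => m hm; clear -hm; lia.
  have [k' ek] : exists k', f = k'%:P.
    have [->|f0] := eqVneq f 0; first by exists 0.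
    exists f`_0; apply: size1_polyC.
    have Bn0 : B != 0 by rewrite -size_poly_gt0 sB.
    by move: sg; rewrite -fB size_mul // sB; move: (size f) => m hm; clear -hm; lia.
  exists k'; apply/matrixP => i j; rewrite [RHS]mxE -/R RE.
  have -> : Q i j = (pq Q j)`_i by rewrite pqE ltn_ord inord_val.
  rewrite -coefCM; congr (_`_i); rewrite /Bc.
  by case: (crs_ord2 j) => -> /=; rewrite -?ek ?mulr1 // fB.
rewrite /br !pq_at !pqR /Bc /= !hornerC mul1r mulr1 /B !hornerE.
have [r0|r0] := eqVneq r 0%N; last first.
  have := hc b a; rewrite eq_sym => /(_ aneb); rewrite /k (negPf r0).
  by congr (_ != _); ring.
rewrite /k r0 /= !mul0r !addr0 subr_eq0; by apply: contraNneq aneb => /yinj ->.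
Qed.

(** For r = 0 the frame is the identity and the three nodes sit at infinity, 0 and 1; a matrix for
    which these three vectors are eigenvectors is scalar. *)
Lemma framing_three (z : 'I_n -> 'I_3) (o : 'I_(0 + 2).+1 -> 'I_n) (u : 'I_n -> 'rV[L]_(2 + 0)) :
  injective (fun a => z (o a)) ->
  (forall i, u i = nth 0 [:: row2 1 0; row2 0 1; row2 1 1] (z i)) ->
  let R : 'M[L]_(2 + 0, 2) := col_mx 1%:M 0 in
  (forall Q, solves o u (fun i => u i *m R) Q -> exists k, Q = k *: R) /\
  (forall a b, a != b -> br (u (o a) *m R) (u (o b) *m R) != 0).
Proof.
move=> zinj hu R.
have R1 : R = 1%:M.
  apply/matrixP => i j; rewrite /R; case: (split_ordP i) => a ->; last by case: a.
  by rewrite col_mxEu !mxE.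
have onto c : exists a, z (o a) = c.
  have [k hk hk'] := injF_bij zinj; by exists (k c).
rewrite R1; split=> [Q hQ|a b ab]; last first.
  rewrite !mulmx1 !hu; have : z (o a) != z (o b) by apply: contraNneq ab => /zinj ->.
  case: (ord3 (z (o a))) => ->; case: (ord3 (z (o b))) => -> //= _;
    by rewrite br_row2 ?mulr1 ?mulr0 ?mul0r ?subr0 ?sub0r ?oppr_eq0 ?oner_neq0.
have val_at c : br (nth 0 [:: row2 1 0; row2 0 1; row2 1 1] (c : 'I_3) *m Q)
    (nth 0 [:: row2 1 0; row2 0 1; row2 1 1] c) = 0.
  have [a ea] := onto c; have := hQ a; by rewrite mulmx1 !hu ea.
have h0 := val_at 0; have h1 := val_at 1; have h2 := val_at 2.
move: h0 h1 h2; rewrite /= /br !mul_rV2 !mxE /= !mul1r !mul0r !mulr1 !mulr0 ?addr0 ?add0r ?subr0 ?sub0r.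
move=> /eqP; rewrite oppr_eq0 => /eqP h0 h1; rewrite h0 h1 addr0 add0r => /eqP.
rewrite subr_eq0 => /eqP h2; exists (Q 0 0); apply/matrixP => i j; rewrite !mxE.
by case: (crs_ord2 i) => ->; case: (crs_ord2 j) => ->; rewrite /= ?mulr1 ?mulr0.
Qed.

Lemma good_of_powers (D : layout n r) (y : 'I_n -> L) :
  (forall s, s || switch D -> injective (fun a => y (nodes D s a))) ->
  exists p, good D (fun i => \row_j y i ^+ j) p.
Proof.
move=> yinj.
have /fin_all_exists[ab hab] s : exists ab, s || switch D ->
    framing (fun i => \row_j y i ^+ j) (nodes D s) ab.
  case: (boolP (s || switch D)) => hs; last by exists 0.
  by have [ab hab] := framing_powers (yinj s hs); exists ab.
exact: good_of_framings hab.
Qed.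

End ExistsGood.

(** * Cycles of a permutation of order 2m *)

Section Layouts.
Variables (n m : nat) (g : 'S_n).
Hypothesis n5 : (5 <= n)%N.
Hypothesis m_odd : odd m.
Hypothesis g_ord : (g ^+ (2 * m) = 1)%g.

Lemma make_layout r (O : pred 'I_n) (sg : 'I_n -> bool) (sw : bool) :
  (forall i, sg i || sw) ->
  (forall s, s || sw -> #|[pred i | O i && (sg i == s)]| = (r + r.+2).+1) ->
  exists D : layout n r, [/\ inO D = O, sgn D = sg & switch D = sw].
Proof.
move=> hs hc; pose i0 : 'I_n := Ordinal (leq_trans (isT : 1 <= 5)%N n5).
pose nd s (a : 'I_(r + r.+2).+1) := nth i0 (enum [pred i | O i && (sg i == s)]) a.
have h1 s a : s || sw -> O (nd s a) /\ sg (nd s a) = s.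
  move=> h; have : nd s a \in enum [pred i | O i && (sg i == s)].
    by apply: mem_nth; rewrite -cardE hc.
  by rewrite mem_enum => /andP[-> /eqP].
have h2 i : O i -> exists a, nd (sg i) a = i.
  move=> Oi; have hi : i \in enum [pred j | O j && (sg j == sg i)] by rewrite mem_enum !inE Oi eqxx.
  have lt : (index i (enum [pred j | O j && (sg j == sg i)]) < (r + r.+2).+1)%N.
    by rewrite -(hc _ (hs i)) cardE index_mem.
  by exists (Ordinal lt); apply: nth_index.
have h3 s : s || sw -> injective (nd s).
  move=> h a b /eqP; rewrite nth_uniq ?enum_uniq ?[X in (_ < X)%N]cardE -?cardE ?hc //.
  by move=> /eqP /val_inj.
by exists (Layout hs h1 h2 h3).
Qed.

Local Notation f := (fun i => g i).
Local Notation cyc i := (fingraph.order f i).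
Let f_inj : injective f. Proof. exact: perm_inj. Qed.

Lemma iter_perm k (i : 'I_n) : iter k f i = (g ^+ k)%g i.
Proof. by rewrite permX. Qed.

Lemma order_dvd (i : 'I_n) : (cyc i %| 2 * m)%N.
Proof.
have h : iter (2 * m %% cyc i) f i = i.
  have : iter (2 * m) f i = i by rewrite iter_perm g_ord perm1.
  rewrite {1}(divn_eq (2 * m) (cyc i)) addnC iterD.
  suff -> : iter (2 * m %/ cyc i * cyc i) f i = i by [].
  elim: (_ %/ _)%N => //= k ih; by rewrite mulSn iterD ih iter_order.
have lt : (2 * m %% cyc i < cyc i)%N by rewrite ltn_mod fingraph.order_gt0.
have := findex_iter lt; rewrite h findex0 => /esym/eqP.
by [].
Qed.

(** A cycle length divides 2 m with m odd, so it is not a multiple of 4; the halves of an even cycle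
    are therefore of odd size. *)
Lemma order_not4 (i : 'I_n) : ~~ odd (cyc i) -> exists2 d, odd d & cyc i = d.*2.
Proof.
move=> ev; have e : cyc i = (cyc i)./2.*2 by rewrite even_halfK.
exists (cyc i)./2 => //; move: (cyc i)./2 e => h e.
have := order_dvd i; rewrite e -mul2n dvdn_pmul2l // => /dvdnP[k ek].
by move: m_odd; rewrite ek oddM => /andP[].
Qed.

Let fsym : connect_sym (frel f). Proof. exact: fconnect_sym. Qed.

Lemma fconnect_perm i0 i : fconnect f i0 (g i) = fconnect f i0 i.
Proof. by rewrite -(same_fconnect1_r f_inj i0 i). Qed.

(** The sign alternates along a cycle from its root on; this is consistent where the cycle closes
    exactly because its length is even. *)
Definition parity i := ~~ odd (findex f (froot f i) i).

Lemma parity_perm i : ~~ odd (cyc i) -> parity (g i) = ~~ parity i.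
Proof.
move=> ev; rewrite /parity negbK.
have rg : froot f (g i) = froot f i.
  by apply/eqP; rewrite root_connect // fsym fconnect1.
have ri : fconnect f (froot f i) i by rewrite fsym connect_root.
set x := froot f i in rg ri *; set k := findex f x i.
have kE : iter k f x = i by apply: iter_findex.
have ok : (k < cyc x)%N by apply: findex_max.
have ox : cyc x = cyc i by apply: eq_card => j; apply: same_connect.
have ek : iter k.+1 f x = g i by rewrite iterS kE.
rewrite rg; move: ok; rewrite leq_eqVlt => /orP[/eqP e|lt].
  have -> : g i = x by rewrite -ek e iter_order.
  rewrite findex0 /=; move: ev; rewrite -ox -e /= negbK => ->; by [].
by rewrite -ek findex_iter //= negbK.
Qed.

Lemma card_parity (O : pred 'I_n) : (forall i, O (g i) = O i) ->
  (forall i, O i -> ~~ odd (cyc i)) ->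
  forall s, #|[pred i | O i && (parity i == s)]|.*2 = #|O|.
Proof.
move=> hO ev.
have e : #|[pred i | O i && (parity i == false)]| = #|[pred i | O i && (parity i == true)]|.
  rewrite -(card_image f_inj [pred i | O i && (parity i == true)]).
  apply: eq_card => i; rewrite !inE; apply/andP/imageP => [[Oi /eqP pi]|[j /andP[Oj /eqP pj] ->]].
    have gi : g (g^-1 i)%g = i by rewrite permKV.
    have Oj : O (g^-1 i)%g by rewrite -hO gi.
    exists (g^-1 i)%g => //; rewrite inE Oj /=.
    by have := parity_perm (ev _ Oj); rewrite gi pi => /esym/negbFE ->.
  by rewrite hO parity_perm ?ev // pj.
have s2 : (#|[pred i | O i && (parity i == true)]| + #|[pred i | O i && (parity i == false)]|)%N = #|O|.
  rewrite -(cardID [pred i | parity i] O); congr (_ + _)%N; apply: eq_card => i; rewrite !inE.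
    by rewrite eqb_id andbC.
  by rewrite eqbF_neg andbC.
by case; rewrite -s2 ?e addnn // -e.
Qed.

Definition invariant_layout r (D : layout n r) :=
  (forall i, inO D (g i) = inO D i) /\ (forall i, sgn D (g i) = sgn D i (+) switch D).

(** All nodes but at most one lie in a nontrivial orbit. Conjugate elements indexed by the orbit,
    together with 0 for the possible extra node, then give distinct nodes. *)
Definition orbit_layout r (D : layout n r) := exists i0, [/\ (1 < #|fconnect f i0|)%N
  & forall i j, inO D i -> inO D j -> ~~ fconnect f i0 i -> ~~ fconnect f i0 j -> i = j].

(** The nodes of each half carry three letters preserved by the permutation, so nodes in fixed
    position at infinity, 0 and 1 are equivariant. *)
Definition three_layout (D : layout n 0) := exists z : 'I_n -> 'I_3,
  (forall i, inO D i -> z (g i) = z i) /\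
  (forall s, s || switch D -> injective (fun a => z (nodes D s a))).

Lemma odd_shape k : odd k -> (3 <= k)%N -> k = (k./2.-1 + k./2.-1.+2).+1.
Proof. by move=> ok k3; have := odd_double_half k; rewrite ok; lia. Qed.

(** The cases are: an odd cycle of length at least 3; a cycle of length 2 d together with a fixed
    point, giving 2 d + 1 = 2 (d - 1) + 3 nodes; the identity, with any three points; no fixed point
    and a cycle of length 2 d with d odd and at least 3, cut into two halves; transpositions only,
    three of them being used. *)
Lemma layout_exists :
  (exists r (D : layout n r), invariant_layout D /\ orbit_layout D) \/
  (exists D : layout n 0, invariant_layout D /\ three_layout D).
Proof.
case: (boolP [exists i, odd (cyc i) && (3 <= cyc i)%N]) => [/existsP[i0 /andP[oo o3]]|].
  left; exists (cyc i0)./2.-1.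
  have [|s|D [eO es ew]] := @make_layout (cyc i0)./2.-1 (fconnect f i0) (fun=> true) false => //.
    rewrite orbF => ->; rewrite -odd_shape //; apply: eq_card => i; by rewrite !inE andbT.
  exists D; split; first by split=> i; rewrite ?eO ?es ?ew // fconnect_perm.
  exists i0; split; first exact: leq_trans o3.
  by move=> i j; rewrite eO => ->.
rewrite negb_exists => /forallP no_odd3.
have odd1 i : odd (cyc i) -> cyc i = 1%N.
  move=> oi; have := no_odd3 i; have := fingraph.order_gt0 f i; rewrite oi /=.
  by case: (cyc i) oi => [|[|[|k]]].
have fixed i : cyc i = 1%N -> g i = i.
  by move=> o1; have := iter_order f_inj i; rewrite o1.
case: (boolP [exists i, odd (cyc i)]) => [/existsP[i1 oi1]|].
  have fi1 := fixed _ (odd1 _ oi1).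
  case: (boolP [exists i, ~~ odd (cyc i)]) => [/existsP[i0 ev]|].
    left; have [d od ed] := order_not4 ev.
    have d0 : (0 < d)%N by case: d od {ed}.
    have ni1 : ~~ fconnect f i0 i1.
      apply: contra ev; rewrite fsym => /iter_findex; rewrite iter_perm => <-.
      suff -> : (g ^+ findex f i1 i0)%g i1 = i1 by [].
      by rewrite -iter_perm; elim: (findex _ _ _) => //= k ->.
    pose O := [predU1 i1 & fconnect f i0].
    have [|s|D [eO es ew]] := @make_layout d.-1 O (fun=> true) false => //.
      rewrite orbF => ->; transitivity #|O|; first by apply: eq_card => i; rewrite !inE andbT.
      rewrite cardU1 [_ \in _](negPf ni1) /= -/(cyc i0) ed; case: (d) d0 => // k _; lia.
    exists d.-1, D; split; first split=> i; rewrite ?eO ?es ?ew //.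
      by rewrite !inE /= fconnect_perm -{1}fi1 (inj_eq f_inj).
    exists i0; split; first by rewrite -/(cyc i0) ed; case: (d) d0.
    by move=> i j; rewrite eO !inE => /orP[/eqP ->|->] // /orP[/eqP ->|->].
  rewrite negb_exists => /forallP all_odd.
  have g1 i : g i = i by apply: fixed; apply: odd1; have := all_odd i; rewrite negbK.
  have n3 : (3 <= n)%N by apply: leq_trans n5.
  right; have [|s|D [eO es ew]] := @make_layout 0 [pred i : 'I_n | (i < 3)%N] (fun=> true) false => //.
    rewrite orbF => ->; rewrite -[RHS](card_ord 3).
    have wi : injective (widen_ord n3) by move=> i j /(congr1 val) /= /val_inj.
    rewrite -(card_image wi); apply: eq_card => i; rewrite !inE andbT.
    apply/idP/imageP => [i3|[k _ ->]]; last by case: k.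
    by exists (Ordinal i3) => //; apply/val_inj.
  exists D; split; first by split=> i; rewrite ?eO ?es ?ew // !inE g1.
  exists (fun i => inord i); split=> [i _|s hs a b e]; first by rewrite g1.
  have [Oa _] := nodes_in a hs; have [Ob _] := nodes_in b hs.
  move: Oa Ob; rewrite eO !inE => Oa Ob; apply: (nodes_inj hs); apply/val_inj.
  by have := congr1 val e; rewrite /= !inordK.
rewrite negb_exists => /forallP ev.
have sgT i : parity i || true by rewrite orbT.
have psgn i : parity (g i) = parity i (+) true by rewrite parity_perm // addbT.
case: (boolP [exists i, (4 <= cyc i)%N]) => [/existsP[i0 o4]|].
  left; have [d od ed] := order_not4 (ev i0).
  have d3 : (3 <= d)%N by move: od o4; rewrite ed; case: (d) => [|[|[|k]]].
  have [s _|D [eO es ew]] := @make_layout d./2.-1 (fconnect f i0) parity true sgT.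
    rewrite -odd_shape //; apply: double_inj.
    by rewrite (card_parity (fconnect_perm i0)) -/(cyc i0).
  exists d./2.-1, D; split; first by split=> i; rewrite ?eO ?es ?ew // fconnect_perm.
  exists i0; split; first exact: leq_trans o4.
  by move=> i j; rewrite eO => ->.
rewrite negb_exists => /forallP lt4; right.
have two i : cyc i = 2%N.
  by have := lt4 i; have := ev i; have := fingraph.order_gt0 f i; case: (cyc i) => [|[|[|[|k]]]].
have gg i : g (g i) = i by have := iter_order f_inj i; rewrite two.
(* All cycles have length 2, so n is even and thus at least 6: three transpositions are
   available. *)
have pn : (3 <= #|[pred i | parity i]|)%N.
  have := @card_parity predT (fun=> erefl) (fun i _ => ev i) true.
  rewrite card_ord (_ : #|[pred i | predT i && (parity i == true)]| = #|[pred i | parity i]|); last first.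
    by apply: eq_card => i; rewrite !inE eqb_id.
  by move: n5; lia.
pose i0 : 'I_n := Ordinal (leq_trans (isT : 1 <= 5)%N n5).
pose a (k : 'I_3) := nth i0 (enum [pred i | parity i]) k.
have ap k : parity (a k).
  have : a k \in enum [pred i | parity i] by apply: mem_nth; rewrite -cardE (leq_trans _ pn).
  by rewrite mem_enum.
have ainj : injective a.
  move=> k k' /eqP; rewrite nth_uniq ?enum_uniq // -?cardE ?(leq_trans _ pn) //.
  by move=> /eqP /val_inj.
pose Q i k := (i == a k) || (i == g (a k)).
have QE i k : Q i k = (i == if parity i then a k else g (a k)).
  rewrite /Q; case pi : (parity i).
    case: (i =P a k) => //= _; apply/negP => /eqP e; move: pi; rewrite e psgn ap //.
  case: (i =P a k) => //= e; by move: pi; rewrite e ap.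
have Qu i k k' : Q i k -> Q i k' -> k = k'.
  by rewrite !QE; case: (parity i) => /eqP -> /eqP => [/ainj|/f_inj/ainj].
have Qg i k : Q (g i) k = Q i k.
  rewrite !QE psgn addbT; case: (parity i) => /=; first by rewrite (inj_eq f_inj).
  by rewrite -[X in _ == X]gg (inj_eq f_inj).
have [s _|D [eO es ew]] := @make_layout 0 [pred i | [exists k, Q i k]] parity true sgT.
  rewrite -[RHS](card_ord 3).
  have inj' : injective (fun k => if s then a k else g (a k)).
    by case: s => k k'; [exact: ainj | move/f_inj/ainj].
  rewrite -(card_image inj'); apply: eq_card => i; rewrite !inE.
  apply/andP/imageP => [[/existsP[k Qk] /eqP ps]|[k _ ->]].
    by exists k => //; move: Qk; rewrite QE ps => /eqP.
  split; last by case: s {inj'}; rewrite ?psgn ap.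
  by apply/existsP; exists k; rewrite /Q; case: s {inj'}; rewrite eqxx ?orbT.
exists D; split.
  by split=> i; rewrite ?eO ?es ?ew // !inE; apply: eq_existsb => k; rewrite Qg.
exists (fun i => odflt 0 [pick k | Q i k]); split.
  by move=> i _; congr odflt; apply: eq_pick => k; rewrite /= Qg.
have zE i k : Q i k -> odflt 0 [pick k | Q i k] = k.
  by move=> Qk; case: pickP => [k' Qk'|/(_ k)]; [exact: Qu Qk' Qk | rewrite Qk].
move=> s hs b b' e; have [Ob sb] := nodes_in b hs; have [Ob' sb'] := nodes_in b' hs.
move: Ob Ob' sb sb'; rewrite eO es => /existsP[k Qk] /existsP[k' Qk'] sb sb'.
apply: (nodes_inj hs); move: e; rewrite (zE _ _ Qk) (zE _ _ Qk') => e.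
by move: Qk Qk'; rewrite -e !QE sb sb' => /eqP -> /eqP ->.
Qed.

End Layouts.

(** * The absolute Galois group *)

Section SeparableClosure.
Variables (F L : fieldType) (iota : {rmorphism F -> L}).
Hypothesis sc : separable_closure iota.

(* If s exhausted L, with q elements and W the product of the X - a, then 1 + X W^q would be separable,
   because q = 0 in L, and would have no root. *)
Lemma sep_closed_infinite (s : seq L) : exists x, x \notin s.
Proof.
apply: NNPP => N; have all_s x : x \in undup s.
  rewrite mem_undup; apply/negPn/negP => h; by apply: N; exists x.
pose q := size (undup s).
have q0 : q%:R = 0 :> L.
  have e : \sum_(a <- undup s) (a + 1) = \sum_(a <- undup s) a.
    rewrite -(big_map (fun a => a + 1) predT id); apply: perm_big.
    apply: uniq_perm; rewrite ?undup_uniq ?map_inj_uniq ?undup_uniq //; first exact: addIr.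
    by move=> x; rewrite all_s; apply/mapP; exists (x - 1); rewrite ?subrK.
  move/eqP: e; rewrite big_split /= addrC -subr_eq0 addrK.
  by rewrite big_const_seq count_predT iter_addr_0 => /eqP.
pose W : {poly L} := \prod_(a <- undup s) ('X - a%:P).
pose P := 1 + 'X * W ^+ q.
have q0' : (0 < q)%N by rewrite /q; move: (all_s 0); case: (undup s).
have P1 a : P.[a] = 1.
  have W0 : W.[a] = 0 by apply/rootP; rewrite root_prod_XsubC.
  by rewrite /P !hornerE /= W0 expr0n eqn0Ngt q0' mulr0 addr0.
have dP : P^`() = W ^+ q.
  rewrite /P derivD derivM derivX derivC add0r mul1r deriv_exp -[_ *+ q]mulr_natr.
  by rewrite -[q%:R]polyC_natr q0 mulr0 mulr0 addr0.
have sP : separable_poly P.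
  by rewrite separable_poly.unlock dP /P addrC coprimep_sym coprimep_addl_mul coprimep1.
have [_ /(_ P sP)[]] := sc; last by move=> a /rootP; rewrite P1 => /eqP; rewrite oner_eq0.
have W0 : W ^+ q != 0 by rewrite expf_neq0 // -size_poly_gt0 size_prod_XsubC.
have sz : size ('X * W ^+ q) = (size (W ^+ q)).+1 by rewrite mulrC size_mulX.
by rewrite /P addrC size_polyDl sz ?size_poly1 ltnS size_poly_gt0.
Qed.

(** The polynomial of least degree over [K] that vanishes at [x] divides the separable polynomial
    [q] coming from [F], so its image under [f] is separable and has a root [y] in [L]. It divides
    every other polynomial over [K] that vanishes at [x]. *)
Lemma extend_root (K : fieldType) (j : {rmorphism F -> K}) (v f : {rmorphism K -> L}) :
  (forall c, v (j c) = iota c) -> (forall c, f (j c) = iota c) ->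
  forall x, exists y, forall p, root (map_poly v p) x -> root (map_poly f p) y.
Proof.
move=> vj fj x; have [alg root_ex] := sc; have [q sq qx] := alg x.
pose P k := boolp.asbool (exists p : {poly K}, [/\ p != 0, size p = k & root (map_poly v p) x]).
have q0 : q != 0 by apply: separable_poly_neq0.
have jq : map_poly v (map_poly j q) = map_poly iota q.
  by rewrite -map_poly_comp; apply: eq_map_poly => c; apply: vj.
have fq : map_poly f (map_poly j q) = map_poly iota q.
  by rewrite -map_poly_comp; apply: eq_map_poly => c; apply: fj.
have exP : exists k, P k.
  by exists (size (map_poly j q)); apply/boolp.asboolP; exists (map_poly j q); rewrite map_poly_eq0 jq.
case: (ex_minnP exP) => k /boolp.asboolP[p [p0 sp px]] kmin.
have pdvd p' : root (map_poly v p') x -> p %| p'.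
  move=> p'x; apply/negPn/negP => nd.
  have r0 : p' %% p != 0 by rewrite -/(p %| p') in nd.
  have : (k <= size (p' %% p)%R)%N.
    apply: kmin; apply/boolp.asboolP; exists (p' %% p); split=> //.
    apply/rootP; have := congr1 (fun q => (map_poly v q).[x]) (divp_eq p' p).
    rewrite /= rmorphD rmorphM hornerD hornerM (rootP px) (rootP p'x) mulr0 add0r.
    by move=> <-.
  by rewrite leqNgt -sp ltn_modp p0.
have sf : separable_poly (map_poly f p).
  apply: dvdp_separable (_ : separable_poly (map_poly iota q)).
    by rewrite -fq dvdp_map; apply: pdvd; rewrite jq.
  by rewrite separable_map.
have s1 : (1 < size (map_poly f p))%N.
  rewrite size_map_poly ltnNge; apply/negP => /size1_polyC e.
  move: px p0; rewrite e map_polyC rootC fmorph_eq0 => /eqP ->.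
  by rewrite polyC0 eqxx.
have [y ry] := root_ex _ sf s1; exists y => p' /pdvd h.
by apply: root_dvdp ry; rewrite dvdp_map.
Qed.

Section Subfield.
Variable K : {pred L}.
Hypothesis K_closed : divring_closed K.
HB.instance Definition _ := GRing.isDivringClosed.Build L K K_closed.

Let Ksub := {x | x \in K}.
HB.instance Definition _ := SubType.on Ksub.
HB.instance Definition _ := Choice.on Ksub.
HB.instance Definition _ := [SubChoice_isSubIntegralDomain of Ksub by <:].
HB.instance Definition _ := [SubIntegralDomain_isSubField of Ksub by <:].

Variable f : L -> L.
Hypothesis iotaK : forall c, iota c \in K.
Hypothesis fB : {in K &, {morph f : x y / x - y}}.
Hypothesis fM : {in K &, {morph f : x y / x * y}}.
Hypothesis f_iota : forall c, f (iota c) = iota c.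

Lemma extend_root_subfield x : exists y, forall p, p \is a polyOver K ->
  root p x -> root (map_poly f p) y.
Proof.
pose g (k : Ksub) : L := f (val k).
have f1 : f 1 = 1 by rewrite -(rmorph1 iota) f_iota.
have gB : {morph g : a b / a - b} by move=> a b; rewrite /g /= fB // ?(valP a) ?(valP b).
have gM : {morph g : a b / a * b} by move=> a b; rewrite /g /= fM // ?(valP a) ?(valP b).
have g1 : g 1 = 1 by rewrite /g /= f1.
pose gA := GRing.isZmodMorphism.Build Ksub L g gB.
pose gMm := GRing.isMonoidMorphism.Build Ksub L g (conj g1 gM).
pose G : {rmorphism Ksub -> L} := HB.pack g gA gMm.
pose h (c : F) : Ksub := exist _ (iota c) (iotaK c).
have hB : {morph h : a b / a - b} by move=> a b; apply: val_inj; rewrite /= rmorphB.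
have hM : {morph h : a b / a * b} by move=> a b; apply: val_inj; rewrite /= rmorphM.
have h1 : h 1 = 1 by apply: val_inj; rewrite /= rmorph1.
pose hA := GRing.isZmodMorphism.Build F Ksub h hB.
pose hMm := GRing.isMonoidMorphism.Build F Ksub h (conj h1 hM).
pose H : {rmorphism F -> Ksub} := HB.pack h hA hMm.
have [y hy] := @extend_root Ksub H (val : {rmorphism Ksub -> L}) G (fun=> erefl) f_iota x.
exists y => p /polyOverP pK px.
pose p' : {poly Ksub} := \poly_(i < size p) (exist (fun z => z \in K) p`_i (pK i) : Ksub).
have e : map_poly (val : {rmorphism Ksub -> L}) p' = p.
  apply/polyP => i; rewrite coef_map coef_poly /=; case: ltnP => // hi.
  by rewrite nth_default.
have f0 : f 0 = 0 by have := f_iota 0; rewrite rmorph0.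
suff -> : map_poly f p = map_poly G p' by apply: hy; rewrite e.
by apply/polyP => i; rewrite [RHS]coef_map coef_map_id0 // -e coef_map.
Qed.

End Subfield.

(* A partial F-embedding of L in itself, as its graph. *)
Record partial_hom := PartialHom {
  graph : L -> L -> Prop;
  graph_iota : forall c, graph (iota c) (iota c);
  graphB : forall x y x' y', graph x y -> graph x' y' -> graph (x - x') (y - y');
  graphM : forall x y x' y', graph x y -> graph x' y' -> graph (x * x') (y * y');
  graph0 : forall y, graph 0 y -> y = 0
}.

Lemma graph_fun G x y y' : graph G x y -> graph G x y' -> y = y'.
Proof.
by move=> h h'; apply/eqP; rewrite -subr_eq0; apply/eqP/(graph0 (p := G)); rewrite -(subrr x); apply: graphB.
Qed.

Lemma graph00 G : graph G 0 0.
Proof. by have := graph_iota G 0; rewrite rmorph0. Qed.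

Lemma graphD G x y x' y' : graph G x y -> graph G x' y' -> graph G (x + x') (y + y').
Proof.
move=> h h'; rewrite -[x']opprK -[y']opprK; apply: graphB => //.
by rewrite -[- x']sub0r -[- y']sub0r; apply: graphB => //; apply: graph00.
Qed.

Lemma graph_poly G x y (p : {poly F}) : graph G x y ->
  graph G (map_poly iota p).[x] (map_poly iota p).[y].
Proof.
move=> h; elim/poly_ind: p => [|p c ih]; first by rewrite rmorph0 !horner0; apply: graph00.
rewrite rmorphD rmorphM /= map_polyX map_polyC !hornerE.
by apply: graphD; [apply: graphM | apply: graph_iota].
Qed.

(** The domain of the graph is a ring; it is a field because a nonzero [x] is algebraic. A relation
    p1(x) x + c = 0 over [F] with c nonzero makes the inverse of [x] a polynomial in [x], and [y]
    satisfies the same relation. *)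
Lemma graphV G x y : graph G x y -> graph G x^-1 y^-1.
Proof.
move=> h; have [x0|x0] := eqVneq x 0.
  by move: h; rewrite x0 => /graph0 ->; rewrite invr0; apply: graph00.
have [[alg _] [q sq qx]] := (sc, sc.1 x).
pose P k := boolp.asbool (exists p : {poly F}, [/\ p != 0, size p = k & root (map_poly iota p) x]).
have exP : exists k, P k.
  by exists (size q); apply/boolp.asboolP; exists q; rewrite separable_poly_neq0.
case: (ex_minnP exP) => k /boolp.asboolP[p [p0 sp px]] kmin.
have [p1 [c ep]] : exists p1 c, p = p1 * 'X + c%:P.
  by elim/poly_ind: (p) => [|p1 c _]; [exists 0, 0; rewrite mul0r addr0 | exists p1, c].
have E z : (map_poly iota p).[z] = (map_poly iota p1).[z] * z + iota c.
  by rewrite ep rmorphD rmorphM /= map_polyX map_polyC !hornerE.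
have c0 : c != 0.
  apply: contraTneq isT => c0; have p10 : p1 != 0.
    by apply: contraNneq p0 => p10; rewrite ep p10 c0 mul0r addr0.
  have : P (size p1).
    apply/boolp.asboolP; exists p1; split=> //; apply/rootP/eqP.
    by have /rootP := px; rewrite E c0 rmorph0 addr0 => /eqP; rewrite mulf_eq0 (negPf x0) orbF.
  by move/kmin; rewrite -sp ep c0 addr0 size_mulX // ltnn.
have inv z : root (map_poly iota p) z -> z^-1 = - (map_poly iota p1).[z] * (iota c)^-1.
  move=> /rootP; rewrite E => /eqP; rewrite addr_eq0 => /eqP e.
  have z0 : z != 0.
    apply: contraNneq c0 => z0; rewrite -(fmorph_eq0 iota) -oppr_eq0 -e z0 mulr0 //.
  by apply: (mulfI z0); rewrite mulfV // mulrA mulrN [z * _]mulrC e opprK mulfV // fmorph_eq0.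
have py : root (map_poly iota p) y.
  by apply/rootP; apply: (graph0 (p := G)); rewrite -(rootP px); apply: graph_poly.
rewrite (inv x px) (inv y py); apply: graphM; last first.
  by rewrite -fmorphV; apply: graph_iota.
by rewrite -[- _]sub0r -[X in graph G _ X]sub0r; apply: graphB; [apply: graph00 | apply: graph_poly].
Qed.

Definition poly_pair G (p1 p2 : {poly L}) := forall i, graph G p1`_i p2`_i.

Lemma graph_sum G (I : Type) (r : seq I) (a b : I -> L) :
  (forall i, graph G (a i) (b i)) -> graph G (\sum_(i <- r) a i) (\sum_(i <- r) b i).
Proof.
move=> h; elim: r => [|i r ih]; first by rewrite !big_nil; apply: graph00.
by rewrite !big_cons; apply: graphD.
Qed.

(** The new graph consists of the values at [x] and [y] of pairs of polynomials with corresponding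
    coefficients; the hypothesis is what makes it single-valued. *)
Lemma adjoin G x y : (forall p1 p2, poly_pair G p1 p2 -> p1.[x] = 0 -> p2.[y] = 0) ->
  exists2 G', forall a b, graph G a b -> graph G' a b & graph G' x y.
Proof.
move=> h; pose gr a b := exists p1 p2, [/\ poly_pair G p1 p2, p1.[x] = a & p2.[y] = b].
have cst a b : graph G a b -> gr a b.
  move=> hab; exists a%:P, b%:P; rewrite !hornerC; split=> // i; rewrite !coefC.
  by case: eqP => _ //; apply: graph00.
have gB a b a' b' : gr a b -> gr a' b' -> gr (a - a') (b - b').
  move=> [p1 [p2 [hp <- <-]]] [q1 [q2 [hq <- <-]]]; exists (p1 - q1), (p2 - q2).
  by rewrite !hornerE; split=> // i; rewrite !coefB; apply: graphB.
have gM a b a' b' : gr a b -> gr a' b' -> gr (a * a') (b * b').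
  move=> [p1 [p2 [hp <- <-]]] [q1 [q2 [hq <- <-]]]; exists (p1 * q1), (p2 * q2).
  rewrite !hornerE; split=> // i; rewrite !coefM; apply: graph_sum => k.
  exact: graphM.
have g0 b : gr 0 b -> b = 0 by move=> [p1 [p2 [hp e <-]]]; apply: h hp e.
exists (PartialHom (fun c => cst _ _ (graph_iota G c)) gB gM g0) => //=.
exists 'X, 'X; rewrite !hornerX; split=> // i; rewrite !coefX.
by case: eqP => _; [have := graph_iota G 1; rewrite rmorph1 | exact: graph00].
Qed.

Lemma adjoin_any G x : exists y G', (forall a b, graph G a b -> graph G' a b) /\ graph G' x y.
Proof.
pose K : {pred L} := [pred a | boolp.asbool (exists b, graph G a b)].
have KP a : reflect (exists b, graph G a b) (a \in K) by rewrite inE; apply: boolp.asboolP.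
pose f a := epsilon (inhabits 0) (graph G a).
have fP a : a \in K -> graph G a (f a) by move/KP => h; apply: epsilon_spec.
have Kc : divring_closed K.
  split; first by apply/KP; exists 1; have := graph_iota G 1; rewrite rmorph1.
    by move=> a b /KP[a' ha] /KP[b' hb]; apply/KP; exists (a' - b'); apply: graphB.
  by move=> a b /KP[a' ha] /KP[b' hb]; apply/KP; exists (a' / b'); apply: graphM => //; apply: graphV.
have iK c : iota c \in K by apply/KP; exists (iota c); apply: graph_iota.
have fB : {in K &, {morph f : a b / a - b}}.
  move=> a b Ka Kb; apply: (@graph_fun G (a - b)); last by apply: graphB; apply: fP.
  by apply/fP/KP; exists (f a - f b); apply: graphB; apply: fP.
have fM : {in K &, {morph f : a b / a * b}}.
  move=> a b Ka Kb; apply: (@graph_fun G (a * b)); last by apply: graphM; apply: fP.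
  by apply/fP/KP; exists (f a * f b); apply: graphM; apply: fP.
have fi c : f (iota c) = iota c.
  by apply: (@graph_fun G (iota c)); [apply: fP | apply: graph_iota].
have [y hy] := extend_root_subfield Kc iK fB fM fi x.
exists y; have [|G' sub gx] := @adjoin G x y; last by exists G'.
move=> p1 p2 hp p1x.
have p1K : p1 \is a polyOver K by apply/polyOverP => i; apply/KP; exists p2`_i.
have -> : p2 = map_poly f p1.
  apply/polyP => i; rewrite coef_map_id0; last by have := fi 0; rewrite rmorph0.
  by apply: (@graph_fun G p1`_i) => //; apply/fP/KP; exists p2`_i.
by apply/rootP/hy => //; apply/rootP.
Qed.

Lemma total_absGal G : (forall x, exists y, graph G x y) ->
  exists s : absGal iota, forall x, graph G x (s x).
Proof.
move=> tot; pose f a := epsilon (inhabits 0) (graph G a).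
have fP a : graph G a (f a) by apply: epsilon_spec; apply: tot.
have fB : {morph f : a b / a - b}.
  by move=> a b; apply: (@graph_fun G (a - b)) => //; apply: graphB.
have fM : {morph f : a b / a * b}.
  by move=> a b; apply: (@graph_fun G (a * b)) => //; apply: graphM.
have fi c : f (iota c) = iota c.
  by apply: (@graph_fun G (iota c)) => //; apply: graph_iota.
have f1 : f 1 = 1 by rewrite -(rmorph1 iota) fi.
pose fA := GRing.isZmodMorphism.Build L L f fB.
pose fMm := GRing.isMonoidMorphism.Build L L f (conj f1 fM).
pose s : {rmorphism L -> L} := HB.pack f fA fMm.
by exists (@AbsGal _ _ iota s fi).
Qed.

(** Zorn's lemma on the extensions of [G0]: a maximal one is total by [adjoin_any]. *)
Lemma extend_partial_hom G0 : exists s : absGal iota, forall a b, graph G0 a b -> s a = b.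
Proof.
pose T := {G : partial_hom | forall a b, graph G0 a b -> graph G a b}.
pose R (G G' : T) : bool := boolp.asbool (forall a b, graph (sval G) a b -> graph (sval G') a b).
have RP G G' : reflect (forall a b, graph (sval G) a b -> graph (sval G') a b) (R G G').
  exact: boolp.asboolP.
pose t0 : T := exist _ G0 (fun a b h => h).
have [||A totA|G Gmax] := @classical_sets.ZL_preorder T t0 R.
- by move=> G; apply/RP.
- by move=> G1 G2 G3 /RP h1 /RP h2; apply/RP => a b /h1 /h2.
- case: (classic (exists G, A G)) => [[G1 AG1]|none]; last first.
    by exists t0 => s As; case: none; exists s.
  pose gr a b := exists2 G, A G & graph (sval G) a b.
  have two a b a' b' : gr a b -> gr a' b' ->
      exists G, [/\ A G, graph (sval G) a b & graph (sval G) a' b'].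
    move=> [G AG h] [G' AG' h']; case: (totA G G' AG AG') => /RP sub.
      by exists G'; split=> //; apply: sub.
    by exists G; split=> //; apply: sub.
  have gi c : gr (iota c) (iota c) by exists G1 => //; apply: graph_iota.
  have gB a b a' b' : gr a b -> gr a' b' -> gr (a - a') (b - b').
    by move=> h h'; have [G [AG g g']] := two _ _ _ _ h h'; exists G => //; apply: graphB.
  have gM a b a' b' : gr a b -> gr a' b' -> gr (a * a') (b * b').
    by move=> h h'; have [G [AG g g']] := two _ _ _ _ h h'; exists G => //; apply: graphM.
  have g0 b : gr 0 b -> b = 0 by case=> G _ /graph0.
  have sub a b : graph G0 a b -> graph (PartialHom gi gB gM g0) a b.
    by move=> h; exists G1 => //; apply: (svalP G1).
  by exists (exist _ _ sub) => G AG; apply/RP => a b h; exists G.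
have tot x : exists y, graph (sval G) x y.
  have [y [G' [sub gx]]] := adjoin_any (sval G) x.
  have sub0 a b : graph G0 a b -> graph G' a b by move=> h; apply/sub/(svalP G).
  have /RP le : R (exist _ G' sub0) G by apply: Gmax; apply/RP.
  by exists y; apply: le.
have [s hs] := total_absGal tot; exists s => a b h.
by apply: (@graph_fun (sval G) a) => //; apply: (svalP G).
Qed.

(** If [a] is not in [F], its minimal polynomial is separable of degree at least 2, so it has
    another root [b]. The embedding of F(a) that sends [a] to [b] extends to an element of the
    Galois group moving [a]. *)
Lemma fixed_field a : (forall s : absGal iota, s a = a) -> exists c, a = iota c.
Proof.
move=> fixa; apply: NNPP => N; have [alg root_ex] := sc; have [q sq qa] := alg a.
pose P k := boolp.asbool (exists p : {poly F}, [/\ p != 0, size p = k & root (map_poly iota p) a]).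
have exP : exists k, P k.
  by exists (size q); apply/boolp.asboolP; exists q; rewrite separable_poly_neq0.
case: (ex_minnP exP) => k /boolp.asboolP[p [p0 sp pa]] kmin.
have pdvd p' : root (map_poly iota p') a -> p %| p'.
  move=> p'a; apply/negPn/negP => nd.
  have : (k <= size (p' %% p)%R)%N.
    apply: kmin; apply/boolp.asboolP; exists (p' %% p); split=> //.
    apply/rootP; have := congr1 (fun q => (map_poly iota q).[a]) (divp_eq p' p).
    rewrite /= rmorphD rmorphM hornerD hornerM (rootP pa) (rootP p'a) mulr0 add0r.
    by move=> <-.
  by rewrite leqNgt -sp ltn_modp p0.
have sepp : separable_poly (map_poly iota p).
  by rewrite separable_map; apply: dvdp_separable sq; apply: pdvd.
have /factor_theorem[p1 ep] := pa.
have p10 : p1 != 0.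
  by apply: contraNneq p0 => p10; rewrite -(map_poly_eq0 iota) ep p10 mul0r.
have s1 : (1 < size p1)%N.
  have sz : size p = (size p1).+1.
    by rewrite -(size_map_poly iota) ep size_Mmonic ?monicXsubC // size_XsubC addn2.
  rewrite ltnNge; apply/negP => h.
  have sp2 : size p = 2%N by apply/eqP; rewrite sz eqn_leq !ltnS h size_poly_gt0.
  have := pa; rewrite /root horner_coef size_map_poly sp2 !big_ord_recl big_ord0 /= !coef_map /=.
  rewrite expr0 mulr1 addr0 expr1 addr_eq0 => /eqP e.
  have c0 : p`_1 != 0 by have := p0; rewrite -lead_coef_eq0 /lead_coef sp2.
  apply: N; exists (- p`_0 / p`_1); rewrite fmorph_div rmorphN e opprK mulrC.
  by rewrite mulKf // fmorph_eq0.
have sep1 : separable_poly p1 by apply: dvdp_separable sepp; rewrite ep dvdp_mulr.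
have [b pb] := root_ex _ sep1 s1.
have ab : a != b.
  apply: contraTneq sepp => eab; rewrite ep separable_root negb_and negbK; apply/orP; right.
  by rewrite eab.
have gB (x y x' y' : L) : (exists c, x = iota c /\ y = iota c) -> (exists c, x' = iota c /\ y' = iota c) ->
    exists c, x - x' = iota c /\ y - y' = iota c.
  by move=> [c [-> ->]] [c' [-> ->]]; exists (c - c'); rewrite rmorphB.
have gM (x y x' y' : L) : (exists c, x = iota c /\ y = iota c) -> (exists c, x' = iota c /\ y' = iota c) ->
    exists c, x * x' = iota c /\ y * y' = iota c.
  by move=> [c [-> ->]] [c' [-> ->]]; exists (c * c'); rewrite rmorphM.
have g0 y : (exists c, 0 = iota c /\ y = iota c) -> y = 0 by move=> [c [-> ->]].
pose G0 := @PartialHom (fun x y => exists c, x = iota c /\ y = iota c)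
  (fun c => ex_intro _ c (conj erefl erefl)) gB gM g0.
have [|G1 _ gab] := @adjoin G0 a b.
  move=> q1 q2 hq q1a.
  have [c hc] : exists c : nat -> F, forall i, q1`_i = iota (c i) /\ q2`_i = iota (c i).
    exists (fun i => epsilon (inhabits 0) (fun c => q1`_i = iota c /\ q2`_i = iota c)) => i.
    exact: (epsilon_spec (inhabits 0) _ (hq i)).
  pose q' : {poly F} := \poly_(i < maxn (size q1) (size q2)) c i.
  have e1 : map_poly iota q' = q1.
    apply/polyP => i; rewrite coef_map coef_poly /=; case: ltnP => h; first by case: (hc i).
    by rewrite rmorph0 nth_default //; move: h; rewrite geq_max => /andP[].
  have e2 : map_poly iota q' = q2.
    apply/polyP => i; rewrite coef_map coef_poly /=; case: ltnP => h; first by case: (hc i).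
    by rewrite rmorph0 nth_default //; move: h; rewrite geq_max => /andP[].
  have : p %| q' by apply: pdvd; rewrite e1; apply/rootP.
  rewrite -(dvdp_map iota) e2 => /dvdpP[r ->].
  by rewrite hornerM ep hornerM (rootP pb) mul0r mulr0.
have [s hs] := extend_partial_hom G1.
by move: ab; rewrite -{1}(fixa s) (hs _ _ gab) eqxx.
Qed.

Lemma absGal_root (p : {poly F}) a (s : absGal iota) :
  root (map_poly iota p) a -> root (map_poly iota p) (s a).
Proof.
move=> pa; have -> : map_poly iota p = map_poly s (map_poly iota p).
  by rewrite -map_poly_comp; apply: eq_map_poly => c; rewrite /= absGal_fix.
by rewrite /root horner_map fmorph_eq0.
Qed.

Lemma conjugates_finite a : exists e : seq L, forall s : absGal iota, s a \in e.
Proof.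
have [q sq qa] := sc.1 a.
have q0 : map_poly iota q != 0 by rewrite map_poly_eq0 separable_poly_neq0.
apply: NNPP => N.
have [e ue [re sz]] : exists2 e : seq L, uniq e & all (root (map_poly iota q)) e /\ size e = size (map_poly iota q).
  elim: (size _) => [|k [e ue [re sz]]]; first by exists [::].
  have [s hs] : exists s : absGal iota, s a \notin e.
    apply: NNPP => N'; apply: N; exists e => s; apply/negPn/negP => h; by apply: N'; exists s.
  exists (s a :: e); rewrite /= ?hs ?ue // sz; split=> //.
  by rewrite re andbT; apply: absGal_root.
by have := max_poly_roots q0 re ue; rewrite sz ltnn.
Qed.

Lemma stable_finite (e : seq L) : exists2 S : seq L, {subset e <= S} &
  uniq S /\ forall (s : absGal iota) x, x \in S -> s x \in S.
Proof.
pose id_gal : absGal iota := @AbsGal _ _ iota idfun (fun=> erefl).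
have [S sub st] : exists2 S : seq L, {subset e <= S} &
    forall (s : absGal iota) x, x \in S -> s x \in S.
  elim: e => [|a e [S sub st]]; first by exists [::].
  have [r hr] := conjugates_finite a.
  pose r' := [seq x <- r | boolp.asbool (exists s : absGal iota, s a = x)].
  exists (r' ++ S) => [x|s x].
    rewrite inE mem_cat => /orP[/eqP ->|/sub ->]; last by rewrite orbT.
    rewrite mem_filter (hr id_gal) andbT; apply/orP; left.
    by apply/boolp.asboolP; exists id_gal.
  rewrite !mem_cat => /orP[|/(st s) ->]; last by rewrite orbT.
  rewrite !mem_filter => /andP[/boolp.asboolP[t <-] _]; apply/orP; left.
  have /= h := hr (absGal_comp s t); rewrite h andbT.
  by apply/boolp.asboolP; exists (absGal_comp s t).
exists (undup S) => [x /sub|]; first by rewrite mem_undup.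
by split=> [|s x]; rewrite ?undup_uniq // !mem_undup; apply: st.
Qed.

Lemma absGal_surj (s : absGal iota) x : exists y, s y = x.
Proof.
have [S sub [uS st]] := stable_finite [:: x].
have u : uniq [seq s y | y <- S] by rewrite map_inj_uniq //; apply: fmorph_inj.
have subS : {subset [seq s y | y <- S] <= S} by move=> z /mapP[y yS ->]; apply: st.
have [|_ e] := uniq_min_size u subS; first by rewrite size_map.
have : x \in [seq s y | y <- S] by rewrite e sub ?inE.
by case/mapP => y _ ->; exists y.
Qed.

Definition absGal1 : absGal iota := @AbsGal _ _ iota idfun (fun=> erefl).

Fixpoint absGalX (s : absGal iota) k : absGal iota :=
  if k is k'.+1 then absGal_comp s (absGalX s k') else absGal1.

Lemma absGalXE s k x : absGalX s k x = iter k s x.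
Proof. by elim: k => //= k <-. Qed.

(* Some power of s is the identity on a given finite stable set. *)
Lemma absGal_inverse_on (S : seq L) (s : absGal iota) :
  (forall x, x \in S -> s x \in S) -> exists t : absGal iota, forall x, x \in S -> t (s x) = x.
Proof.
move=> st; pose T := seq_sub S.
pose f (x : T) : T := SeqSub (st _ (ssvalP x)).
have finj : injective f by move=> x y /(congr1 (@ssval L S)) /= /fmorph_inj /val_inj.
pose N := (\prod_(x : T) fingraph.order f x)%N.
have N0 : (0 < N)%N by apply: prodn_gt0 => x; apply: fingraph.order_gt0.
have it (x : T) : iter N f x = x.
  rewrite /N (bigD1 x) //= mulnC; elim: (\prod_(_ | _) _)%N => //= k ih.
  by rewrite mulSn iterD ih iter_order.
exists (absGalX s N.-1) => x xS; rewrite absGalXE -iterSr prednK //.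
have E k : ssval (iter k f (SeqSub xS)) = iter k s x by elim: k => //= k ->.
by rewrite -E it.
Qed.

End SeparableClosure.

(** * Finite Galois quotients, independence of characters and Hilbert 90 *)

Section GaloisDescent.
Variables (F L : fieldType) (iota : {rmorphism F -> L}).
Hypothesis sc : separable_closure iota.
Local Notation Gal := (absGal iota).

Definition agree (S : seq L) (s t : Gal) := forall x, x \in S -> s x = t x.
(** By Galois theory this is membership in the field generated by [S] over [F]. The formulation by
    restrictions is what sums over representatives require. *)
Definition determined (S : seq L) (e : L) := forall s t : Gal, agree S s t -> s e = t e.

Lemma determined1 S : determined S 1.
Proof. by move=> s t _; rewrite !rmorph1. Qed.

Lemma determined_mem S x : x \in S -> determined S x.
Proof. by move=> xS s t; apply. Qed.

Lemma determinedM S x y : determined S x -> determined S y -> determined S (x * y).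
Proof. by move=> hx hy s t h; rewrite !rmorphM (hx s t) // (hy s t). Qed.

Variables (S : seq L).
Hypothesis stS : forall (s : Gal) x, x \in S -> s x \in S.

(** Restriction to a finite stable set has finitely many values; they play the role of a finite
    Galois quotient. *)
Lemma representatives : exists N (t : 'I_N -> Gal), (forall s, exists k, agree S s (t k)) /\
  forall k l, k != l -> exists2 x, x \in S & t k x != t l x.
Proof.
pose T := seq_sub S.
pose res (s : Gal) : {ffun T -> T} := [ffun x : T => SeqSub (stS s (ssvalP x))].
have resP s t : agree S s t <-> res s = res t.
  split=> [h|h x xS]; first by apply/ffunP => x; rewrite !ffunE; apply/val_inj/h/ssvalP.
  by have /ffunP/(_ (SeqSub xS)) := h; rewrite !ffunE => /(congr1 (@ssval L S)).
pose A := [set phi | boolp.asbool (exists s, res s = phi)].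
have /fin_all_exists[t ht] : forall k : 'I_#|A|, exists s, res s = enum_val k.
  by move=> k; have := enum_valP k; rewrite inE => /boolp.asboolP.
exists #|A|, t; split=> [s|k l kl].
  have sA : res s \in A by rewrite inE; apply/boolp.asboolP; exists s.
  by exists (enum_rank_in sA (res s)); apply/resP; rewrite ht enum_rankK_in.
apply: NNPP => N; move/eqP: kl; apply; apply: enum_val_inj; rewrite -!ht; apply/resP => x xS.
by apply/eqP/negPn/negP => h; apply: N; exists x.
Qed.

Variables (N : nat) (t : 'I_N -> Gal).
Hypothesis t_cover : forall s, exists k, agree S s (t k).
Hypothesis t_sep : forall k l, k != l -> exists2 x, x \in S & t k x != t l x.

(* Dedekind's independence of characters *)
Lemma galois_independent (c : 'I_N -> L) :
  (forall e, determined S e -> \sum_k c k * t k e = 0) -> forall k, c k = 0.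
Proof.
move: {2}(#|[pred k | c k != 0]|) (leqnn #|[pred k | c k != 0]|) => m.
elim: m c => [|m ih] c hm h k0.
  apply/eqP/negPn/negP => ck; move: hm; rewrite leqn0 => /eqP/card0_eq/(_ k0).
  by rewrite inE ck.
apply/eqP/negPn/negP => ck0.
have other l : l != k0 -> c l = 0.
  move=> lk; have [x xS hx] := t_sep lk.
  pose c' k := c k * (t k x - t k0 x).
  suff /eqP : c' l = 0 by rewrite mulf_eq0 subr_eq0 (negPf hx) orbF => /eqP.
  apply: ih => [|e he].
    rewrite -ltnS; apply: leq_trans hm; apply: proper_card; apply/properP; split.
      by apply/subsetP => k; rewrite !inE mulf_eq0 negb_or => /andP[].
    by exists k0; rewrite !inE ?ck0 // mulf_eq0 subrr eqxx orbT.
  have e1 := h _ (determinedM (determined_mem xS) he).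
  transitivity (\sum_k c k * t k (x * e) - t k0 x * \sum_k c k * t k e).
    by rewrite mulr_sumr -sumrB; apply: eq_bigr => k _; rewrite rmorphM /c'; ring.
  by rewrite e1 h // mulr0 subrr.
have := h 1 (@determined1 S); rewrite (bigD1 k0) //= big1 ?addr0 => [|l lk].
  by rewrite rmorph1 mulr1 => /eqP; rewrite (negPf ck0).
by rewrite other // mul0r.
Qed.

Lemma galois_independent_ex (c : 'I_N -> L) k0 : c k0 != 0 ->
  exists2 e, determined S e & \sum_k c k * t k e != 0.
Proof.
move=> ck; apply: NNPP => H; move/eqP: ck; apply; apply: galois_independent => e he.
by apply/eqP/negPn/negP => h; apply: H; exists e.
Qed.

Lemma translation (s : Gal) : exists2 p : 'I_N -> 'I_N, injective p &
  forall k, agree S (absGal_comp s (t k)) (t (p k)).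
Proof.
have /fin_all_exists[p hp] : forall k, exists l, agree S (absGal_comp s (t k)) (t l).
  by move=> k; apply: t_cover.
exists p => // k l e; apply/eqP/negPn/negP => /t_sep[x xS]; move/eqP; apply.
by apply: (fmorph_inj s); have /= := hp k x xS; rewrite e -(hp l x xS).
Qed.

Lemma identity_index : exists k, forall x, x \in S -> t k x = x.
Proof. by have [k hk] := t_cover (absGal1 iota); exists k => x xS; rewrite -hk. Qed.

(* Hilbert 90 for a permutation action *)
Section Speiser.
Variables (q : nat) (act : Gal -> 'I_q -> 'I_q).
Hypothesis act_comp : forall s s' i, act (absGal_comp s s') i = act s (act s' i).
Hypothesis act_inj : forall s, injective (act s).
Hypothesis act_S : forall s s', agree S s s' -> act s =1 act s'.

Definition invariant_vec (b : 'I_q -> L) := forall (s : Gal) i, s (b i) = b (act s i).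

(** The trace of [e] times the basis vector at [i0] is an invariant vector. Its pairing with [w] is
    a combination of characters applied to [e], with nonzero coefficient [w 0 i0] at the identity,
    so it is nonzero for some [e]. *)
Lemma invariant_detects (w : 'rV[L]_q) : w != 0 ->
  exists2 b, invariant_vec b & \sum_i w 0 i * b i != 0.
Proof.
case/rV0Pn => i0 wi0; have [k0 hk0] := identity_index.
have a0 : act (t k0) i0 = i0.
  apply: (@act_inj (t k0)); rewrite -act_comp; apply: act_S => x xS /=.
  by rewrite !hk0.
have [|e he ne] := @galois_independent_ex (fun k => w 0 (act (t k) i0)) k0; first by rewrite a0.
exists (fun i => \sum_k t k e * (act (t k) i0 == i)%:R).
  move=> s i; have [p pinj hp] := translation s.
  rewrite rmorph_sum [RHS](reindex_inj pinj) /=; apply: eq_bigr => k _.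
  rewrite rmorphM rmorph_nat -(he _ _ (hp k)) /=.
  by rewrite -(act_S (hp k)) act_comp (inj_eq (@act_inj s)).
apply: contraNneq ne => e0; apply/eqP; rewrite -[RHS]e0.
under [RHS]eq_bigr do rewrite mulr_sumr.
rewrite exchange_big /=; apply: eq_bigr => k _.
rewrite (bigD1 (act (t k) i0)) //= eqxx mulr1 big1 ?addr0 // => i.
by rewrite eq_sym => /negPf ->; rewrite !mulr0.
Qed.

(** Columns are added one at a time: while there are fewer than [q], a nonzero row [w] kills them
    all, and an invariant vector not killed by [w] is independent of them. *)
Lemma speiser : exists2 B : 'M[L]_q, B \in unitmx & forall j, invariant_vec (fun i => B i j).
Proof.
have step m : (m <= q)%N -> exists B : 'M[L]_(q, m),
    (forall j, invariant_vec (fun i => B i j)) /\ forall c : 'cV_m, B *m c = 0 -> c = 0.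
  elim: m => [_|m ih mq].
    by exists 0; split=> [[]//|c _]; apply/colP => -[].
  have [B [hB iB]] := ih (ltnW mq).
  have nz : kermx B != 0.
    by rewrite -mxrank_eq0 mxrank_ker subn_eq0 -ltnNge; apply: leq_ltn_trans mq; apply: rank_leq_col.
  pose w := nz_row (kermx B); have w0 : w != 0 by rewrite nz_row_eq0.
  have wB : w *m B = 0 by apply/sub_kermxP/nz_row_sub.
  have [b hb nb] := invariant_detects w0.
  have e1 : (m + 1 = m.+1)%N by rewrite addn1.
  pose B' : 'M[L]_(q, m + 1) := row_mx B (\col_i b i).
  have [h1 h2] : (forall j, invariant_vec (fun i => B' i j)) /\ forall c : 'cV_(m + 1), B' *m c = 0 -> c = 0.
    split=> [j s i|c].
      case: (split_ordP j) => k ->; rewrite ?row_mxEl ?row_mxEr; first exact: hB.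
      by rewrite !mxE.
    rewrite -[c]vsubmxK mul_row_col => e.
    have d0 : dsubmx c = 0.
      apply/colP => k; rewrite [RHS]mxE ord1.
      have := congr1 (fun X => (w *m X) 0 0) e; rewrite mulmxDr mulmxA wB mul0mx add0r mulmx0 !mxE.
      have -> : \sum_j w 0 j * ((\col_i b i) *m dsubmx c) j 0 = (\sum_j w 0 j * b j) * dsubmx c 0 0.
        by rewrite big_distrl; apply: eq_bigr => j _; rewrite !mxE big_ord1 !mxE mulrA.
      by move/eqP; rewrite mulf_eq0 (negPf nb) mxE => /eqP.
    by move: e; rewrite d0 mulmx0 addr0 => /iB ->; rewrite col_mx0.
  by rewrite -e1; exists B'.
have [B [hB iB]] := step q (leqnn q); exists B => //.
rewrite -unitmx_tr unitmxE unitfE; apply/negP => /det0P[v v0 hv].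
move/eqP: v0; apply; apply: trmx_inj; rewrite trmx0; apply: iB.
by apply: trmx_inj; rewrite trmx_mul trmxK hv trmx0.
Qed.

End Speiser.
End GaloisDescent.

(** Multiplication by an element permutes the list, so comparing the products of its members shows
    each to be a root of unity of order dividing its size; among that many roots of unity in a field
    one is primitive. *)
Lemma unity_power_list (L : fieldType) (E : seq L) : uniq E -> (forall x, x \in E -> x != 0) ->
  (forall x y, x \in E -> y \in E -> x * y \in E) -> E != [::] ->
  exists2 z, z \in E & forall x, x \in E -> exists k, x = z ^+ k.
Proof.
move=> uE nE mE nil.
have root_E : all (size E).-unity_root E.
  apply/allP => x xE; rewrite unity_rootE; apply/eqP.
  have P0 : \prod_(y <- E) y != 0 by rewrite prodf_seq_neq0; apply/allP => y /nE.
  have e : \prod_(y <- E) (x * y) = \prod_(y <- E) y.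
    rewrite -(big_map (fun y => x * y) predT id); apply: perm_big.
    have u : uniq [seq x * y | y <- E] by rewrite map_inj_uniq //; apply/mulfI/nE.
    have [z /mapP[y yE ->]||_ e] := uniq_min_size u (s2 := E); rewrite ?size_map //; first exact: mE.
    exact: uniq_perm.
  move: e; rewrite big_split /= big_const_seq count_predT iter_mulr_1 => e.
  by apply: (mulIf P0); rewrite mul1r.
have sz : (0 < size E)%N by case: (E) nil.
have /hasP[z zE pz] := has_prim_root sz root_E uE (leqnn _).
exists z => // x xE; have /allP/(_ x xE) := root_E; rewrite unity_rootE => /eqP x1.
by have [k ->] := prim_rootP pz x1; exists k.
Qed.

(** * Nodes permuted by the Galois group through rho *)

Section TwistedFunctions.
Variables (F L : fieldType) (iota : {rmorphism F -> L}).
Hypothesis sc : separable_closure iota.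
Local Notation Gal := (absGal iota).
Variables (n : nat) (rho : Gal -> 'S_n).
Hypothesis rho_hom : galois_hom rho.
Hypothesis rho_cont : galois_continuous rho.
Hypothesis rho_comm : forall s t, (rho s * rho t = rho t * rho s)%g.

Lemma rho_comp (s t : Gal) i : rho (absGal_comp s t) i = rho s (rho t i).
Proof. by rewrite rho_hom rho_comm permM. Qed.

(** Continuity is used at the identity only: if [s] and [s'] agree on the stable set, a group
    element [t] that undoes both of them there carries the comparison to the identity. *)
Lemma rho_determined : exists2 S : seq L, uniq S /\ (forall (s : Gal) x, x \in S -> s x \in S) &
  forall s t : Gal, agree S s t -> rho s = rho t.
Proof.
have [e he] := rho_cont (absGal1 iota).
have [S sub [uS st]] := stable_finite sc e; exists S => // s s' ss.
have [t ht] := absGal_inverse_on (st s).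
have h1 : rho (absGal_comp t s) = rho (absGal1 iota).
  by apply: he => x /sub xS /=; rewrite ht.
have h2 : rho (absGal_comp t s') = rho (absGal1 iota).
  by apply: he => x /sub xS /=; rewrite -ss // ht.
by apply: (mulgI (rho t)); rewrite -!rho_hom h1 h2.
Qed.

Lemma twisted_basis (q : nat) (act : 'S_n -> 'I_q -> 'I_q) :
  (forall s t i, act (rho (absGal_comp s t)) i = act (rho s) (act (rho t) i)) ->
  (forall s, injective (act (rho s))) ->
  exists2 B : 'M[L]_q, B \in unitmx & forall (s : Gal) i j, s (B i j) = B (act (rho s) i) j.
Proof.
move=> hc hi; have [S [uS st] det] := rho_determined.
have [N [t [t_cover t_sep]]] := representatives st.
have [B uB hB] := @speiser _ _ _ S N t t_cover t_sep q (fun s => act (rho s)) hc hi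
  (fun s s' h i => congr1 (fun g => act g i) (det s s' h)).
by exists B => // s i j; apply: (hB j).
Qed.

(** Invariant vectors are the combinations over [F] of the columns of [B], whose rows are distinct.
    Over an infinite [F] a general combination separates the indices. Over a finite [F] the nonzero
    values at [i0] of invariant vectors form a finite group; if the value of [b] generates it, every
    such value is a power of it, and by transitivity two equal entries of [b] would give two equal
    rows of [B]. *)
Lemma twisted_function (P : pred 'I_n) i0 : P i0 -> (forall s i, P (rho s i) = P i) ->
  (forall i, P i -> exists s, rho s i0 = i) ->
  exists y : 'I_n -> L, [/\ forall (s : Gal) i, s (y i) = y (rho s i),
    forall i j, P i -> P j -> y i = y j -> i = j & forall i, ~~ P i -> y i = 0].
Proof.
move=> Pi0 Pst Ptr.
suff [y [hy inj]] : exists y : 'I_n -> L, (forall (s : Gal) i, P i -> s (y i) = y (rho s i)) /\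
    forall i j, P i -> P j -> y i = y j -> i = j.
  exists (fun i => if P i then y i else 0); split=> [s i|i j Pi Pj|i /negPf ->] //.
    by rewrite Pst; case: ifP => [Pi|_]; [apply: hy | apply: rmorph0].
  by rewrite Pi Pj; apply: inj.
have [B uB hB] := @twisted_basis n (fun g i => g i) rho_comp (fun s => @perm_inj _ (rho s)).
have rows i j : i != j -> exists k, B i k != B j k.
  move=> ij; apply: NNPP => H; have e : row i B = row j B.
    apply/rowP => k; rewrite !mxE; apply/eqP/negPn/negP => h; by apply: H; exists k.
  have : (delta_mx 0 i : 'rV_n) *m B = (delta_mx 0 j : 'rV_n) *m B by rewrite -!rowE.
  move/(can_inj (mulmxK uB))/matrixP/(_ 0 i); rewrite !mxE !eqxx /= (negPf ij) => /eqP.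
  by rewrite oner_eq0.
pose vec (c : 'I_n -> F) i := \sum_j B i j * iota (c j).
have vec_eq c (s : Gal) i : s (vec c i) = vec c (rho s i).
  by rewrite rmorph_sum; apply: eq_bigr => j _; rewrite rmorphM hB absGal_fix.
case: (classic (forall s : seq F, exists x, x \notin s)) => [Finf|Ffin].
  (* The coefficients of the combination are the powers of one element z, so that only the roots of
     one polynomial are excluded. *)
  pose b : {poly L} := \prod_i \prod_(j | i != j) \sum_k (B i k - B j k) *: 'X^k.
  have b0 : b != 0.
    apply/prodf_neq0 => i _; apply/prodf_neq0 => j ij; have [k hk] := rows i j ij.
    apply: contraNneq hk => /(congr1 (fun p : {poly L} => p`_k)); rewrite coef0 coef_sum.
    rewrite (bigD1 k) //= big1 => [|l lk]; last first.
      by rewrite coefZ coefXn; case: (k =P l :> nat) lk => [/ord_inj ->|_ _]; rewrite ?eqxx ?mulr0.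
    by rewrite coefZ coefXn eqxx mulr1 addr0 => /eqP; rewrite subr_eq0.
  have [z hz] : exists z, b.[iota z] != 0.
    apply: NNPP => H; have [s us sz] : exists2 s : seq F, uniq s & size s = size b.
      elim: (size b) => [|k [s us <-]]; first by exists [::].
      by have [x xs] := Finf s; exists (x :: s) => //=; rewrite xs.
    have rt : all (root b) (map iota s).
      apply/allP => _ /mapP[z _ ->]; apply/rootP/eqP/negPn/negP => h; by apply: H; exists z.
    have := max_poly_roots b0 rt; rewrite map_inj_uniq ?us; last exact: fmorph_inj.
    by rewrite size_map sz ltnn => /(_ isT).
  exists (vec (fun k => z ^+ k)); split=> [s i _|i j _ _ e]; first exact: vec_eq.
  apply/eqP/negPn/negP => ij; move: hz; rewrite horner_prod => /prodf_neq0/(_ i isT).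
  rewrite horner_prod => /prodf_neq0/(_ j ij)/eqP; apply.
  rewrite horner_sum; transitivity (vec (fun k => z ^+ k) i - vec (fun k => z ^+ k) j).
    rewrite /vec -sumrB; apply: eq_bigr => k _.
    by rewrite hornerZ hornerXn rmorphXn mulrBl.
  by rewrite e subrr.
have [sF hF] : exists sF : seq F, forall x, x \in sF.
  apply: NNPP => H; apply: Ffin => s; apply: NNPP => H'; apply: H; exists s => x.
  by apply/negPn/negP => h; apply: H'; exists x.
have all_vec (b : 'I_n -> L) : (forall (s : Gal) i, s (b i) = b (rho s i)) -> exists c, b = vec c.
  move=> hb; pose c := invmx B *m \col_i b i.
  have Bc : B *m c = \col_i b i by rewrite /c mulKVmx.
  have cfix (s : Gal) j : s (c j 0) = c j 0.
    suff e : map_mx s c = c by have := congr1 (fun X : 'cV_n => X j 0) e; rewrite [LHS]mxE.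
    apply: (can_inj (mulKmx uB)); rewrite Bc; apply/colP => i.
    have [i' ei'] : exists i', i = rho s i' by exists ((rho s)^-1 i)%g; rewrite permKV.
    rewrite !mxE ei' -hb; have := congr1 (fun X : 'cV_n => s (X i' 0)) Bc.
    rewrite !mxE => <-; rewrite rmorph_sum; apply: eq_bigr => j' _.
    by rewrite rmorphM hB !mxE.
  have /fin_all_exists[d hd] : forall j, exists x, c j 0 = iota x.
    by move=> j; apply: (fixed_field sc) => s; apply: cfix.
  exists d; apply: boolp.funext => i; have := congr1 (fun X : 'cV_n => X i 0) Bc.
  rewrite !mxE => <-; apply: eq_bigr => j _; by rewrite hd.
pose ev (c : {ffun 'I_n -> seq_sub sF}) := vec (fun j => ssval (c j)) i0.
pose E := undup [seq x <- [seq ev c | c <- enum {ffun 'I_n -> seq_sub sF}] | x != 0].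
have EP x : reflect (x != 0 /\ exists2 b, (forall (s : Gal) i, s (b i) = b (rho s i)) & x = b i0) (x \in E).
  rewrite mem_undup mem_filter; apply: (iffP andP) => -[x0].
    case/mapP => c _ ex; split=> //; exists (vec (fun j => ssval (c j))) => [s i|]; first exact: vec_eq.
    exact: ex.
  case=> b /all_vec[c ->] e; split=> //; apply/mapP.
  exists [ffun j => SeqSub (hF (c j))]; first by rewrite mem_enum.
  by rewrite e /ev; congr vec; apply: boolp.funext => j; rewrite ffunE.
have [||||z zE hz] := @unity_power_list _ E.
- exact: undup_uniq.
- by move=> x /EP[].
- move=> x y /EP[x0 [b hb ex]] /EP[y0 [d hd ey]]; apply/EP; split; first exact: mulf_neq0.
  by exists (fun i => b i * d i) => [s i|]; rewrite ?rmorphM ?hb ?hd ?ex ?ey.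
- apply/negP => /eqP E0; have : (1 : L) \in E.
    by apply/EP; rewrite oner_neq0; split=> //; exists (fun=> 1) => // s i; rewrite rmorph1.
  by rewrite E0.
have /EP[_ [b hb eb]] := zE; exists b; split=> [s i _|i j Pi Pj bij]; first exact: hb.
apply/eqP/negPn/negP => ij; have [k /eqP] := rows i j ij; apply.
have hk (s : Gal) l : s (B l k) = B (rho s l) k by apply: hB.
have [si ei] := Ptr i Pi; have [sj ej] := Ptr j Pj; rewrite -ei -ej -!hk.
have [->|nz] := eqVneq (B i0 k) 0; first by rewrite !rmorph0.
have /hz[m ->] : B i0 k \in E by apply/EP; split=> //; exists (fun l => B l k).
by rewrite !rmorphXn eb !hb ei ej bij.
Qed.

End TwistedFunctions.

(** * Descent of rational maps *)

Lemma mh_unmap (A : multiproj) (K K' : fieldType) (f : {rmorphism K -> K'})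
    (D : blocks A -> nat) (p : coord_ring A K) :
  multihomogeneous D (map_mpoly f p) -> multihomogeneous D p.
Proof.
move=> hp m hm; apply: hp; move: hm; rewrite !mcoeff_msupp mcoeff_map_mpoly.
by apply: contra => h; rewrite -(fmorph_eq0 f).
Qed.

Section RatmapDescent.
Variables (F L : fieldType) (iota : {rmorphism F -> L}).
Hypothesis sc : separable_closure iota.
Local Notation Gal := (absGal iota).

Lemma closed_galois (A : multiproj) (X : hcoord A L -> Prop) (s : Gal) x :
  closed_over iota X -> X (galois_act s x) <-> X x.
Proof.
case=> e [_ cX].
have ev p : mh_eval iota p (galois_act s x) = s (mh_eval iota p x).
  rewrite -(@mh_eval_map _ _ _ _ iota idfun iota) // -[in RHS](@mh_eval_map _ _ _ _ iota idfun iota) //.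
  rewrite -mh_eval_conj; congr mh_eval; apply/mpolyP => m.
  by rewrite !mcoeff_map_mpoly; apply/esym/absGal_fix.
have pt : is_point (galois_act s x) <-> is_point x.
  by split=> h i; have [j hj xj] := h i; exists j => //; move: xj; rewrite /galois_act fmorph_eq0.
rewrite !cX pt; split=> -[px h]; split=> // p /h; rewrite ev; last by move=> ->; rewrite rmorph0.
by move/eqP; rewrite fmorph_eq0 => /eqP.
Qed.

Lemma generically_conj (A : multiproj) (X W : hcoord A L -> Prop) (s : Gal) :
  closed_over iota X -> generically X W ->
  generically X (fun x => forall w, galois_act s w = x -> W w).
Proof.
move=> cX [D [h [hh [x Xx hx] H]]]; exists D, (map_mpoly s h); split; first exact: mh_map.
  exists (galois_act s x); first by apply/closed_galois.
  by rewrite mh_eval_conj fmorph_eq0.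
move=> y Xy hy w e; subst y; apply: H; first by apply/(closed_galois s w cX).
by move: hy; rewrite mh_eval_conj fmorph_eq0.
Qed.

Lemma descend_mpoly m (g : {mpoly L[m]}) : (forall (s : Gal) k, s g@_k = g@_k) ->
  exists p : {mpoly F[m]}, map_mpoly iota p = g.
Proof.
move=> fix_g; pose d k := epsilon (inhabits 0) (fun c => g@_k = iota c).
have hd k : iota (d k) = g@_k.
  apply/esym/(epsilon_spec (inhabits (0 : F)) (fun c => g@_k = iota c)).
  by apply: (fixed_field sc) => s; apply: fix_g.
exists (\sum_(k <- msupp g) d k *: 'X_[k]); rewrite raddf_sum /= [RHS]mpolyE.
by apply: eq_bigr => k _; rewrite map_mpolyZ map_mpolyX hd.
Qed.

(** Every conjugate of [h] is proportional to [h] on [X]. The sum of the conjugates weighted by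
    those of an element [e] is Galois invariant, so its coefficients lie in [F], and it is still
    proportional to [h]. Independence of characters provides, in each block, an [e] for which it
    does not vanish. *)
Lemma descend_ratmap (A B : multiproj) (X W : hcoord A L -> Prop) (h : ratmap A B L) :
  closed_over iota X -> irreducible_set X -> ratmap_wf h -> generically X W ->
  (forall x, X x -> W x -> is_point (ratmap_eval idfun h x)) ->
  (forall (s : Gal) x, X x -> W x -> W (galois_act s x) ->
     same_point (ratmap_eval idfun h (galois_act s x)) (galois_act s (ratmap_eval idfun h x))) ->
  exists2 h' : ratmap A B F, ratmap_wf h' &
    generically X (fun x => is_point (ratmap_eval iota h' x) /\
      same_point (ratmap_eval idfun h x) (ratmap_eval iota h' x)).
Proof.
move=> cX irrX wf genW hpt hsame.
have /fin_all_exists[E hE] := wf.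
have [S sub [uS st]] := stable_finite sc
  (flatten [seq [seq (h j)@_m | m <- msupp (h j)] | j <- enum (coords B)]).
have [N [t [t_cover t_sep]]] := representatives st.
have detc j m : determined iota S (h j)@_m.
  have [|n0] := boolP (m \in msupp (h j)); last first.
    by move=> s s' _; rewrite (memN_msupp_eq0 n0) !rmorph0.
  move=> hm; apply/determined_mem/sub/flattenP.
  by exists [seq (h j)@_m | m <- msupp (h j)]; apply: map_f; rewrite ?mem_enum.
pose hs (s : Gal) j : coord_ring A L := map_mpoly s (h j).
(* Proportionality is the vanishing of a form, so it suffices at points of [W] that are conjugates
   of points of [W], where equivariance applies. *)
have cross (s : Gal) j k x : block j = block k -> X x ->
    mh_eval idfun (hs s j) x * mh_eval idfun (h k) x = mh_eval idfun (hs s k) x * mh_eval idfun (h j) x.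
  move=> jk; move: x.
  pose p := hs s j * h k - hs s k * h j.
  have [D hp] : exists D, multihomogeneous D p.
    eexists; apply: mhD; first exact: mhM (mh_map (hE _ _ jk)) (hE _ _ erefl).
    by apply/mhN/mhM; [exact: mh_map (hE _ _ erefl) | exact: hE _ _ jk].
  move=> x Xx; apply/eqP; rewrite -subr_eq0; apply/eqP.
  suff : mh_eval idfun p x = 0 by rewrite mh_evalD mh_evalN !mh_evalM.
  apply: (generically_zero irrX hp) => //.
  apply: generically_mono (generically_and irrX genW (generically_conj s cX genW)) => y Xy [Wy Wy'].
  have [w ew] : exists w, galois_act s w = y.
    have /fin_all_exists[w hw] : forall i, exists z, s z = y i by move=> i; apply: absGal_surj.
    by exists w; apply: boolp.funext => i; apply: hw.
  have Xw : X w by apply/(closed_galois s w cX); rewrite ew.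
  have := same_point_cross (hsame s w Xw (Wy' w ew) _) jk; rewrite ew => /(_ Wy).
  rewrite mh_evalD mh_evalN !mh_evalM /hs -ew !mh_eval_conj /galois_act /ratmap_eval => e.
  by rewrite mulrC -e mulrC subrr.
have [x0 Xx0 Wx0] := generically_ex genW.
have /fin_all_exists2[jb hjb njb] := hpt x0 Xx0 Wx0.
have [k0 hk0] := identity_index t_cover.
have hs_k0 j : hs (t k0) j = h j.
  apply/mpolyP => m; rewrite mcoeff_map_mpoly.
  by apply: (detc j m (t k0) (absGal1 iota)) => x xS; rewrite hk0.
(* Among the conjugates is [h] itself, at the index [k0], and its coordinate [jb b] is nonzero at
   [x0]. *)
have /fin_all_exists2[e he ne] : forall b : blocks B, exists2 e, determined iota S e &
    \sum_k mh_eval idfun (hs (t k) (jb b)) x0 * t k e != 0.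
  by move=> b; apply: (galois_independent_ex t_sep (k0 := k0)); rewrite /= hs_k0; exact: njb.
pose g j : coord_ring A L := \sum_k t k (e (block j)) *: hs (t k) j.
have g_ev j x : mh_eval idfun (g j) x = \sum_k t k (e (block j)) * mh_eval idfun (hs (t k) j) x.
  by rewrite mh_eval_sum; apply: eq_bigr => k _; rewrite -mul_mpolyC mh_evalM mh_evalC.
have g_fix j (s : Gal) m : s (g j)@_m = (g j)@_m.
  have gE : (g j)@_m = \sum_k t k (e (block j) * (h j)@_m).
    rewrite raddf_sum; apply: eq_bigr => k _.
    by rewrite /= mcoeffZ mcoeff_map_mpoly rmorphM.
  have [p pinj hp] := translation t_cover t_sep s.
  rewrite gE rmorph_sum [RHS](reindex_inj pinj); apply: eq_bigr => k _.
  by rewrite -(determinedM (he _) (detc j m) (hp k)).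
have /fin_all_exists[h' hh'] : forall j, exists p, map_mpoly iota p = g j.
  by move=> j; apply: descend_mpoly.
have ev' j x : ratmap_eval iota h' x j = mh_eval idfun (g j) x.
  by rewrite -hh' (@mh_eval_map _ _ _ _ iota idfun iota).
have g_mh b j : block j = b -> multihomogeneous (E b) (g j).
  move=> jb'; apply: mh_sum => k _; rewrite -mul_mpolyC.
  apply: (@mh_eqD _ _ (fun i => 0 + E b i)%N) => //.
  by apply: mhM; [exact: mhC | apply/mh_map/hE].
exists h'.
  by move=> b; exists (E b) => j hj; apply: (@mh_unmap _ _ _ iota); rewrite hh'; apply: g_mh.
have gen_g : generically X (fun x => is_point (ratmap_eval iota h' x)).
  exists (fun a => \sum_b E b a)%N, (\prod_b g (jb b)); split.
  - by apply: mh_prod => b _; apply: g_mh.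
  - exists x0 => //; rewrite mh_eval_prod; apply/prodf_neq0 => b _; rewrite g_ev hjb.
    by under eq_bigr do rewrite mulrC.
  move=> x Xx; rewrite mh_eval_prod => /prodf_neq0 gx b.
  by exists (jb b); rewrite ?ev' // gx.
apply: generically_mono (generically_and irrX gen_g genW) => x Xx [gx Wx]; split=> //.
apply: cross_same_point => //; first exact: hpt.
move=> j k jk; rewrite !ev' !g_ev /ratmap_eval !mulr_sumr -jk; apply: eq_bigr => l _.
have := cross (t l) j k x jk Xx; set u := mh_eval _ _ _ => E0.
by rewrite mulrCA [RHS]mulrCA; congr (_ * _); rewrite mulrC -E0 mulrC.
Qed.

End RatmapDescent.

Section BirationalDescent.
Variables (F L : fieldType) (iota : {rmorphism F -> L}).
Hypothesis sc : separable_closure iota.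
Local Notation Gal := (absGal iota).

Lemma closed_same (A : multiproj) (X : hcoord A L -> Prop) x y :
  closed_over iota X -> same_point x y -> X x -> X y.
Proof.
case=> e [he cX] s /cX[px h]; apply/cX; split; first exact: is_point_same s px.
by move=> p pe; have [D hp] := he p pe; apply: (mh_eval_eq0_same hp s); apply: h.
Qed.

Lemma basic_pullback (A B : multiproj) (X WX : hcoord A L -> Prop) (Y WY : hcoord B L -> Prop)
    (h : ratmap A B L) : ratmap_wf h -> basic_open idfun X WX -> basic_open idfun Y WY ->
  (forall x, WX x -> Y (ratmap_eval idfun h x)) ->
  basic_open idfun X (fun x => WX x /\ WY (ratmap_eval idfun h x)).
Proof.
move=> wf bX [D [e [he eY]]] hY; have [D' hD'] := mh_pullback_wf wf he.
apply: (basic_trans bX); exists D', (pullback h e); split=> // x.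
by rewrite pullbackE eY; split=> [[Wx []]|[Wx ex]] //; split=> //; split=> //; apply: hY.
Qed.

Section Half.
Variables (A B : multiproj) (X WX : hcoord A L -> Prop) (Y WY : hcoord B L -> Prop).
Variables (h : ratmap A B L) (g : ratmap B A L).
Hypothesis (cX : closed_over iota X) (cY : closed_over iota Y).
Hypothesis (iX : irreducible_set X) (iY : irreducible_set Y).
Hypothesis (wfh : ratmap_wf h) (wfg : ratmap_wf g).
Hypothesis (bX : basic_open idfun X WX) (bY : basic_open idfun Y WY).
Hypothesis hY : forall x, WX x -> Y (ratmap_eval idfun h x).
Hypothesis gX : forall y, WY y -> X (ratmap_eval idfun g y).
Hypothesis gh : forall x, WX x -> WY (ratmap_eval idfun h x) ->
  same_point x (ratmap_eval idfun g (ratmap_eval idfun h x)).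
Hypothesis hg : forall y, WY y -> WX (ratmap_eval idfun g y) ->
  same_point y (ratmap_eval idfun h (ratmap_eval idfun g y)).
Hypothesis ne : exists y, WY y /\ WX (ratmap_eval idfun g y).
Variables (h' : ratmap A B F) (g' : ratmap B A F).
Hypothesis wfg' : ratmap_wf g'.
Hypothesis h'_h : generically X (fun x => is_point (ratmap_eval iota h' x) /\
  same_point (ratmap_eval idfun h x) (ratmap_eval iota h' x)).
Hypothesis g'_g : generically Y (fun y => is_point (ratmap_eval iota g' y) /\
  same_point (ratmap_eval idfun g y) (ratmap_eval iota g' y)).

(** The descended maps agree with [h] and [g] only generically. The inverse identity is transferred
    at points x where [h'] agrees with [h] at x and [g'] agrees with [g] at h x; the nonempty
    overlap makes the second condition generic on [X]. *)
Lemma descent_inverse : generically X (inverse_at iota h' g' Y).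
Proof.
have [D [k [hk nk Hk]]] := g'_g.
have gen1 : generically Y (fun y => WY y /\ WX (ratmap_eval idfun g y)).
  exact: generically_basic (basic_pullback wfg bY bX gX) ne.
have gen2 : generically Y (fun y => mh_eval idfun k y != 0) by exists D, k.
have [y Yy [[WYy WXy] ky]] := generically_ex (generically_and iY gen1 gen2).
pose P x := mh_eval idfun k (ratmap_eval idfun h x) != 0.
have bP : basic_open idfun X (fun x => (WX x /\ WY (ratmap_eval idfun h x)) /\ P x).
  have [D' hD'] := mh_pullback_wf wfh hk.
  apply: (basic_trans (basic_pullback wfh bX bY hY)); exists D', (pullback h k); split=> // x.
  by rewrite pullbackE.
have s := hg WYy WXy.
have gen3 := generically_basic bP (ex_intro _ (ratmap_eval idfun g y)
  (conj (conj WXy (basic_same bY WYy (hY WXy) s)) (mh_eval_neq0_same hk s ky))).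
apply: generically_mono (generically_and iX gen3 h'_h) => x Xx [[[WXx WYx] kx] [ptx sx]].
have [gpt gs] := Hk _ (hY WXx) kx.
have s' : same_point (ratmap_eval iota g' (ratmap_eval idfun h x))
    (ratmap_eval iota g' (ratmap_eval iota h' x)) by apply: ratmap_same.
split; first by apply: closed_same cY sx (hY WXx).
  exact: is_point_same s' gpt.
exact: same_point_trans (gh WXx WYx) (same_point_trans gs s').
Qed.

End Half.

(** Equivariance is asked for only where a point and its conjugate both lie in the open set, since
    this set is not assumed stable under the Galois group. *)
Lemma birational_by_descent (A B : multiproj) (X WX : hcoord A L -> Prop)
    (Y WY : hcoord B L -> Prop) (h : ratmap A B L) (g : ratmap B A L) :
  closed_over iota X -> closed_over iota Y -> irreducible_set X -> irreducible_set Y ->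
  ratmap_wf h -> ratmap_wf g -> basic_open idfun X WX -> basic_open idfun Y WY ->
  (forall x, WX x -> Y (ratmap_eval idfun h x)) ->
  (forall y, WY y -> X (ratmap_eval idfun g y)) ->
  (forall x, WX x -> WY (ratmap_eval idfun h x) ->
    same_point x (ratmap_eval idfun g (ratmap_eval idfun h x))) ->
  (forall y, WY y -> WX (ratmap_eval idfun g y) ->
    same_point y (ratmap_eval idfun h (ratmap_eval idfun g y))) ->
  (forall (s : Gal) x, WX x -> WX (galois_act s x) ->
    same_point (ratmap_eval idfun h (galois_act s x)) (galois_act s (ratmap_eval idfun h x))) ->
  (forall (s : Gal) y, WY y -> WY (galois_act s y) ->
    same_point (ratmap_eval idfun g (galois_act s y)) (galois_act s (ratmap_eval idfun g y))) ->
  (exists y, WY y /\ WX (ratmap_eval idfun g y)) ->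
  birational_over iota X Y.
Proof.
move=> cX cY iX iY wfh wfg bX bY hY gX gh hg eh eg [y [WYy WXy]].
have s := hg y WYy WXy; have WYh := basic_same bY WYy (hY _ WXy) s.
have pt (C : multiproj) (Z : hcoord C L -> Prop) z : closed_over iota Z -> Z z -> is_point z.
  by case=> e [_ cZ] /cZ[].
have [h' wfh' sh'] := descend_ratmap sc cX iX wfh
  (generically_basic bX (ex_intro _ _ WXy)) (fun x _ Wx => pt _ _ _ cY (hY x Wx))
  (fun s x _ Wx Wsx => eh s x Wx Wsx).
have [g' wfg' sg'] := descend_ratmap sc cY iY wfg
  (generically_basic bY (ex_intro _ _ WYy)) (fun x _ Wx => pt _ _ _ cX (gX x Wx))
  (fun s x _ Wx Wsx => eg s x Wx Wsx).
apply: (birational_of_generic wfh' wfg' cX cY iX iY).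
  by apply: (descent_inverse cY iX iY wfh wfg bX bY hY gX gh hg _ wfg' sh' sg'); exists y.
apply: (descent_inverse cX iY iX wfg wfh bY bX gX hY hg gh _ wfh' sg' sh').
by exists (ratmap_eval idfun g y).
Qed.

Lemma projspace_closed d : closed_over iota (@is_point (projspace d) L).
Proof. by exists [::]; split=> // x; split=> [px|[]]. Qed.

End BirationalDescent.

(** * Affine charts of projective space and morphisms in charts *)

Section AffineChart.
Variables (T : finType) (L : fieldType).
Local Notation P := (projspace #|T|).
Implicit Types (w : hcoord P L) (f : T -> L).

Definition hom_pt f : hcoord P L := fun j => if unlift ord0 j is Some k then f (enum_val k) else 1.
Definition affine w (t : T) : L := w (lift ord0 (enum_rank t)) / w ord0.

Lemma hom_pt0 f : hom_pt f ord0 = 1.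
Proof. by rewrite /hom_pt unlift_none. Qed.

Lemma hom_pt_lift f t : hom_pt f (lift ord0 (enum_rank t)) = f t.
Proof. by rewrite /hom_pt liftK enum_rankK. Qed.

Lemma affine_hom_pt f : affine (hom_pt f) =1 f.
Proof. by move=> t; rewrite /affine hom_pt0 hom_pt_lift divr1. Qed.

Lemma hom_pt_point f : is_point (hom_pt f).
Proof. by apply/projspace_point; exists ord0; rewrite hom_pt0 oner_neq0. Qed.

Lemma hom_pt_affine w : w ord0 != 0 -> same_point w (hom_pt (affine w)).
Proof.
move=> w0; exists (fun=> (w ord0)^-1); split=> [_|j]; first by rewrite invr_eq0.
rewrite /hom_pt; case: unliftP => [k|] ->; last by rewrite mulVf.
by rewrite /affine enum_valK mulrC.
Qed.

Lemma affine_same w w' : same_point w w' -> affine w =1 affine w'.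
Proof. by case=> c [c0 e] t; rewrite /affine !e -mulf_div mulfV ?mul1r. Qed.

Lemma hom_pt_ext f f' : f =1 f' -> hom_pt f =1 hom_pt f'.
Proof. by move=> e j; rewrite /hom_pt; case: unlift. Qed.

Variables (K : fieldType) (iota : {rmorphism K -> L}).

Definition chart_dom w := is_point w /\ w ord0 != 0.

Lemma basic_chart : basic_open iota (@is_point P L) chart_dom.
Proof.
exists (fun b => (tt == b : nat)), 'X_(enum_rank (ord0 : coords P)); split; first exact: (@mhX P K ord0).
by move=> w; rewrite (@mh_evalX P K L iota w ord0).
Qed.

Lemma regular_affine W t : (forall w, W w -> chart_dom w) -> regular iota W (fun w => affine w t).
Proof.
move=> h; apply: (@regular_coord P) => [|w /h[]//].
by case: (block _) (block _) => -[].
Qed.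

Lemma regular_hom_pt (A : multiproj) (W : hcoord A L -> Prop) (f : hcoord A L -> T -> L) j :
  (forall t, regular iota W (fun x => f x t)) -> regular iota W (fun x => hom_pt (f x) j).
Proof. by move=> h; rewrite /hom_pt; case: unlift => [k|]; [apply: h | apply: regular1]. Qed.

End AffineChart.

Lemma regular_comp (A B : multiproj) (K L : fieldType) (iota : {rmorphism K -> L})
    (W : hcoord A L -> Prop) (W' : hcoord B L -> Prop) (h : ratmap A B K) f :
  ratmap_wf h -> (forall x, W x -> W' (ratmap_eval iota h x)) -> regular iota W' f ->
  regular iota W (fun x => f (ratmap_eval iota h x)).
Proof.
move=> /fin_all_exists[E hE] hW [D [p [q [hp hq H]]]].
exists (fun a => \sum_b D b * E b a)%N, (pullback h p), (pullback h q); split.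
- by apply: mh_pullback hp => j; apply: hE.
- by apply: mh_pullback hq => j; apply: hE.
by move=> x /hW /H; rewrite !pullbackE.
Qed.

Section MorphismPoints.
Variables (L : fieldType) (A B : multiproj).
Variables (X : hcoord A L -> Prop) (Y : hcoord B L -> Prop) (phi : hcoord A L -> hcoord B L).
Hypothesis phi_mor : is_morphism X Y phi.

Lemma morphism_same x x' : X x -> X x' -> same_point x x' -> same_point (phi x) (phi x').
Proof.
case: phi_mor => _ chart Xx Xx' s; have [f [wf px hf]] := chart x Xx.
have s' := ratmap_same idfun wf s.
apply: same_point_trans (same_point_sym (hf x Xx px)) _.
exact: same_point_trans s' (hf x' Xx' (is_point_same s' px)).
Qed.

Lemma morphism_chart x0 : X x0 -> exists (f : ratmap A B L) W, [/\ ratmap_wf f, basic_open idfun X W, W x0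
  & forall x, W x -> is_point (ratmap_eval idfun f x) /\ same_point (ratmap_eval idfun f x) (phi x)].
Proof.
case: phi_mor => _ chart Xx; have [f [wf px hf]] := chart x0 Xx.
have /point_testsP[p hp px0] := px; have [D hD] := point_tests_mh wf hp.
exists f, (fun x => X x /\ mh_eval idfun p x != 0); split=> //; first by exists D, p.
move=> x [Xx' px']; have pt : is_point (ratmap_eval idfun f x) by apply/point_testsP; exists p.
by split=> //; apply: hf.
Qed.

(** A form nonzero somewhere on [Y] is pulled back by a chart of [phi] and multiplied by the form
    that defines the chart domain. The product can be nonzero at a point of [X] only if the original
    form is nonzero at its image. *)
Lemma irreducible_image : irreducible_set X -> (forall y, Y y -> exists2 x, X x & same_point y (phi x)) ->
  irreducible_set Y.
Proof.
move=> irr onto D1 D2 h1 h2 hh1 hh2 [y1 Yy1 n1] [y2 Yy2 n2].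
have lift y D (h : coord_ring B L) : Y y -> multihomogeneous D h -> mh_eval idfun h y != 0 ->
    exists D' (k : coord_ring A L), [/\ multihomogeneous D' k, exists2 x, X x & mh_eval idfun k x != 0
      & forall x, X x -> mh_eval idfun k x != 0 -> mh_eval idfun h (phi x) != 0].
  move=> Yy hh hy; have [x Xx s] := onto y Yy.
  have [f [W [wf [D' [e [he hW]]] Wx hf]]] := morphism_chart Xx.
  have [D'' hD''] := mh_pullback_wf wf hh.
  exists (fun i => D' i + D'' i)%N, (e * pullback f h); split; first exact: mhM.
    exists x => //; rewrite mh_evalM pullbackE mulf_neq0 //; first by case/hW: Wx.
    by have [_ s'] := hf x Wx; apply: mh_eval_neq0_same hh (same_point_trans s (same_point_sym s')) hy.
  move=> z Xz; rewrite mh_evalM mulf_eq0 negb_or pullbackE => /andP[ez hz].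
  have [_ s'] : is_point (ratmap_eval idfun f z) /\ same_point (ratmap_eval idfun f z) (phi z).
    by apply: hf; apply/hW.
  exact: mh_eval_neq0_same hh s' hz.
have [E1 [k1 [hk1 ne1 H1]]] := lift _ _ _ Yy1 hh1 n1.
have [E2 [k2 [hk2 ne2 H2]]] := lift _ _ _ Yy2 hh2 n2.
have [x [Xx kx1 kx2]] := irr _ _ _ _ hk1 hk2 ne1 ne2.
by exists (phi x); split; [case: phi_mor => + _; apply | apply: H1 | apply: H2].
Qed.

End MorphismPoints.

Lemma perm_act_crs (L : fieldType) n (h : 'S_n) (Z : 'I_n -> 'rV[L]_2) :
  perm_act h (crs Z) = crs (fun i => Z (h^-1 i)%g).
Proof. by apply: boolp.funext => -[q d]; rewrite /perm_act /crs /= !ffunE. Qed.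

Lemma perm_act_config (L : fieldType) n (h : 'S_n) (Z Z' : 'I_n -> 'rV[L]_2) :
  same_config Z (fun i => Z' (h i)) -> @same_point (quad_space n) L (perm_act h (crs Z)) (crs Z').
Proof.
case=> M uM hM; rewrite perm_act_crs; apply: same_config_crs; exists M => // i.
by have [c c0 e] := hM (h^-1 i)%g; exists c; rewrite -?e ?permKV.
Qed.

Lemma perm_act_same (L : fieldType) n (h : 'S_n) (x y : hcoord (quad_space n) L) :
  same_point x y -> @same_point (quad_space n) L (perm_act h x) (perm_act h y).
Proof. by case=> c [c0 e]; exists (fun q => c (perm_quad h^-1 q)); split=> // j; rewrite /perm_act e. Qed.

Lemma galois_act_same (A : multiproj) (F L : fieldType) (iota : {rmorphism F -> L}) (s : absGal iota)
    (x y : hcoord A L) : same_point x y -> same_point (galois_act s x) (galois_act s y).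
Proof.
case=> c [c0 e]; exists (fun i => s (c i)); split=> [i|j]; first by rewrite fmorph_eq0.
by rewrite /galois_act e rmorphM.
Qed.

Lemma galois_act_crs (n : nat) (F L : fieldType) (iota : {rmorphism F -> L}) (s : absGal iota)
    (Z : 'I_n -> 'rV[L]_2) : @galois_act (quad_space n) _ _ _ s (crs Z) = crs (fun i => map_mx s (Z i)).
Proof.
apply: boolp.funext => -[q d]; rewrite /galois_act /crs /= !br_map; by case: ifP => _; rewrite rmorphM.
Qed.

Lemma some_quad n : (4 <= n)%N -> quad n.
Proof.
move=> n4; exists [ffun t : 'I_4 => widen_ord n4 t].
by apply/injectiveP => s t; rewrite !ffunE => /(congr1 val) /= /val_inj.
Qed.

Section NormalConfig.
Variables (L : fieldType) (n : nat).
Hypothesis Linf : forall s : seq L, exists x, x \notin s.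
Hypothesis n3 : (3 <= n)%N.
Variable q0 : quad n.
Local Notation NC := (normal_config n3 q0).

Lemma smooth_normal (x : hcoord (quad_space n) L) : smooth_locus x -> distinct_pts (NC x) /\
  @same_point (quad_space n) L x (crs (NC x)).
Proof.
case=> Z d s; have h := normal_config_crs n3 q0 d; rewrite (normal_config_same n3 q0 s); split.
  exact: same_config_distinct h d.
exact: same_point_trans s (same_config_crs h).
Qed.

Lemma crs_smooth (Z : 'I_n -> 'rV[L]_2) : distinct_pts Z -> smooth_locus (crs Z).
Proof. by exists Z => //; apply: same_point_refl. Qed.

(** The equation is the product of all coordinates, by [smooth_locusP]. *)
Lemma basic_smooth (K : fieldType) (iota : {rmorphism K -> L}) :
  basic_open iota (@Mbar L n) (@smooth_locus L n).
Proof.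
exists (fun b => \sum_(j : coords (quad_space n)) (block j == b))%N,
  (\prod_(j : coords (quad_space n)) 'X_(enum_rank j)).
split; first by apply: mh_prod => j _; apply: mhX.
move=> x; rewrite mh_eval_prod; split.
  case/(smooth_locusP Linf n3 q0) => Mx x0; split=> //; apply/prodf_neq0 => j _.
  by rewrite (@mh_evalX _ _ _ iota).
case=> Mx /prodf_neq0 x0; apply/(smooth_locusP Linf n3 q0); split=> // j.
by have := x0 j isT; rewrite (@mh_evalX _ _ _ iota).
Qed.

End NormalConfig.

(** * Twisted forms *)

Lemma param_act_id n r (x : param_ix n r) : param_act false id x = x.
Proof. by case: x => [[[s ab]|k]|i] //=; rewrite addbF. Qed.

Lemma param_act_comp n r b b' (h h' : 'I_n -> 'I_n) (x : param_ix n r) :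
  param_act b h (param_act b' h' x) = param_act (b (+) b') (fun i => h (h' i)) x.
Proof.
case: x => [[[s ab]|k]|i] //=; first by rewrite -addbA [b' (+) b]addbC.
by case: b; case: b' => //=; rewrite tpermK.
Qed.

Lemma param_act_inj n r b (h : 'I_n -> 'I_n) : injective h -> injective (@param_act n r b h).
Proof.
move=> hi; case=> [[[s ab]|k]|i] [[[s' ab']|k']|i'] //=.
- by case=> /addIb -> ->.
- by case: b => /= -[e]; [rewrite (perm_inj e) | rewrite e].
- by case=> /hi ->.
Qed.

Section UsedParameters.
Variables (L : fieldType) (n r : nat) (D : layout n r).
Implicit Types (u : 'I_n -> 'rV[L]_(2 + r)) (p : param_ix n r -> L).

Lemma compatible_id : compatible D false id.
Proof. by split=> // i; rewrite addbF. Qed.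

Lemma Psi_used u p p' : good D u p -> (forall x, used D x -> p' x = p x) ->
  good D u p' /\ same_config (Psi D u p) (Psi D u p').
Proof.
move=> g e; have e' x : used D x -> p' (param_act false id x) = p x by rewrite param_act_id; apply: e.
by split; [apply: (good_act compatible_id (u := u) _ e') | apply: (Psi_act compatible_id (u' := u) _ e')].
Qed.

(** The default value of [insubd] is never taken when the permutation is compatible with the
    layout. *)
Definition act_used (b : bool) (h : 'I_n -> 'I_n) (t : {x | used D x}) : {x | used D x} :=
  insubd t (param_act b h (val t)).

Lemma val_act_used b h t : compatible D b h -> val (act_used b h t) = param_act b h (val t).
Proof. by move=> c; rewrite /act_used val_insubd (used_act _ c) (valP t). Qed.

End UsedParameters.

Section Twist.
Variables (F L : fieldType) (iota : {rmorphism F -> L}).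
Hypothesis sc : separable_closure iota.
Local Notation Gal := (absGal iota).
Variables (n : nat) (rho : Gal -> 'S_n).
Hypothesis n5 : (5 <= n)%N.
Hypothesis rho_hom : galois_hom rho.
Hypothesis rho_cont : galois_continuous rho.
Hypothesis rho_comm : forall s t, (rho s * rho t = rho t * rho s)%g.
Variables (r : nat) (D : layout n r) (chi : 'S_n -> bool) (u : 'I_n -> 'rV[L]_(2 + r)).
Hypothesis compat : forall s, compatible D (chi (rho s)) (rho s).
Hypothesis u_eq : forall (s : Gal) i, inO D i -> map_mx s (u i) = u (rho s i).
Variable p0 : param_ix n r -> L.
Hypothesis good0 : good D u p0.

Local Notation ix := (param_ix n r).
Local Notation T := {x : ix | used D x}.
Local Notation pact s := (param_act (chi (rho s)) (rho s)).

Definition act_ord (h : 'S_n) (i : 'I_#|{: T}|) : 'I_#|{: T}| := enum_rank (act_used (chi h) h (enum_val i)).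

Let chi_comp (s t : Gal) : chi (rho (absGal_comp s t)) = chi (rho s) (+) chi (rho t).
Proof.
pose i0 : 'I_n := Ordinal (leq_trans (isT : 1 <= 5)%N n5).
have [_ _ _ hs] := compat s; have [_ _ _ ht] := compat t.
have [_ _ _ hst] := compat (absGal_comp s t).
have := hst i0; rewrite rho_comp // hs ht -addbA => /addbI <-.
by rewrite addbC.
Qed.

Lemma act_ord_comp (s t : Gal) i :
  act_ord (rho (absGal_comp s t)) i = act_ord (rho s) (act_ord (rho t) i).
Proof.
rewrite /act_ord; congr enum_rank; rewrite enum_rankK; apply/val_inj.
rewrite ?val_act_used ?(compat _) // param_act_comp chi_comp.
by case: (val _) => [[[b ab]|k]|j] //=; rewrite rho_comp.
Qed.

Lemma act_ord_inj (s : Gal) : injective (act_ord (rho s)).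
Proof.
move=> i j /enum_rank_inj /(congr1 val); rewrite ?val_act_used ?(compat _) // => /param_act_inj e.
by apply/enum_val_inj/val_inj/e; exact: perm_inj.
Qed.

Variable B : 'M[L]_#|{: T}|.
Hypothesis uB : B \in unitmx.
Hypothesis B_eq : forall (s : Gal) i j, s (B i j) = B (act_ord (rho s) i) j.

(** The columns of [B] form a basis of vectors invariant under the permuted Galois action on
    parameters. In this basis the twisted action becomes the plain one on the coordinates [c].
    Entries outside [used] are set to 0. *)
Definition par (c : T -> L) (x : ix) : L :=
  if insub x is Some t then (B *m \col_i c (enum_val i)) (enum_rank t) 0 else 0.
Definition par_coord (p : ix -> L) (t : T) : L :=
  (invmx B *m \col_i p (val (enum_val i))) (enum_rank t) 0.

Lemma parE c t : par c (val t) = (B *m \col_i c (enum_val i)) (enum_rank t) 0.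
Proof. by rewrite /par valK. Qed.

Lemma par_par_coord p x : used D x -> par (par_coord p) x = p x.
Proof.
move=> hx; have -> : x = val (exist (used D) x hx) by [].
rewrite parE (_ : (\col_i _) = invmx B *m \col_i p (val (enum_val i))); last first.
  by apply/colP => i; rewrite !mxE /par_coord enum_valK mxE.
by rewrite mulKVmx // mxE enum_rankK.
Qed.

Lemma par_coord_uniq p c : (forall x, used D x -> par c x = p x) -> par_coord p =1 c.
Proof.
move=> h t; rewrite /par_coord (_ : (\col_i _) = B *m \col_i c (enum_val i)); last first.
  by apply/colP => i; rewrite mxE -h ?(valP (enum_val i)) // parE enum_valK.
by rewrite mulKmx // mxE enum_rankK.
Qed.

Lemma par_galois (s : Gal) c x : used D x -> par (fun t => s (c t)) (pact s x) = s (par c x).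
Proof.
move=> hx; have -> : x = val (exist (used D) x hx) by [].
rewrite -val_act_used // !parE !mxE rmorph_sum; apply: eq_bigr => j _.
by rewrite !mxE rmorphM B_eq /act_ord enum_rankK.
Qed.

Lemma par_coord_galois (s : Gal) p p' : (forall x, used D x -> p' (pact s x) = s (p x)) ->
  par_coord p' =1 fun t => s (par_coord p t).
Proof.
move=> h; apply: par_coord_uniq => x hx.
have [k hk hk'] := injF_bij (@param_act_inj n r (chi (rho s)) (rho s) (@perm_inj _ (rho s))).
rewrite -(hk' x); have hkx : used D (k x) by rewrite -(used_act _ (compat s)) hk'.
by rewrite par_galois // par_par_coord // h.
Qed.

Variables (A : multiproj) (Y : hcoord A L -> Prop) (cY : closed_over iota Y).
Variables (phi : hcoord A L -> hcoord (quad_space n) L) (psi : hcoord (quad_space n) L -> hcoord A L).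
Hypothesis phi_mor : is_morphism Y (@Mbar L n) phi.
Hypothesis psi_mor : is_morphism (@Mbar L n) Y psi.
Hypothesis psi_phi : forall y, Y y -> same_point y (psi (phi y)).
Hypothesis phi_psi : forall x, Mbar x -> same_point x (phi (psi x)).
Hypothesis phi_eq : forall (s : Gal) y, Y y ->
  same_point (phi (galois_act s y)) (perm_act (rho s) (galois_act s (phi y))).

Let Linf := sep_closed_infinite sc.
Let n3 : (3 <= n)%N := leq_trans (isT : 3 <= 5)%N n5.

Let q0 := some_quad (ltnW n5).

Local Notation NC := (normal_config n3 q0).

Theorem twist_rational : rational_over iota Y.
Proof.
have n1 : (1 < n)%N by apply: leq_trans n5.
have bS := basic_smooth Linf n3 q0 (@idfun L : {rmorphism L -> L}).
have [|||W' [pf [bW' rpf hW' uniqW']]] := @regular_parameters L n r D (quad_space n) L idfun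
  (@smooth_locus L n) (fun=> u) NC n1.
- by move=> i k; apply: regular_const.
- by move=> i k; apply: regular_normal_config => x j; apply: smooth_nonzero.
- by move=> x /(smooth_normal n3 q0)[].
have bMW := basic_trans bS bW'.
have W's x : W' x -> smooth_locus x by move=> h; apply: (basic_sub bW' h).
have W'same x y : W' x -> Mbar y -> same_point x y -> W' y by move=> h Mz s; apply: (basic_same bMW h Mz s).
have good_smooth p : good D u p -> smooth_locus (crs (Psi D u p)) by case=> d _; apply: crs_smooth.
have good_Mbar p : good D u p -> Mbar (crs (Psi D u p)).
  by move=> /good_smooth s; apply: (basic_sub bS s).
have pf_crs p x : good D u p -> @same_point (quad_space n) L x (crs (Psi D u p)) ->
    W' x /\ forall k, used D k -> pf x k = p k.
  move=> g s; have sx : smooth_locus x by apply: smooth_same (same_point_sym s) (good_smooth p g).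
  apply: uniqW' => //; rewrite (normal_config_same n3 q0 s).
  by apply/same_config_sym/normal_config_crs; case: g.
have crs_pf x : W' x -> @same_point (quad_space n) L x (crs (Psi D u (pf x))).
  move=> Wx; have [_ s] := smooth_normal n3 q0 (W's x Wx).
  by have [_ /same_config_crs] := hW' x Wx; apply: same_point_trans.
pose x0 := crs (Psi D u p0); have Mx0 : Mbar x0 by apply: good_Mbar.
have hY x : Mbar x -> Y (psi x) by case: psi_mor => + _; apply.
have hM y : Y y -> Mbar (phi y) by case: phi_mor => + _; apply.
(* The isomorphisms are given by forms only locally, so charts of both are fixed around one point
   [x0] with good parameters. *)
have [f0 [Wf [wf0 bWf Wf0 hf0]]] := morphism_chart phi_mor (hY _ Mx0).
have [g0 [Wg [wg0 bWg Wg0 hg0]]] := morphism_chart psi_mor Mx0.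
have YWf := basic_sub bWf.
have f0M y : Wf y -> Mbar (ratmap_eval idfun f0 y).
  by move=> Wy; have [_ /same_point_sym s] := hf0 y Wy; apply: Mbar_same s (hM _ (YWf _ Wy)).
pose WY y := Wf y /\ W' (ratmap_eval idfun f0 y).
have bWY : basic_open idfun Y WY := basic_pullback wf0 bWf bMW f0M.
have WYphi y : WY y -> same_point (ratmap_eval idfun f0 y) (phi y) by case=> /hf0[].
pose cf y := par_coord (pf (ratmap_eval idfun f0 y)).
have rcf t : regular idfun WY (fun y => cf y t).
  rewrite /cf; apply: (@regular_comp _ _ _ _ _ _ W' f0 (fun x => par_coord (pf x) t)) => //.
    by move=> y [].
  apply: regular_mulmx => [i j|i j]; first exact: regular_const.
  by apply: regular_ext (rpf (val (enum_val i))) => x _; rewrite mxE.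
have [h [[Dh wfh] hE]] := ratmap_of_regular (fun j => regular_hom_pt j rcf).
have hS (y : hcoord A L) : WY y -> @same_point (projspace #|{: T}|) L (hom_pt (cf y)) (ratmap_eval idfun h y).
  by move=> /hE[c c0 e]; exists (fun=> c).
pose pz w := par (affine w).
have rpz W x : (forall w, W w -> @chart_dom {: T} L w) -> regular idfun W (fun w => pz w x).
  move=> hW; rewrite /pz /par; case: insubP => [t _ _|_]; last exact: regular0.
  apply: regular_mulmx => [i j|i j]; first exact: regular_const.
  by apply: regular_ext (regular_affine idfun (enum_val i) hW) => w _; rewrite mxE.
pose WZ1 w := chart_dom w /\ good D u (pz w).
have bWZ1 : basic_open idfun (@chart_dom {: T} L) WZ1.
  by apply: basic_good => *; [apply: regular_const | apply: rpz].
have rx j : regular idfun WZ1 (fun w => crs (Psi D u (pz w)) j).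
  apply: regular_crs; apply: regular_Psi => [i k|x]; first exact: regular_const.
  by apply: rpz => w [].
have [r1 [[Dr wfr] rE]] := ratmap_of_regular (B := quad_space n) rx.
have rS w : WZ1 w -> @same_point (quad_space n) L (crs (Psi D u (pz w))) (ratmap_eval idfun r1 w).
  by move=> /rE[c c0 e]; exists (fun=> c).
have wfr1 : ratmap_wf r1 by move=> b; exists Dr.
have rM w : WZ1 w -> Mbar (ratmap_eval idfun r1 w).
  by move=> Ww; apply: Mbar_same (rS w Ww) (good_Mbar _ Ww.2).
pose WZ w := WZ1 w /\ Wg (ratmap_eval idfun r1 w).
have bWZ : basic_open idfun (@is_point (projspace #|{: T}|) L) WZ.
  exact: (basic_pullback wfr1 (basic_trans (basic_chart {: T} (@idfun L : {rmorphism L -> L})) bWZ1) bWg rM).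
pose g : ratmap (projspace #|{: T}|) A L := fun j => pullback r1 (g0 j).
have wfg : ratmap_wf g.
  move=> b; have [D' hD'] := wg0 b.
  by exists (fun a => \sum_c D' c * Dr a)%N => j /hD' hj; apply: mh_pullback hj.
have gE w : ratmap_eval idfun g w = ratmap_eval idfun g0 (ratmap_eval idfun r1 w).
  by apply: boolp.funext => j; rewrite /ratmap_eval pullbackE.
have gS w : WZ w -> same_point (psi (crs (Psi D u (pz w)))) (ratmap_eval idfun g w).
  case=> W1 W2; rewrite gE; have [_ s] := hg0 _ W2.
  apply: same_point_trans (same_point_sym s).
  by apply: (morphism_same psi_mor) (rS w W1); [apply: good_Mbar; case: W1 | apply: rM].
have gY w : WZ w -> Y (ratmap_eval idfun g w).
  move=> Ww; apply: closed_same cY (gS w Ww) _; apply/hY/good_Mbar; by case: Ww => -[].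
have phig w : WZ w -> same_point (phi (ratmap_eval idfun g w)) (crs (Psi D u (pz w))).
  move=> Ww; have Mc : Mbar (crs (Psi D u (pz w))) by apply: good_Mbar; case: Ww => -[].
  apply: same_point_trans _ (same_point_sym (phi_psi Mc)).
  by apply: (morphism_same phi_mor (gY w Ww) (hY _ Mc)); apply: same_point_sym (gS w Ww).
have irrM : irreducible_set (@Mbar L n) := good_families_irreducible Linf (Mbar_families L n3).
have irrY : irreducible_set Y.
  by apply: (irreducible_image psi_mor irrM) => y Yy; exists (phi y); [apply: hM | apply: psi_phi].
have irrP := good_families_irreducible Linf (projspace_families L #|{: T}|).
exists #|{: T}|; apply: (birational_by_descent sc cY (projspace_closed iota _) irrY irrP _ wfg bWY bWZ _ gY).
- by move=> b; exists Dh.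
- by move=> y Wy; apply: is_point_same (hS y Wy) (hom_pt_point _).
- move=> y Wy Wz; have Yy := YWf _ Wy.1.
  have e k : used D k -> pz (ratmap_eval idfun h y) k = pf (ratmap_eval idfun f0 y) k.
    move=> hk; rewrite /pz (_ : affine _ = cf y) ?par_par_coord //; apply: boolp.funext => t.
    by rewrite -(affine_same (hS y Wy)) affine_hom_pt.
  have [_ s] := Psi_used (hW' _ Wy.2).1 e.
  apply: same_point_trans (gS _ Wz); apply: same_point_trans (psi_phi Yy) _.
  have Mc : Mbar (crs (Psi D u (pz (ratmap_eval idfun h y)))) by apply: good_Mbar; case: Wz => -[].
  apply: (morphism_same psi_mor) => //; first exact: hM.
  apply: same_point_trans (same_point_sym (WYphi y Wy)) _.
  by apply: same_point_trans (crs_pf _ Wy.2) (same_config_crs s).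
- move=> w Ww Wy; apply: same_point_trans (hS _ Wy).
  have w0 : w ord0 != 0 by case: Ww => -[[]].
  have [_ e] := pf_crs _ _ Ww.1.2 (same_point_trans (WYphi _ Wy) (phig w Ww)).
  apply: same_point_trans (hom_pt_affine w0) _; apply/same_point_eq/hom_pt_ext => t.
  by apply/esym/par_coord_uniq => k hk; rewrite e.
(* The configuration of the conjugate point has the conjugate parameters, permuted. By uniqueness
   these are the parameters read at the conjugate of y, and in the basis [B] the permutation
   disappears. *)
- move=> s y Wy Wsy; apply: same_point_trans (same_point_sym (hS _ Wsy)) _.
  apply: same_point_trans _ (galois_act_same s (hS y Wy)).
  set p := pf (ratmap_eval idfun f0 y); have [gp _] := hW' _ Wy.2; rewrite -/p in gp.
  have hi := @param_act_inj n r (chi (rho s)) (rho s) (@perm_inj _ (rho s)).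
  have [k hk hk'] := injF_bij hi.
  pose p' x := s (p (k x)).
  have ep x : used D x -> p' (pact s x) = s (p x) by rewrite /p' hk.
  have u_s i : inO D i -> u (rho s i) = map_mx s (u i) by move=> Oi; rewrite u_eq.
  have sg := good_map s gp.
  have gp' : good D u p' := good_act (compat s) u_s ep sg.
  have sc1 := Psi_act (compat s) u_s ep sg.
  have X1 : @same_point (quad_space n) L (phi (galois_act s y)) (crs (Psi D u p')).
    apply: same_point_trans (phi_eq s (YWf _ Wy.1)) _.
    apply: same_point_trans (perm_act_same (rho s) (galois_act_same s _)) _.
      exact: same_point_trans (same_point_sym (WYphi y Wy)) (crs_pf _ Wy.2).
    rewrite -/p galois_act_crs (boolp.funext (Psi_map D s u p)).
    exact: perm_act_config sc1.
  have [_ e] := pf_crs _ _ gp' (same_point_trans (WYphi _ Wsy) X1).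
  apply: same_point_eq => j; rewrite /galois_act /hom_pt; case: unlift => [i|]; last by rewrite rmorph1.
  apply: par_coord_galois => x hx; rewrite e ?ep //.
  by rewrite (used_act _ (compat s)).
- move=> s w Ww Wsw; apply: same_point_trans (same_point_sym (gS _ Wsw)) _.
  have Yg := gY w Ww; have Ysg : Y (galois_act s (ratmap_eval idfun g w)) by apply/closed_galois.
  have Mc w' : WZ w' -> Mbar (crs (Psi D u (pz w'))) by move=> Ww'; apply: good_Mbar; case: Ww' => -[].
  apply: same_point_trans (same_point_sym (psi_phi Ysg)).
  apply: (morphism_same psi_mor); [exact: Mc | exact: hM |].
  apply: same_point_trans (same_point_sym (phi_eq s Yg)).
  apply: same_point_trans (same_point_sym (perm_act_same (rho s) (galois_act_same s (phig w Ww)))).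
  have ep x : used D x -> pz (galois_act s w) (pact s x) = s (pz w x).
    move=> hx; rewrite /pz -par_galois //; congr par; apply: boolp.funext => t.
    by rewrite /affine /galois_act fmorph_div.
  have u_s i : inO D i -> u (rho s i) = map_mx s (u i) by move=> Oi; rewrite u_eq.
  have sc1 := Psi_act (compat s) u_s ep (good_map s Ww.1.2).
  rewrite galois_act_crs (boolp.funext (Psi_map D s u (pz w))).
  exact/same_point_sym/(perm_act_config sc1).
(* A point of the overlap: its parameters are those of [p0], so it maps to the point at which both
   charts were taken. *)
pose w0 := hom_pt (par_coord p0).
have ez x : used D x -> pz w0 x = p0 x.
  move=> hx; rewrite /pz (_ : affine _ = par_coord p0) ?par_par_coord //.
  exact/boolp.funext/affine_hom_pt.
have [gz sz] := Psi_used good0 ez.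
have W1 : WZ1 w0 by split=> //; split; [apply: hom_pt_point | rewrite /w0 hom_pt0 oner_neq0].
have sw0 : @same_point (quad_space n) L x0 (crs (Psi D u (pz w0))) := same_config_crs sz.
have Wz : WZ w0.
  by split=> //; apply: basic_same bWg Wg0 (rM _ W1) (same_point_trans sw0 (rS _ W1)).
exists w0; split=> //; have sg : same_point (psi x0) (ratmap_eval idfun g w0).
  apply: same_point_trans (gS _ Wz); apply: (morphism_same psi_mor) => //; exact: good_Mbar.
have Wf1 : Wf (ratmap_eval idfun g w0) by apply: basic_same bWf Wf0 (gY _ Wz) sg.
split=> //; have [_ s1] := hf0 _ Wf1.
have [W'x _] := pf_crs p0 x0 good0 (same_point_refl _).
apply: W'same W'x (f0M _ Wf1) _; apply: same_point_trans (same_point_sym s1).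
by apply: same_point_trans sw0 (same_point_sym (phig _ Wz)).
Qed.

End Twist.

Section CyclicImage.
Variables (n m r : nat) (g : 'S_n) (D : layout n r).
Hypothesis inv : invariant_layout g D.

Lemma layout_pow k : (forall i, inO D ((g ^+ k)%g i) = inO D i) /\
  forall i, sgn D ((g ^+ k)%g i) = sgn D i (+) (odd k && switch D).
Proof.
have [hO hs] := inv; elim: k => [|k [ihO ihs]].
  by split=> i; rewrite expg0 perm1 ?addbF.
split=> i; rewrite expgSr permM; first by rewrite hO.
by rewrite hs ihs -addbA /=; case: odd; case: switch.
Qed.

Variable n0 : (0 < n)%N.

(** The exchange of halves is read off one marked point, which makes it a function of the
    permutation and not of its exponent as a power of the generator. *)
Definition flips (h : 'S_n) : bool := sgn D (h (Ordinal n0)) (+) sgn D (Ordinal n0).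

Lemma compatible_pow k : compatible D (flips (g ^+ k)%g) (g ^+ k)%g.
Proof.
have [hO hs] := layout_pow k.
have -> : flips (g ^+ k)%g = odd k && switch D by rewrite /flips hs addbC addbA addbb.
by split=> //; [apply: perm_inj | case/andP].
Qed.

End CyclicImage.

Section RationalTwist.
Variables (F L : fieldType) (iota : {rmorphism F -> L}).
Hypothesis sc : separable_closure iota.
Local Notation Gal := (absGal iota).
Variables (n m : nat) (C : {group 'S_n}) (rho : Gal -> 'S_n).
Hypothesis n5 : (5 <= n)%N.
Hypothesis m_odd : odd m.
Hypothesis C_cyclic : cyclic C.
Hypothesis C_card : #|C| = (2 * m)%N.
Hypothesis rho_hom : galois_hom rho.
Hypothesis rho_cont : galois_continuous rho.
Hypothesis rho_in : forall s, rho s \in C.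

Let Linf := sep_closed_infinite sc.

Let rho_comm (s t : Gal) : (rho s * rho t = rho t * rho s)%g.
Proof. by have /centsP/(_ _ (rho_in s) _ (rho_in t)) := cyclic_abelian C_cyclic. Qed.

Lemma rho1 : rho (absGal1 iota) = 1%g.
Proof.
have [e he] := rho_cont (absGal1 iota).
by apply: (mulgI (rho (absGal1 iota))); rewrite -rho_hom mulg1; apply: he.
Qed.

(** The image is a subgroup of a cyclic group, hence cyclic. Its generator replaces that of [C] in
    the choice of a layout, so that the Galois group is transitive on each of its cycles. *)
Lemma image_generator : exists2 s0, (rho s0 ^+ (2 * m) = 1)%g &
  forall s, exists k, rho s = (rho s0 ^+ k)%g.
Proof.
pose I := [set h in C | boolp.asbool (exists s, rho s = h)].
have II h : (h \in I) <-> exists s, rho s = h.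
  by rewrite inE; split=> [/andP[_ /boolp.asboolP]|[s e]] //; rewrite -{1}e rho_in; apply/boolp.asboolP; exists s.
have gI : group_set I.
  apply/group_setP; split; first by apply/II; exists (absGal1 iota); apply: rho1.
  by move=> _ _ /II[s <-] /II[t <-]; apply/II; exists (absGal_comp s t).
have sIC : (group gI \subset C)%g by apply/subsetP => h; rewrite inE => /andP[].
have /cyclicP[g eg] := cyclicS sIC C_cyclic.
have /II[s0 es0] : g \in I by have := cycle_id g; rewrite -eg.
exists s0; first by rewrite -C_card expg_cardG.
move=> s; have : rho s \in <[g]>%g by rewrite -eg; apply/II; exists s.
by case/cycleP => k ->; exists k; rewrite es0.
Qed.

Variables (A : multiproj) (Y : hcoord A L -> Prop).
Hypothesis Y_twist : is_twist_Mbar rho Y.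

Lemma rational_of_layout s0 r (D : layout n r) (u : 'I_n -> 'rV[L]_(2 + r)) p :
  (forall s, exists k, rho s = (rho s0 ^+ k)%g) -> invariant_layout (rho s0) D ->
  (forall (s : Gal) i, inO D i -> map_mx s (u i) = u (rho s i)) -> good D u p ->
  rational_over iota Y.
Proof.
move=> gen inv hu gp; have n0 : (0 < n)%N by apply: leq_trans n5.
have compat (s : Gal) : compatible D (flips D n0 (rho s)) (rho s).
  by have [k ->] := gen s; apply: compatible_pow.
have [B uB hB] := twisted_basis sc rho_hom rho_cont
  (act_ord_comp n5 rho_hom rho_comm compat) (act_ord_inj compat).
have [cY [phi [[phi_mor [psi [psi_mor h1 h2]]] phi_eq]]] := Y_twist.
exact: (twist_rational sc n5 compat hu gp uB hB cY phi_mor psi_mor h1 h2 phi_eq).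
Qed.

Theorem twisted_Mbar_rational : rational_over iota Y.
Proof.
have [s0 ord0 gen] := image_generator; set g := rho s0 in ord0 gen.
have [[r [D [inv [i0 [big fix1]]]]]|[D [inv [z [zg zinj]]]]] := layout_exists n5 m_odd ord0.
  pose P := [pred i | fconnect g i0 i].
  have Pg k i : P ((g ^+ k)%g i) = P i.
    rewrite -iter_perm !inE; apply/idP/idP => h; last by apply: connect_trans h (fconnect_iter _ _ _).
    by apply: connect_trans h _; rewrite fconnect_sym ?fconnect_iter //; apply: perm_inj.
  have pow k : exists s, rho s = (g ^+ k)%g.
    elim: k => [|k [s e]]; first by exists (absGal1 iota); rewrite rho1.
    by exists (absGal_comp s s0); rewrite rho_hom e expgSr.
  have Pi0 : P i0 by apply: connect0.
  have Prho s i : P (rho s i) = P i by have [k ->] := gen s; apply: Pg.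
  have Ptr i : P i -> exists s, rho s i0 = i.
    by move=> /iter_findex e; have [s hs] := pow (findex g i0 i); exists s; rewrite hs -iter_perm.
  have [y [hy inj out]] := twisted_function sc rho_hom rho_cont rho_comm Pi0 Prho Ptr.
  have moved i : P i -> g i != i.
    move=> Pi; apply: contraTneq big => e; rewrite -leqNgt.
    have st k : iter k g i = i by elim: k => //= k ->.
    have fs : connect_sym (frel g) by apply/fconnect_sym/perm_inj.
    have ei0 : i0 = i.
      by have /iter_findex : fconnect g i i0 by [rewrite fs; exact: Pi]; rewrite st.
    rewrite -(cards1 i); apply: subset_leq_card; apply/subsetP => j; rewrite ei0 !inE.
    by move=> /iter_findex <-; rewrite st.
  (* The Galois group fixes 0 but moves the nodes of a nontrivial orbit, so 0 remains free for the
     node outside the orbit. *)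
  have y0 i : P i -> y i != 0.
    move=> Pi; apply: contraTneq (moved i Pi) => e; rewrite negbK; apply/eqP/inj => //.
      by have := Pg 1%N i; rewrite expg1 => ->.
    by rewrite -hy e rmorph0.
  have yinj s a b : s || switch D -> y (nodes D s a) = y (nodes D s b) -> a = b.
    move=> hs e; apply: (nodes_inj hs); have [Oa _] := nodes_in a hs; have [Ob _] := nodes_in b hs.
    case: (boolP (P (nodes D s a))) => Pa; case: (boolP (P (nodes D s b))) => Pb.
    - exact: inj.
    - by move: (y0 _ Pa); rewrite e out ?eqxx.
    - by move: (y0 _ Pb); rewrite -e out ?eqxx.
    - exact: fix1.
  pose u i : 'rV[L]_(2 + r) := \row_j y i ^+ j.
  have [p gp] : exists p, good D u p := good_of_powers Linf (fun s hs a b => @yinj s a b hs).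
  apply: (rational_of_layout gen inv _ gp) => s i _.
  by apply/rowP => j; rewrite !mxE rmorphXn hy.
pose u i : 'rV[L]_(2 + 0) := nth 0 [:: row2 1 0; row2 0 1; row2 1 1] (z i).
have hab s : s || switch D -> framing u (nodes D s) 0.
  by move=> hs; apply: (framing_three (zinj s hs)).
have [p gp] := good_of_framings Linf hab.
apply: (rational_of_layout gen inv _ gp) => s i Oi.
have [k e] := gen s; have hz : z ((g ^+ k)%g i) = z i.
  elim: k {e} => [|k ih]; first by rewrite expg0 perm1.
  by rewrite expgSr permM zg ?ih // (layout_pow inv k).1.
rewrite /u e hz; case: (ord3 (z i)) => -> /=; by rewrite map_row2 ?rmorph0 ?rmorph1.
Qed.

End RationalTwist.

(** * Stable linearization *)

Section Separation.
Variables (L : fieldType) (n : nat).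
Hypothesis Linf : forall s : seq L, exists x, x \notin s.
Hypothesis n5 : (5 <= n)%N.
Let n3 : (3 <= n)%N := leq_trans (isT : 3 <= 5)%N n5.
Implicit Types (x : hcoord (quad_space n) L).

Lemma infinite_inj (T : finType) : exists t : T -> L, injective t.
Proof.
have [s us sz] : exists2 s : seq L, uniq s & size s = #|T|.
  elim: #|T| => [|k [s us <-]]; first by exists [::].
  by have [z zs] := Linf s; exists (z :: s) => //=; rewrite zs.
exists (fun a => nth 0 s (enum_rank a)) => a b /eqP.
by rewrite nth_uniq ?sz // => /eqP /val_inj /enum_rank_inj.
Qed.

Definition cr x (q : quad n) : L := x (q, 0) / x (q, 1).

Lemma cr_same x y q : @same_point (quad_space n) L x y -> cr x q = cr y q.
Proof. by case=> c [c0 e]; rewrite /cr !e /= -mulf_div mulfV ?mul1r. Qed.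

(* Each permutation h carries the label of i to that of h i; k is an extra indeterminate. *)
Definition label x (k : L) (i : 'I_n) : L := \prod_(q : quad n | val q 0 == i) (k - cr x q).

Lemma label_same x y k : @same_point (quad_space n) L x y -> label x k =1 label y k.
Proof. by move=> s i; apply: eq_bigr => q _; rewrite (cr_same q s). Qed.

Lemma perm_quadK (h : 'S_n) : cancel (perm_quad h) (perm_quad h^-1).
Proof. by move=> q; apply/val_inj/ffunP => t; rewrite !ffunE permK. Qed.

Lemma label_perm (h : 'S_n) x k i : label (perm_act h x) k (h i) = label x k i.
Proof.
rewrite /label (reindex_inj (can_inj (perm_quadK h))) /=.
apply: eq_big => [q|q _]; first by rewrite ffunE (inj_eq perm_inj).
by rewrite /cr /perm_act /= perm_quadK.
Qed.

Definition separated x := forall q q' : quad n, (forall t, val q t != val q' 0) -> cr x q != cr x q'.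

(** Four points besides [j] are required, which uses n at least 5. *)
Lemma quad_avoiding (i j : 'I_n) : i != j -> exists2 q : quad n, val q 0 = i & forall t, val q t != j.
Proof.
move=> ij; pose s := take 4 (i :: enum (~: [set i; j])).
have us : uniq (i :: enum (~: [set i; j])).
  by rewrite /= enum_uniq mem_enum !inE eqxx.
have sz : size s = 4.
  rewrite size_takel //= -cardE; have := cardsC [set i; j]; rewrite cards2 ij card_ord.
  by move: #|_| => k; lia.
have inj : injectiveb [ffun t : 'I_4 => nth i s t].
  apply/injectiveP => a b; rewrite !ffunE => /eqP.
  by rewrite nth_uniq ?sz ?take_uniq // => /eqP /val_inj.
exists (exist (fun f : {ffun 'I_4 -> 'I_n} => is_true (injectiveb f)) _ inj); first by rewrite ffunE.
move=> t; rewrite ffunE; have /mem_take : nth i s t \in s by rewrite mem_nth ?sz.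
rewrite inE mem_enum !inE negb_or => /orP[/eqP ->//|/andP[] //].
Qed.

(** As polynomials in k the labels of i and j differ: the cross-ratio of a quadruple that starts at
    i and avoids j is a root of the first and, by separation, not of the second. *)
Lemma label_separates x : separated x -> exists k, injective (label x k).
Proof.
move=> sx; pose P i : {poly L} := \prod_(q : quad n | val q 0 == i) ('X - (cr x q)%:P).
have Pk k i : (P i).[k] = label x k i.
  by rewrite horner_prod; apply: eq_bigr => q _; rewrite hornerXsubC.
have [k] : exists k, (\prod_i \prod_(j | i != j) (P i - P j)).[k] != 0.
  apply: (poly_nonroot Linf); apply/prodf_neq0 => i _; apply/prodf_neq0 => j ij.
  have [q qi qj] := quad_avoiding ij.
  apply/eqP => /(congr1 (fun R : {poly L} => R.[cr x q])) /eqP.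
  rewrite hornerD hornerN !Pk horner0 subr_eq0 {1}/label (bigD1 q) ?qi //= subrr mul0r eq_sym.
  apply/negP; apply/prodf_neq0 => q' /eqP e; rewrite subr_eq0; apply: sx => t; by rewrite e.
rewrite horner_prod => /prodf_neq0 h; exists k => i j e; apply/eqP/negPn/negP => ij.
have := h i isT; rewrite horner_prod => /prodf_neq0/(_ j ij).
by rewrite hornerD hornerN !Pk e subrr eqxx.
Qed.

(** Two configurations that differ only in the first point of [q'] have the same cross-ratio at [q],
    which omits that point, but different ones at [q']. So the cross-ratios at [q] and [q'] cannot
    agree on both. *)
Lemma separated_generic : generically (@Mbar L n) separated.
Proof.
pose q0 := some_quad (ltnW n5).
have irr : irreducible_set (@Mbar L n) := good_families_irreducible Linf (Mbar_families L n3).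
have bS := basic_smooth Linf n3 q0 (@idfun L : {rmorphism L -> L}).
have [t tinj] := infinite_inj (option 'I_n).
pose Z (b : option 'I_n) i : 'rV[L]_2 := row2 (t (if b == Some i then None else Some i)) 1.
have brZ b i j : br (Z b i) (Z b j) = t (if b == Some i then None else Some i) - t (if b == Some j then None else Some j).
  by rewrite br_row2 mulr1 mul1r.
have dZ b : distinct_pts (Z b).
  move=> i j ij; rewrite brZ subr_eq0; apply: contraNneq ij => /tinj.
  case: (b =P Some i) => [->|_]; case: eqP => //; first by case=> ->.
  by move=> _ [->].
pose I := [seq p : quad n * quad n <- enum {: quad n * quad n} | [forall s, val p.1 s != val p.2 0]].
have gen : forall p, p \in I -> generically (@Mbar L n) (fun x => cr x p.1 != cr x p.2).
  move=> [q q']; rewrite mem_filter => /andP[/forallP /= qq' _].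
  have b : basic_open idfun (@smooth_locus L n) (fun x => smooth_locus x /\ cr x q - cr x q' != 0).
    apply: basic_step; apply: regularB; apply: (@regular_coord (quad_space n)) => //;
      move=> x /smooth_nonzero; exact.
  suff [b' hb'] : exists b', cr (crs (Z b')) q - cr (crs (Z b')) q' != 0.
    apply: generically_mono (generically_basic (basic_trans bS b) _) => [x _ [_]|].
      by rewrite subr_eq0.
    by exists (crs (Z b')); split=> //; apply: crs_smooth.
  apply: NNPP => H.
  have e b' : cr (crs (Z b')) q = cr (crs (Z b')) q'.
    by apply/eqP; rewrite -subr_eq0; apply/negPn/negP => h; apply: H; exists b'.
  have eq : cr (crs (Z None)) q = cr (crs (Z (Some (val q' 0)))) q.
    have ez s : Z (Some (val q' 0)) (val q s) = Z None (val q s).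
      by rewrite /Z /=; case: eqP => // -[e']; move: (qq' s); rewrite -e' eqxx.
    by rewrite /cr /crs /= !ez.
  move: eq; rewrite !e /cr /crs /= !brZ /= eqxx.
  have nq s s' : s != s' -> (Some (val q' s) == Some (val q' s')) = false.
    by move=> ss; apply: negbTE; apply: contra ss => /eqP[/(injectiveP _ (valP q'))] ->.
  rewrite !nq //; have inj s s' : s != s' -> t (Some (val q' s)) - t (Some (val q' s')) != 0.
    by move=> /nq /eqP h; rewrite subr_eq0; apply/eqP => /tinj.
  have nN s : t None - t (Some (val q' s)) != 0 by rewrite subr_eq0; apply/eqP => /tinj.
  move/eqP; rewrite eqr_div ?mulf_neq0 ?inj //; apply/negP.
  rewrite -subr_eq0; set a := t (Some (val q' 0)); set b1 := t (Some (val q' 1)).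
  set c := t (Some (val q' 2)); set d := t (Some (val q' 3)).
  rewrite (_ : _ - _ = (b1 - d) * (b1 - c) * ((t None - a) * (d - c))); last by ring.
  by rewrite !mulf_neq0 ?inj //; apply: nN.
apply: generically_mono (generically_all irr _ gen) => [x _ h q q' qq'|].
  by apply: (h (q, q')); rewrite mem_filter mem_enum andbT; apply/forallP.
by exists (crs (Z None)); apply: crs_Mbar n3.
Qed.

End Separation.

Definition powers_mx (L : fieldType) n (y : 'I_n -> L) : 'M[L]_n := \matrix_(i, j) y i ^+ j.

Lemma powers_mx_unit (L : fieldType) n (y : 'I_n -> L) : injective y -> powers_mx y \in unitmx.
Proof.
move=> yinj; have -> : powers_mx y = (Vandermonde n (\row_j y j))^T.
  by apply/matrixP => i j; rewrite !mxE.
rewrite unitmx_tr unitmxE unitfE det_Vandermonde; apply/prodf_neq0 => i _.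
apply/prodf_neq0 => j ij; rewrite !mxE subr_eq0; apply: contraTneq ij => /yinj ->.
by rewrite ltnn.
Qed.

Lemma basic_injective (A : multiproj) (K L : fieldType) (iota : {rmorphism K -> L}) n
    (W : hcoord A L -> Prop) (y : hcoord A L -> 'I_n -> L) :
  (forall i, regular iota W (fun x => y x i)) ->
  basic_open iota W (fun x => W x /\ injective (y x)).
Proof.
move=> hy; have := @basic_all A K L iota W _ [seq p <- enum {: 'I_n * 'I_n} | p.1 != p.2]
  (fun p x => y x p.1 - y x p.2) (fun p _ => regularB (hy p.1) (hy p.2)).
apply: basic_eq => x; split=> -[Wx h]; split=> //.
  move=> i j e; apply/eqP/negPn/negP => ij.
  by have := h (i, j); rewrite mem_filter mem_enum ij /= e subrr eqxx => /(_ isT).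
move=> [i j]; rewrite mem_filter => /andP[/= ij _]; rewrite subr_eq0.
by apply: contraNneq ij => /h ->.
Qed.

(** * The permutation representation on the target *)

Section PermutationModel.
Variables (F L : fieldType) (iota : {rmorphism F -> L}).
Variables (n r : nat) (C : {group 'S_n}) (D : layout n r) (fl : 'S_n -> bool).
Hypothesis n0 : (0 < n)%N.
Hypothesis compat : forall a, a \in C -> compatible D (fl a) a.

(** Affine coordinates of the target: a fixed one for the indeterminate of the labels, one for each
    marked point, and the parameters in use. *)
Definition model_ix := (option 'I_n + {x : param_ix n r | used D x})%type.

Definition move (a : 'S_n) (k : model_ix) : model_ix := match k with
  | inl None => inl None
  | inl (Some i) => inl (Some (a i))
  | inr t => inr (act_used (fl a) a t) end.

Let flM a b : a \in C -> b \in C -> fl (a * b)%g = fl b (+) fl a.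
Proof.
move=> aC bC; have [_ _ _ ha] := compat aC; have [_ _ _ hb] := compat bC.
have [_ _ _ hab] := compat (groupM aC bC).
by have := hab (Ordinal n0); rewrite permM hb ha -addbA => /addbI <-; rewrite addbC.
Qed.

Let fl1 : fl 1%g = false.
Proof. by have := flM (group1 C) (group1 C); rewrite mulg1 addbb. Qed.

Lemma moveM a b k : a \in C -> b \in C -> move (a * b)%g k = move b (move a k).
Proof.
move=> aC bC; case: k => [[i|]|t] //=; first by rewrite permM.
congr inr; apply/val_inj; have ca := compat aC; have cb := compat bC; have cab := compat (groupM aC bC).
rewrite (val_act_used _ cab) (val_act_used _ cb) (val_act_used _ ca) param_act_comp flM //.
by case: (val t) => [[[s ab]|j]|i] //=; rewrite permM.
Qed.

Lemma move1 k : move 1%g k = k.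
Proof.
case: k => [[i|]|t] //=; first by rewrite perm1.
congr inr; apply/val_inj; rewrite (val_act_used _ (compat (group1 C))) fl1.
by case: (val t) => [[[s ab]|j]|i] //=; rewrite ?addbF ?perm1.
Qed.

Definition move_ord (a : 'S_n) (j : 'I_#|{: model_ix}|.+1) : 'I_#|{: model_ix}|.+1 :=
  if unlift ord0 j is Some k then lift ord0 (enum_rank (move a (enum_val k))) else ord0.

Lemma move_ordM a b j : a \in C -> b \in C -> move_ord (a * b)%g j = move_ord b (move_ord a j).
Proof.
move=> aC bC; rewrite {1 3}/move_ord; case: unliftP => [k|] _; last by rewrite /move_ord unlift_none.
by rewrite /move_ord liftK enum_rankK moveM.
Qed.

Lemma move_ord1 j : move_ord 1%g j = j.
Proof. by rewrite /move_ord; case: unliftP => [k|] -> //; rewrite move1 enum_valK. Qed.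

Definition model_mx (a : 'S_n) : 'M[F]_(#|{: model_ix}|.+1) := \matrix_(i, j) (move_ord a i == j)%:R.

Lemma model_repr : mx_repr C model_mx.
Proof.
split=> [|a b aC bC]; first by apply/matrixP => i j; rewrite !mxE move_ord1.
apply/matrixP => i j; rewrite !mxE (bigD1 (move_ord a i)) //= !mxE eqxx mul1r move_ordM //.
by rewrite big1 ?addr0 // => k hk; rewrite !mxE eq_sym (negPf hk) mul0r.
Qed.

Definition model := MxRepresentation model_repr.
Local Notation P := (projspace #|{: model_ix}|).

Lemma proj_act_move a (w : hcoord P L) j : a \in C -> proj_act iota model a w (move_ord a j) = w j.
Proof.
move=> aC; rewrite /proj_act mxE (bigD1 j) //= !mxE eqxx rmorph1 mulr1.
rewrite big1 ?addr0 // => k kj; rewrite !mxE (_ : _ == _ = false) ?rmorph0 ?mulr0 //.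
apply: contraNF kj => /eqP /(congr1 (move_ord a^-1)).
by rewrite -!move_ordM ?groupV // mulgV !move_ord1 => ->.
Qed.

Lemma proj_act_hom_pt a (f f' : model_ix -> L) : a \in C -> (forall k, f' (move a k) = f k) ->
  proj_act iota model a (hom_pt f) = hom_pt f'.
Proof.
move=> aC h; apply: boolp.funext => j.
have -> : j = move_ord a (move_ord a^-1 j) by rewrite -move_ordM ?groupV // mulVg move_ord1.
rewrite proj_act_move //; move: (move_ord _ j) => {}j; rewrite /move_ord /hom_pt.
by case: unliftP => [k|] _; rewrite ?unlift_none ?liftK ?enum_rankK ?h.
Qed.

Lemma proj_act_same a (w w' : hcoord P L) : same_point w w' ->
  same_point (proj_act iota model a w) (proj_act iota model a w').
Proof.
case=> c [c0 e]; exists c; split=> // j; rewrite /proj_act !mxE mulr_sumr; apply: eq_bigr => k _.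
by rewrite !mxE e mulrA.
Qed.

End PermutationModel.

(** * Equivariant birational maps between the product and the representation *)

Section StableLinearization.
Variables (F L : fieldType) (iota : {rmorphism F -> L}).
Hypothesis Linf : forall s : seq L, exists x, x \notin s.
Variables (n r : nat) (C : {group 'S_n}) (D : layout n r) (fl : 'S_n -> bool).
Hypothesis n5 : (5 <= n)%N.
Hypothesis compat : forall a, a \in C -> compatible D (fl a) a.

Let n0 : (0 < n)%N := leq_trans (isT : 0 < 5)%N n5.
Let n1 : (1 < n)%N := leq_trans (isT : 1 < 5)%N n5.
Let n3 : (3 <= n)%N := leq_trans (isT : 3 <= 5)%N n5.
Let q0 := some_quad (ltnW n5).

Local Notation T := (model_ix D).
Local Notation Q := (quad_space n).
Local Notation S := (projspace #|{: option 'I_n}|).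
Local Notation P := (projspace #|{: T}|).
Local Notation A := (prod_mp Q S).
Local Notation NC := (normal_config n3 q0).

Let fst_pt (x : hcoord A L) : hcoord Q L := fun j => x (inl j).
Let snd_pt (x : hcoord A L) : hcoord S L := fun j => x (inr j).
Let X : hcoord A L -> Prop := prod_set (@Mbar L n) (@is_point S L).

Let powers (v : 'I_n -> L) i : 'rV[L]_(2 + r) := \row_j v i ^+ j.

Let lab x := label (fst_pt x) (affine (snd_pt x) None).
(** The polynomial whose coefficients are the n remaining coordinates of the second factor,
    evaluated at the labels. For distinct labels the Vandermonde matrix is invertible, so the n
    values can replace the coefficients as coordinates. The group fixes the coefficients and
    permutes the values, and the values are at the same time the interpolation nodes. *)
Let lin x i := \sum_(j < n) lab x i ^+ j * affine (snd_pt x) (Some j).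

Let W1 x := [/\ X x, smooth_locus (fst_pt x) & snd_pt x ord0 != 0].

Let bW1 : basic_open iota X W1.
Proof.
pose e : coord_ring A F := \prod_(j : coords Q) 'X_(enum_rank (inl j : coords A)) *
  'X_(enum_rank (inr ord0 : coords A)).
exists (fun b => \sum_(j : coords Q) (block (inl j : coords A) == b) + (inr tt == b))%N, e; split.
  by apply: mhM; [apply: mh_prod => j _; apply: mhX | apply: (@mhX A F (inr ord0))].
move=> x; rewrite mh_evalM mh_eval_prod (@mh_evalX A F L iota x (inr ord0)) mulf_eq0 negb_or.
split=> [[Xx /(smooth_locusP Linf n3 q0)[_ x0] ->]|[Xx /andP[/prodf_neq0 h x0]]].
  split=> //; rewrite andbT; apply/prodf_neq0 => j _; rewrite (@mh_evalX A F L iota x (inl j)).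
  exact: x0.
split=> //; apply/(smooth_locusP Linf n3 q0); split=> [|j]; first by case: Xx.
by have := h j isT; rewrite (@mh_evalX A F L iota x (inl j)).
Qed.

Let regular_snd W t : (forall x, W x -> W1 x) -> regular iota W (fun x => affine (snd_pt x) t).
Proof. by move=> h; apply: (@regular_coord A) => // x /h[]. Qed.

Let regular_cr W q : (forall x, W x -> W1 x) -> regular iota W (fun x => cr (fst_pt x) q).
Proof.
by move=> h; apply: (@regular_coord A) => // x /h[_ s _]; apply: (smooth_nonzero _ s).
Qed.

Let regular_lab W i : (forall x, W x -> W1 x) -> regular iota W (fun x => lab x i).
Proof.
move=> h; apply: regular_prod => q _; apply: regularB; [exact: regular_snd | exact: regular_cr].
Qed.

Let regular_lin W i : (forall x, W x -> W1 x) -> regular iota W (fun x => lin x i).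
Proof.
move=> h; apply: regular_sum => j _; apply: regularM; last exact: regular_snd.
by apply: regularX; apply: regular_lab.
Qed.

Let W2 x := W1 x /\ injective (lab x).

Let bW2 : basic_open iota W1 W2.
Proof. by apply: basic_injective => i; apply: regular_lab. Qed.

Let regular_NC W i k : (forall x, W x -> W1 x) -> regular iota W (fun x => NC (fst_pt x) i 0 k).
Proof.
move=> h; pose p : ratmap A Q F := fun j => 'X_(enum_rank (inl j : coords A)).
have pE x : ratmap_eval iota p x = fst_pt x.
  by apply: boolp.funext => j; rewrite /ratmap_eval (@mh_evalX A F L iota x (inl j)).
apply: regular_ext (fun x _ => congr1 (fun y => NC y i 0 k) (pE x)) _.
apply: (@regular_comp _ _ _ _ _ W (@smooth_locus L n) p (fun y => NC y i 0 k)).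
- by move=> b; exists (fun c => (inl b == c : nat)) => j <-; apply: (@mhX A F (inl j)).
- by move=> x /h[_ s _]; rewrite pE.
by apply: regular_normal_config => x j; apply: smooth_nonzero.
Qed.

Let row_powers W (v : hcoord A L -> 'I_n -> L) i k : (forall i, regular iota W (fun x => v x i)) ->
  regular iota W (fun x => powers (v x) i 0 k).
Proof. by move=> h; apply: regular_ext (regularX k (h i)) => x _; rewrite [RHS]mxE. Qed.

Let same_lab x y : same_point x y -> lab x =1 lab y.
Proof.
move=> s i; rewrite /lab (affine_same (same_point_snd s)).
exact: label_same (same_point_fst s) _.
Qed.

Let same_lin x y : same_point x y -> lin x =1 lin y.
Proof.
move=> s i; apply: eq_bigr => j _; rewrite (same_lab s); congr (_ * _).
exact: affine_same (same_point_snd s) _.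
Qed.

(* In the target chart the affine coordinates are the indeterminate k of the labels, the vector of the
   values lin x i, and the parameters of the configuration; back solves the Vandermonde system. *)
Let par (w : hcoord P L) (x : param_ix n r) : L := if insub x is Some t then affine w (inr t : T) else 0.
Let vec (w : hcoord P L) i := affine w (inl (Some i) : T).
Let cfg (w : hcoord P L) := Psi D (powers (vec w)) (par w).
(** No circularity arises: the configuration is rebuilt from the values and the parameters, the
    labels are computed from it, and the coefficients come last. *)
Let tlab (w : hcoord P L) := label (crs (cfg w)) (affine w (inl None : T)).
Let coeff (w : hcoord P L) (t : option 'I_n) : L := if t is Some j then
  (invmx (powers_mx (tlab w)) *m \col_i vec w i) j 0 else affine w (inl None : T).
Let back (w : hcoord P L) : hcoord A L := fun j => match j with inl j => crs (cfg w) j | inr j => hom_pt (coeff w) j end.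

Let Z1 (w : hcoord P L) := chart_dom w /\ good D (powers (vec w)) (par w).
Let Z2 (w : hcoord P L) := Z1 w /\ injective (tlab w).

Let regular_par W x : (forall w, W w -> @chart_dom {: T} L w) -> regular iota W (fun w => par w x).
Proof.
move=> h; rewrite /par; case: insubP => [t _ _|_]; last exact: regular0.
exact: regular_affine.
Qed.

Let regular_vec W i k : (forall w, W w -> @chart_dom {: T} L w) ->
  regular iota W (fun w => powers (vec w) i 0 k).
Proof.
move=> h; apply: regular_ext (regularX k (regular_affine iota (inl (Some i) : T) h)) => w _.
by rewrite [RHS]mxE.
Qed.

Let regular_cfg j : regular iota Z1 (fun w => crs (cfg w) j).
Proof.
apply: regular_crs; apply: regular_Psi => [i k|x]; [apply: regular_vec | apply: regular_par];
  by move=> w [].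
Qed.

Let regular_tlab W i : (forall w, W w -> Z1 w) -> regular iota W (fun w => tlab w i).
Proof.
move=> h; apply: regular_prod => q _; apply: regularB.
  by apply: regular_affine => w /h[].
apply: (@regularM _ _ _ _ W (fun w => crs (cfg w) (q, 0)) (fun w => (crs (cfg w) (q, 1))^-1)).
  exact: regular_sub h (regular_cfg _).
apply: regularV (regular_sub h (regular_cfg _)) => w /h[_ [d _]]; exact: crs_neq0.
Qed.

Let bZ2 : basic_open iota (@is_point P L) Z2.
Proof.
apply: basic_trans (basic_chart {: T} iota) _.
have b1 : basic_open iota (@chart_dom {: T} L) Z1.
  by apply: basic_good => *; [apply: regular_vec | apply: regular_par].
by apply: basic_trans b1 _; apply: basic_injective => i; apply: regular_tlab.
Qed.

Let regular_back j : regular iota Z2 (fun w => back w j).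
Proof.
have Z21 w : Z2 w -> Z1 w by case.
case: j => j; first exact: regular_sub Z21 (regular_cfg j).
apply: regular_hom_pt => -[k|] /=; last by apply: regular_affine => w [[]].
apply: regular_mulmx => [a b|a b].
  apply: regular_invmx => [w [_ inj]|i l]; first exact: powers_mx_unit.
  by apply: regular_ext (regularX l (regular_tlab i Z21)) => w _; rewrite [RHS]mxE.
by apply: regular_ext (regular_affine iota (inl (Some a) : T) _) => [w _|w [[]]]; rewrite ?mxE.
Qed.

Let back_tlab w : lab (back w) =1 tlab w.
Proof.
move=> i; rewrite /lab /tlab; congr label.
exact: (affine_hom_pt (coeff w) None).
Qed.

Let back_lin w : injective (tlab w) -> lin (back w) =1 vec w.
Proof.
move=> inj i; rewrite /lin.
transitivity ((powers_mx (tlab w) *m (invmx (powers_mx (tlab w)) *m \col_i vec w i)) i 0).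
  rewrite [RHS]mxE; apply: eq_bigr => j _; rewrite back_tlab [in RHS]mxE; congr (_ * _).
  exact: (affine_hom_pt (coeff w) (Some j)).
by rewrite mulKVmx ?powers_mx_unit // mxE.
Qed.

Let back_W2 w : Z2 w -> W2 (back w).
Proof.
case=> -[_ [d _]] inj; split; last by move=> i j; rewrite !back_tlab; apply: inj.
split; last by rewrite /snd_pt /= hom_pt0 oner_neq0.
  by split; [apply: crs_Mbar | apply: hom_pt_point].
exact: crs_smooth.
Qed.

Theorem stably_linearizable_of_layout : stably_linearizable iota C (@perm_act n L) (@Mbar L n).
Proof.
have [|||U [pf [bU rpf hU uniqU]]] := @regular_parameters L n r D A F iota W2 (fun x => powers (lin x))
  (fun x => NC (fst_pt x)) n1.
- by move=> i k; apply: row_powers => j; apply: regular_lin => x [].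
- by move=> i k; apply: regular_NC => x [].
- by move=> x [[_ /(smooth_normal n3 q0)[]]].
have UW2 : forall x, U x -> W2 x := basic_sub bU.
have bXU := basic_trans (basic_trans bW1 bW2) bU.
pose tgt x (k : T) : L := match k with inl None => affine (snd_pt x) None
  | inl (Some i) => lin x i | inr t => pf x (val t) end.
have rtgt k : regular iota U (fun x => tgt x k).
  case: k => [[i|]|t] /=; last exact: rpf.
    by apply: regular_lin => x /UW2[].
  by apply: regular_snd => x /UW2[].
have [f [[Df wff] fE]] := ratmap_of_regular (B := P) (fun j => regular_hom_pt j rtgt).
have wf : ratmap_wf f by move=> b; exists Df.
have fS x : U x -> same_point (hom_pt (tgt x)) (ratmap_eval iota f x : hcoord P L).
  by move=> /fE[c c0 e]; exists (fun=> c).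
have [g [[Dg wfg] gE]] := ratmap_of_regular (B := A) regular_back.
have wg : ratmap_wf g by move=> b; exists Dg.
have gS w : Z2 w -> same_point (back w) (ratmap_eval iota g w).
  by move=> /gE[c c0 e]; exists (fun=> c).
have sameW2 x y : W2 x -> same_point x y -> W2 y.
  move=> [[[Mx px] sx x0] inj] s; have s1 := same_point_fst s; have s2 := same_point_snd s.
  split; last by move=> i j; rewrite -!(same_lab s); apply: inj.
  split; [split | |].
  - exact: Mbar_same s1 Mx.
  - exact: is_point_same s2 px.
  - exact: smooth_same s1 sx.
  by case: s2 => c [c0 e]; move: (e ord0) => /= e'; rewrite /snd_pt e' mulf_neq0.
have U_of x p v : W2 x -> good D (powers v) p -> lin x =1 v ->
    @same_point Q L (fst_pt x) (crs (Psi D (powers v) p)) ->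
    U x /\ forall k, used D k -> pf x k = p k.
  move=> Wx gp ev s; have ev' : lin x = v := boolp.funext ev; apply: uniqU => //.
    by rewrite ev'.
  rewrite ev' (normal_config_same n3 q0 s); apply/same_config_sym/normal_config_crs; by case: gp.
have crs_of x : U x -> @same_point Q L (fst_pt x) (crs (Psi D (powers (lin x)) (pf x))).
  move=> Ux; have [[_ sx _] _] := UW2 x Ux; have [_ s] := smooth_normal n3 q0 sx.
  by have [_ /same_config_crs] := hU x Ux; apply: same_point_trans.
have same_tgt x y : U x -> U y -> same_point x y -> tgt x =1 tgt y.
  move=> Ux Uy s [[i|]|t] /=; first exact: same_lin.
    exact: affine_same (same_point_snd s) _.
  exact: (regular_same (rpf _)).
(* A point of [U] is recovered from its image, whatever the scaling of the homogeneous coordinates;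
   the configuration may use parameters that differ outside [used], which [Psi_used] absorbs. *)
have read x w : U x -> w ord0 != 0 -> same_point (hom_pt (tgt x)) w ->
    [/\ Z2 w, affine w (inl None : T) = affine (snd_pt x) None, vec w =1 lin x &
      same_point x (back w)].
  move=> Ux w0 s; have aw k : affine w k = tgt x k by rewrite -(affine_same s) affine_hom_pt.
  have ev : vec w = lin x by apply: boolp.funext => i; apply: aw.
  have ep k : used D k -> par w k = pf x k.
    by move=> hk; rewrite /par; case: insubP => [t _ <-|]; rewrite ?aw // hk.
  have [gp sp] := Psi_used (hU x Ux).1 ep.
  have s1 : @same_point Q L (fst_pt x) (crs (cfg w)).
    by rewrite /cfg ev; apply: same_point_trans (crs_of x Ux) (same_config_crs sp).
  have el : tlab w =1 lab x.
    by move=> i; rewrite /tlab aw /= /lab; apply/esym/label_same.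
  have zw : Z2 w.
    split; last by move=> i j; rewrite !el; apply: (UW2 x Ux).2.
    split; last by rewrite ev.
    by split=> //; apply/projspace_point; exists ord0.
  split; [by [] | exact: aw _ | by move=> i; rewrite ev |].
  apply: same_point_prod => //.
  have x0 : snd_pt x ord0 != 0 by have [[]] := UW2 x Ux.
  apply: same_point_trans (hom_pt_affine x0) _; apply/same_point_eq/hom_pt_ext => -[j|] /=.
    rewrite (_ : (\col_i vec w i) = powers_mx (tlab w) *m \col_j affine (snd_pt x) (Some j)).
      by rewrite mulKmx ?powers_mx_unit ?mxE //; apply: zw.2.
    apply/colP => i; rewrite mxE ev [RHS]mxE; apply: eq_bigr => k _.
    by rewrite !mxE el.
  by rewrite aw.
have forth x : U x -> Z2 (ratmap_eval iota f x) /\ same_point x (ratmap_eval iota g (ratmap_eval iota f x)).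
  move=> Ux; have s := fS x Ux.
  have w0 : ratmap_eval iota f x ord0 != 0.
    by case: s => c [c0 e]; rewrite e hom_pt0 mulr1.
  have [zw _ _ sb] := read x _ Ux w0 s; split=> //.
  exact: same_point_trans sb (gS _ zw).
have backU w : Z2 w -> U (back w) /\ tgt (back w) =1 affine w.
  move=> zw; have [Ub ep] := U_of (back w) (par w) (vec w) (back_W2 zw) zw.1.2 (back_lin zw.2) (same_point_refl _).
  split=> // -[[i|]|t] /=; first exact: back_lin zw.2 _.
    exact: (affine_hom_pt (coeff w) None).
  by rewrite ep ?(valP t) // /par valK.
have Usame x y : U x -> same_point x y -> U y.
  by move=> Ux s; apply: basic_same bU Ux (sameW2 _ _ (UW2 x Ux) s) s.
have backw w : Z2 w -> U (ratmap_eval iota g w) /\ same_point w (ratmap_eval iota f (ratmap_eval iota g w)).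
  move=> zw; have [Ub eb] := backU w zw; have s := gS w zw; have Ug := Usame _ _ Ub s; split=> //.
  apply: same_point_trans _ (fS _ Ug).
  have w0 : w ord0 != 0 by case: zw => -[[]].
  apply: same_point_trans (hom_pt_affine w0) _; apply/same_point_eq/hom_pt_ext => k.
  by rewrite -eb; apply: same_tgt.
pose act := @act_fst Q S L _ (@perm_act n L).
(* The group fixes the second factor and permutes the labels, hence the values; the parameters
   follow by their uniqueness. *)
have Uact a x : a \in C -> U x -> U (act a x) /\ forall k, tgt (act a x) (move fl a k) = tgt x k.
  move=> aC Ux; have [[[Mx px] sx x0] inj] := UW2 x Ux.
  have ca := compat aC; have [gp sp] := hU x Ux.
  have el i : lab (act a x) (a i) = lab x i by apply: label_perm.
  have ev i : lin (act a x) (a i) = lin x i by apply: eq_bigr => j _; rewrite el.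
  have [k hk hk'] := injF_bij (@param_act_inj n r (fl a) a (@perm_inj _ a)).
  pose p' y := pf x (k y).
  have ep y : used D y -> p' (param_act (fl a) a y) = pf x y by rewrite /p' hk.
  have eu i : inO D i -> powers (lin (act a x)) (a i) = powers (lin x) i.
    by move=> _; apply/rowP => j; rewrite !mxE ev.
  have gp' := good_act ca eu ep gp; have sa := Psi_act ca eu ep gp.
  have sx' : @same_point Q L (fst_pt (act a x)) (crs (Psi D (powers (lin (act a x))) p')).
    exact: same_point_trans (perm_act_same a (crs_of x Ux)) (perm_act_config sa).
  have s' : smooth_locus (fst_pt (act a x)).
    by apply: smooth_same (same_point_sym sx') _; apply: crs_smooth; case: gp'.
  have Wx : W2 (act a x).
    split; last first.
      move=> i j; rewrite -[i](permKV a) -[j](permKV a) !el => /inj e.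
      by rewrite e.
    split=> //; split=> //; by have [sub _] := Mbar_families L n3; apply: sub.
  have [Ua e] := U_of _ _ _ Wx gp' (fun _ => erefl) sx'; split=> // -[[i|]|t] //=.
  by rewrite e (val_act_used _ ca) ?ep ?(used_act _ ca) ?(valP t).
have fact a x : a \in C -> U x -> same_point (ratmap_eval iota f (act a x))
    (proj_act iota (model F n0 compat) a (ratmap_eval iota f x)).
  move=> aC Ux; have [Ua e] := Uact a x aC Ux.
  apply: same_point_trans (same_point_sym (fS _ Ua)) _.
  rewrite -(proj_act_hom_pt iota n0 compat aC e).
  exact: proj_act_same (fS x Ux).
(* For fixed distinct nodes [v], irreducibility gives a configuration that is separated and has good
   parameters. A suitable k makes its labels distinct, and the coefficients are then solved for so
   that the values are [v]. *)
have [x0 Ux0] : exists x, U x.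
  have [v vinj] := infinite_inj Linf 'I_n.
  have [p gp] : exists p, good D (powers v) p.
    by apply: (good_of_powers Linf) => s hs a b /vinj /(nodes_inj hs).
  have bS := basic_smooth Linf n3 q0 (@idfun L : {rmorphism L -> L}).
  have [|||U' [pf' [bU' _ hU' uniqU']]] := @regular_parameters L n r D Q L idfun (@smooth_locus L n)
    (fun=> powers v) NC n1.
  - by move=> i k; apply: regular_const.
  - by move=> i k; apply: regular_normal_config => x j; apply: smooth_nonzero.
  - by move=> x /(smooth_normal n3 q0)[].
  have gU' : generically (@Mbar L n) U'.
    apply: generically_basic (basic_trans bS bU') _; exists (crs (Psi D (powers v) p)).
    have [] // := uniqU' (crs (Psi D (powers v) p)) p.
      by apply: crs_smooth; case: gp.
    by apply/same_config_sym/normal_config_crs; case: gp.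
  have irr := good_families_irreducible Linf (Mbar_families L n3).
  have [x Mx [Ux sx]] := generically_ex (generically_and irr gU' (separated_generic Linf n5)).
  have [k kinj] := label_separates Linf n5 sx.
  have Vu := powers_mx_unit kinj.
  pose c := invmx (powers_mx (label x k)) *m \col_i v i.
  pose z (t : option 'I_n) := if t is Some j then c j 0 else k.
  pose y : hcoord A L := fun j => match j with inl j => x j | inr j => hom_pt z j end.
  have ay t : affine (snd_pt y) t = z t := affine_hom_pt z t.
  have ly i : lab y i = label x k i by rewrite /lab ay.
  have Wy : W2 y.
    split; last by move=> i j; rewrite !ly; apply: kinj.
    split; [by split=> //; apply: hom_pt_point | exact: basic_sub bU' _ Ux |].
    by rewrite /snd_pt /= hom_pt0 oner_neq0.
  have vy : lin y =1 v.
    move=> i; transitivity ((powers_mx (label x k) *m c) i 0).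
      by rewrite [RHS]mxE; apply: eq_bigr => j _; rewrite ly ay [in RHS]mxE.
    by rewrite mulKVmx // mxE.
  exists y; have [gx sx'] := hU' x Ux.
  have [_ s1] := smooth_normal n3 q0 (basic_sub bU' Ux).
  by case: (U_of y (pf' x) v Wy gx vy (same_point_trans s1 (same_config_crs sx'))).
have irrX : irreducible_set X.
  exact: (good_families_irreducible Linf (good_families_prod (Mbar_families L n3) (projspace_families L _))).
have irrP := good_families_irreducible Linf (projspace_families L #|{: T}|).
exists #|{: option 'I_n}|, #|{: T}|, (model F n0 compat), U, Z2, f, g; split.
- split=> //; split; try exact: basic_open_over.
    apply: (generically_dense irrX); apply: generically_basic (basic_openL bXU) _; by exists x0.
  apply: (generically_dense irrP); apply: generically_basic (basic_openL bZ2) _.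
  by exists (ratmap_eval iota f x0); case: (forth x0 Ux0).
- by move=> a x aC /(Uact a x aC)[].
(* Up to scalars [w] is the image of a point of the stable set [U], and the map is equivariant
   there. *)
- move=> a w aC zw; have [Ug s] := backw w zw; have [Ua _] := Uact a _ aC Ug.
  have s' := same_point_trans (fact a _ aC Ug) (proj_act_same iota n0 compat a (same_point_sym s)).
  have [zf _] := forth _ Ua; have pt := is_point_same s' (basic_sub bZ2 zf).
  exact: (basic_same bZ2 zf pt s').
- exact: fact.
Qed.

End StableLinearization.

Theorem Mbar_stably_linearizable (n m : nat) (C : {group 'S_n}) (F L : fieldType)
    (iota : {rmorphism F -> L}) :
  (5 <= n)%N -> odd m -> cyclic C -> #|C| = (2 * m)%N -> separable_closure iota ->
  stably_linearizable iota C (@perm_act n L) (@Mbar L n).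
Proof.
move=> n5 m_odd /cyclicP[g eC] C_card sc; have n0 : (0 < n)%N by apply: leq_trans n5.
have g_ord : (g ^+ (2 * m) = 1)%g by rewrite -C_card expg_cardG // eC cycle_id.
have [r [D inv]] : exists r (D : layout n r), invariant_layout g D.
  by have [[r [D [inv _]]]|[D [inv _]]] := layout_exists n5 m_odd g_ord; [exists r, D | exists 0%N, D].
apply: (stably_linearizable_of_layout iota (sep_closed_infinite sc) n5 (D := D) (fl := flips D n0)) => a.
by rewrite eC => /cycleP[k ->]; apply: compatible_pow.
Qed.

Local Close Scope ring_scope.

Theorem corollary20 (n m : nat) (C : {group 'S_n})
  (hn : 5 <= n) (hm : odd m) (hC : cyclic C) (hCm : #|C| = 2 * m) :
  (forall (F L : fieldType) (iota : {rmorphism F -> L})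
      (rho : absGal iota -> 'S_n),
    separable_closure iota ->
    galois_hom rho -> galois_continuous rho -> (forall s, rho s \in C) ->
    forall (A : multiproj) (Y : hcoord A L -> Prop),
      is_twist_Mbar rho Y -> rational_over iota Y)
  /\
  (forall (F L : fieldType) (iota : {rmorphism F -> L}),
    separable_closure iota ->
    stably_linearizable iota C (@perm_act n L) (@Mbar L n)).
Proof.
split=> [F L iota rho sc rho_hom rho_cont rho_in A Y tw|F L iota sc].
  exact: (twisted_Mbar_rational sc hn hm hC hCm rho_hom rho_cont rho_in tw).
exact: Mbar_stably_linearizable hn hm hC hCm sc.
Qed.
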